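(* Let $A=\bigoplus_{n\ge 0}A_n$ be a finitely generated graded algebra over an algebraically closed field $k=A_0$ ($A$ need not be standard graded). Assume $\dim A=d\ge 2$ and that $A$ is Cohen-Macaulay. Further assume: (1) there exists a Noether normalization $T=k[X_1,\ldots,X_d]$ of $A$ with $\deg X_1=\cdots=\deg X_d=m$; (2) for every $T$-regular sequence $u_1,\ldots,u_{d-1}\in T_m$ we have $\sharp\operatorname{Ass}^{(d-1)}_A\bigl(A/(u_1,\ldots,u_{d-1})A\bigr)=1$. If $R$ is a graded ring such that we have inclusions of graded rings $T\subseteq R\subseteq A$ and $\operatorname{grade}(T_+,R)\ge d-1$, then $A_1^*(R)$, the first graded Chow group of $R$, is a torsion group.
   Context: A Noether normalization $T=k[X_1,\ldots,X_d]$ of $A$ is here a graded polynomial subring, generated by homogeneous algebraically independent elements, over which $A$ is a finite module. $T_m$ is the degree $m$ component of $T$, $T_+=\bigoplus_{n>0}T_n$, and $\operatorname{grade}(T_+,R)$ is the grade of the ideal $T_+$ on the $T$-module $R$. $\operatorname{Ass}^{(i)}_A(M)$ denotes the set of associated primes of the $A$-module $M$ of height $i$, and $\sharp$ denotes cardinality. For a graded affine algebra $R$ over a field (here $R$ is a finite $T$-module, hence affine), the graded Chow groups are defined as follows, where $\dim$ is Krull dimension. $Z_i^*(R)$ is the free abelian group with basis the symbols $[R/P]$, $P$ a homogeneous prime ideal of $R$ with $\dim R/P=i$. For a homogeneous prime $Q$ with $\dim R/Q=i+1$ and a homogeneous element $x\in R\setminus Q$, put $\operatorname{div}(Q,x)=\sum_{\dim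 R/P=i}\operatorname{length}\bigl(((R/Q)/x(R/Q))_P\bigr)[R/P]$; all primes $P$ occurring with nonzero coefficient are homogeneous, so $\operatorname{div}(Q,x)\in Z_i^*(R)$. The graded Chow group $A_i^*(R)$ is the quotient of $Z_i^*(R)$ by the subgroup generated by all $\operatorname{div}(Q,x)$ with $Q$ a homogeneous prime, $\dim R/Q=i+1$, and $x\notin Q$ homogeneous. *)

(* Defs.v *)
From HB Require Import structures.
From mathcomp Require Import all_boot all_order all_algebra.
From mathcomp Require Import boolp classical_sets functions cardinality fsbigop.
From mathcomp Require Import freeg ring.
(* The notations of mpoly clash with those of classical_sets. *)
From mathcomp Require Import -(notations) mpoly.
Set Implicit Arguments.
Unset Strict Implicit.
Unset Printing Implicit Defensive.
Import GRing.Theory.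
Local Open Scope classical_set_scope.
Local Open Scope ring_scope.
Local Open Scope quotient_scope.

(* An ideal of a commutative ring S is a submodule of the S-module S^o. *)

Section Submodules.
Variables (S : comPzRingType) (V : lmodType S).

Definition submodule (N : set V) : Prop :=
  N 0 /\ forall a x y, N x -> N y -> N (a *: x + y).

Definition lspan (N : set V) : set V := smallest submodule N.

(* The S-module I V is the span of this set. *)
Definition smul (I : set S) : set V := [set a *: x | a in I & x in setT].

Definition finite_module := exists s : seq V, lspan [set` s] = setT.

Lemma lspan_submodule N : submodule (lspan N).
Proof.
split=> [M [[M0 _] _] //|a x y Nx Ny M hM].
by case: (hM) => [[_ MP] _]; apply: MP; [apply: Nx | apply: Ny].
Qed.

Definition inspan (N : set V) : {pred V} := fun x => `[< lspan N x >].

Lemma inspan_zmod_closed N : zmod_closed (inspan N).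
Proof.
have [N0 NP] := lspan_submodule N; split=> [|x y /asboolP Nx /asboolP Ny].
  exact/asboolP.
by apply/asboolP; rewrite addrC -scaleN1r; apply: NP.
Qed.

HB.instance Definition _ N :=
  GRing.isZmodClosed.Build V (inspan N) (inspan_zmod_closed N).

End Submodules.
Arguments submodule {S} V.
Arguments smul {S} V I.
Arguments finite_module {S} V.

(* V / <N>, for an arbitrary subset N of V *)
Definition lquot (S : comPzRingType) (V : lmodType S) (N : set V) : Type :=
  Quotient.quot (inspan N).

HB.instance Definition _ (S : comPzRingType) (V : lmodType S) (N : set V) :=
  EqQuotient.on (lquot N).
HB.instance Definition _ (S : comPzRingType) (V : lmodType S) (N : set V) :=
  GRing.Zmodule.on (lquot N).

Section QuotientModule.
Variables (S : comPzRingType) (V : lmodType S) (N : set V).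
Local Notation Q := (lquot N).

Lemma lquotP (x y : V) : reflect (lspan N (x - y)) (\pi_Q x == \pi_Q y).
Proof. by rewrite /Q -(@Quotient.idealrBE _ (inspan N)); apply: asboolP. Qed.

Definition lquot_scale (a : S) := lift_op1 Q ( *:%R a).

Lemma lquot_piD x y : \pi_Q (x + y) = \pi_Q x + \pi_Q y.
Proof. exact: (Quotient.pi_add (inspan N)). Qed.

Lemma lquot_piZ a x : lquot_scale a (\pi_Q x) = \pi_Q (a *: x).
Proof.
unlock lquot_scale; apply/esym/eqP/lquotP; rewrite -scalerBr.
have /lquotP h : \pi_Q x == \pi_Q (repr (\pi_Q x)) by rewrite reprK.
have [N0 NP] := lspan_submodule N.
by rewrite -[_ *: _]addr0; apply: NP; [exact: h | exact: N0].
Qed.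

Lemma lquot_scaleA a b x :
  lquot_scale a (lquot_scale b x) = lquot_scale (a * b) x.
Proof. by elim/quotW: x => x; rewrite !lquot_piZ scalerA. Qed.

Lemma lquot_scale1 : left_id 1 lquot_scale.
Proof. by elim/quotW => x; rewrite lquot_piZ scale1r. Qed.

Lemma lquot_scaleDr : right_distributive lquot_scale +%R.
Proof.
move=> a; elim/quotW => x; elim/quotW => y.
by rewrite !(=^~ lquot_piD, lquot_piZ) scalerDr.
Qed.

Lemma lquot_scaleDl x : {morph lquot_scale^~ x : a b / a + b}.
Proof.
by elim/quotW: x => x a b; rewrite !(=^~ lquot_piD, lquot_piZ) scalerDl.
Qed.

HB.instance Definition _ := GRing.Zmodule_isLmodule.Build S Q
  lquot_scaleA lquot_scale1 lquot_scaleDr lquot_scaleDl.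

End QuotientModule.

(* The ring R / <I>, for an arbitrary subset I of R *)
Definition quotr (R : comPzRingType) (I : set R) : Type :=
  lquot (I : set R^o).

HB.instance Definition _ (R : comPzRingType) (I : set R) :=
  EqQuotient.on (quotr I).
HB.instance Definition _ (R : comPzRingType) (I : set R) :=
  GRing.Zmodule.on (quotr I).

Section QuotientRing.
Variables (R : comPzRingType) (I : set R).
Local Notation Q := (quotr I).

Definition quotr_mul := lift_op2 Q *%R.

Lemma quotr_piD x y : \pi_Q (x + y) = \pi_Q x + \pi_Q y.
Proof. exact: (@lquot_piD _ _ (I : set R^o)). Qed.

Lemma quotr_piM x y : quotr_mul (\pi_Q x) (\pi_Q y) = \pi_Q (x * y).
Proof.
unlock quotr_mul; have piM a b : \pi_Q (a * b) = \pi_Q (a * repr (\pi_Q b)).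
  have := @lquot_piZ _ _ (I : set R^o) a b.
  by unlock lquot_scale => /esym.
by rewrite [RHS]piM [in RHS]mulrC [RHS]piM [in RHS]mulrC.
Qed.

Lemma quotr_mulA : associative quotr_mul.
Proof.
elim/quotW => x; elim/quotW => y; elim/quotW => z.
by rewrite !quotr_piM mulrA.
Qed.

Lemma quotr_mulC : commutative quotr_mul.
Proof. by move=> x y; unlock quotr_mul; rewrite mulrC. Qed.

Lemma quotr_mul1 : left_id (\pi_Q 1) quotr_mul.
Proof. by elim/quotW => x; rewrite quotr_piM mul1r. Qed.

Lemma quotr_mulDl : left_distributive quotr_mul +%R.
Proof.
elim/quotW => x; elim/quotW => y; elim/quotW => z.
by rewrite !(=^~ quotr_piD, quotr_piM) mulrDl.
Qed.

HB.instance Definition _ := GRing.Zmodule_isComPzRing.Build Q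
  quotr_mulA quotr_mulC quotr_mul1 quotr_mulDl.

End QuotientRing.

Definition mul_closed (S : comPzRingType) (D : set S) : Prop :=
  D 1 /\ forall s t, D s -> D t -> D (s * t).

(* The multiplicative set generated by D; it is D itself when D is the
   complement of a prime ideal. *)
Definition mspan (S : comPzRingType) (D : set S) : set S :=
  smallest (@mul_closed S) D.

Definition denom (S : comPzRingType) (D : set S) : Type :=
  {s : S | `[< mspan D s >]}.
HB.instance Definition _ (S : comPzRingType) (D : set S) :=
  Choice.on (denom D).

Section Denominators.
Variables (S : comPzRingType) (D : set S).

Lemma mspan1 : mspan D 1.
Proof. by move=> M [[M1 _] _]. Qed.

Lemma mspanM s t : mspan D s -> mspan D t -> mspan D (s * t).
Proof.
move=> Ds Dt M hM; case: (hM) => [[_ MP] _].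
by apply: MP; [apply: Ds|apply: Dt].
Qed.

Definition dval (s : denom D) : S := sval s.

Lemma denomP (s : denom D) : mspan D (dval s).
Proof. exact/asboolP/(svalP s). Qed.

Definition mkdenom s (Ds : mspan D s) : denom D :=
  exist _ s (asboolT Ds).

Definition denom1 := mkdenom mspan1.
Definition denomM (s t : denom D) := mkdenom (mspanM (denomP s) (denomP t)).

Lemma dval1 : dval denom1 = 1.
Proof. by []. Qed.

Lemma dvalM s t : dval (denomM s t) = dval s * dval t.
Proof. by []. Qed.

End Denominators.
Arguments dval : simpl never.

(* The localization D^-1 V, for an arbitrary subset D of S, is the quotient of
   V * denom D by the usual equivalence of fractions. *)
Section Fractions.
Variables (S : comPzRingType) (D : set S) (V : lmodType S).
Local Notation F := (V * denom D)%type.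
Implicit Types p q r : F.

Definition frac_eq : rel F := fun p q =>
  `[< exists2 u, mspan D u & u *: (dval q.2 *: p.1) = u *: (dval p.2 *: q.1) >].

Lemma frac_eq_equiv : equiv_class_of frac_eq.
Proof.
split=> [p|p q|q p r].
- by apply/asboolP; exists 1 => //; apply: mspan1.
- by apply/asboolP/asboolP => -[u Du e]; exists u.
- move=> /asboolP[u Du e] /asboolP[v Dv e'].
  apply/asboolP; exists (u * v * dval q.2).
    by apply: mspanM (denomP _); apply: mspanM.
  transitivity ((v * dval r.2) *: (u *: (dval q.2 *: p.1))).
    by rewrite !scalerA; congr (_ *: _); ring.
  rewrite e; transitivity ((u * dval p.2) *: (v *: (dval r.2 *: q.1))).
    by rewrite !scalerA; congr (_ *: _); ring.
  by rewrite e' !scalerA; congr (_ *: _); ring.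
Qed.

Canonical frac_eq_canonical := EquivRelPack frac_eq_equiv.

Definition frac_add p q : F :=
  (dval q.2 *: p.1 + dval p.2 *: q.1, denomM p.2 q.2).
Definition frac_opp p : F := (- p.1, p.2).
Definition frac_scale (c : S^o * denom D) p : F :=
  ((c.1 : S) *: p.1, denomM c.2 p.2).

End Fractions.

Definition locm (S : comPzRingType) (D : set S) (V : lmodType S) : Type :=
  {eq_quot (@frac_eq S D V)}.

HB.instance Definition _ (S : comPzRingType) (D : set S) (V : lmodType S) :=
  EqQuotient.on (locm D V).
HB.instance Definition _ (S : comPzRingType) (D : set S) (V : lmodType S) :=
  Choice.on (locm D V).

Section LocalizationZmodule.
Variables (S : comPzRingType) (D : set S) (V : lmodType S).
Local Notation L := (locm D V).
Local Notation F := (V * denom D)%type.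
Implicit Types p q r : F.

Lemma locmP p q : \pi_L p = \pi_L q <->
  exists2 u, mspan D u & u *: (dval q.2 *: p.1) = u *: (dval p.2 *: q.1).
Proof.
by split=> [/eqP|h]; last apply/eqP; rewrite eqmodE => *; apply/asboolP.
Qed.

Lemma locm_reprP p : exists2 u, mspan D u &
  u *: (dval (repr (\pi_L p)).2 *: p.1) = u *: (dval p.2 *: (repr (\pi_L p)).1).
Proof. by apply/locmP; rewrite reprK. Qed.

Definition locm_zero : L := \pi_L (0, denom1 D).
Definition locm_add := lift_op2 L (@frac_add S D V).
Definition locm_opp := lift_op1 L (@frac_opp S D V).

Lemma locm_piD p q :
  locm_add (\pi_L p) (\pi_L q) = \pi_L (frac_add p q).
Proof.
unlock locm_add; apply/esym/locmP; rewrite /= ?dvalM.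
have [u Du e] := locm_reprP p; have [v Dv e'] := locm_reprP q.
set p' := repr _ in e *; set q' := repr _ in e' *.
exists (u * v); first exact: mspanM.
rewrite !scalerDr; congr (_ + _).
  transitivity ((v * (dval q.2 * dval q'.2)) *: (u *: (dval p'.2 *: p.1))).
    by rewrite !scalerA; congr (_ *: _); ring.
  by rewrite e !scalerA; congr (_ *: _); ring.
transitivity ((u * (dval p.2 * dval p'.2)) *: (v *: (dval q'.2 *: q.1))).
  by rewrite !scalerA; congr (_ *: _); ring.
by rewrite e' !scalerA; congr (_ *: _); ring.
Qed.

Lemma locm_piN p : locm_opp (\pi_L p) = \pi_L (frac_opp p).
Proof.
unlock locm_opp; apply/esym/locmP; rewrite /= ?dvalM.
have [u Du e] := locm_reprP p; exists u => //.
by rewrite !scalerN e.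
Qed.

Lemma locm_addA : associative locm_add.
Proof.
elim/quotW => p; elim/quotW => q; elim/quotW => r.
rewrite !locm_piD; apply/locmP; exists 1; first exact: mspan1.
rewrite /= ?(dval1, dvalM) !scalerDr !scalerA addrA;
  congr (_ + _ + _); congr (_ *: _); ring.
Qed.

Lemma locm_addC : commutative locm_add.
Proof.
elim/quotW => p; elim/quotW => q.
rewrite !locm_piD; apply/locmP; exists 1; first exact: mspan1.
rewrite /= ?(dval1, dvalM) !scalerDr !scalerA addrC;
  congr (_ + _); congr (_ *: _); ring.
Qed.

Lemma locm_add0 : left_id locm_zero locm_add.
Proof.
elim/quotW => p; rewrite locm_piD; apply/locmP; exists 1; first exact: mspan1.
by rewrite /= ?(dval1, dvalM) scaler0 add0r !scalerA; congr (_ *: _); ring.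
Qed.

Lemma locm_addN : left_inverse locm_zero locm_opp locm_add.
Proof.
elim/quotW => p; rewrite locm_piN locm_piD.
apply/locmP; exists 1; first exact: mspan1.
by rewrite /= ?(dval1, dvalM) scalerN addNr !scaler0.
Qed.

HB.instance Definition _ := GRing.isZmodule.Build L
  locm_addA locm_addC locm_add0 locm_addN.

End LocalizationZmodule.

(* The ring D^-1 R *)
Definition locr (R : comPzRingType) (D : set R) : Type := locm D R^o.

HB.instance Definition _ (R : comPzRingType) (D : set R) :=
  EqQuotient.on (locr D).
HB.instance Definition _ (R : comPzRingType) (D : set R) :=
  GRing.Zmodule.on (locr D).

Section LocalizationScale.
Variables (S : comPzRingType) (D : set S) (V : lmodType S).
Local Notation L := (locm D V).
Local Notation K := (locr D).
Implicit Types (p q : V * denom D) (b c : S^o * denom D).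

Definition locm_scale : K -> L -> L :=
  locked (fun (c : K) (p : L) => \pi_L (frac_scale (repr c) (repr p))).

Lemma locm_piZ c p : locm_scale (\pi_K c) (\pi_L p) = \pi_L (frac_scale c p).
Proof.
unlock locm_scale; apply/esym/locmP; rewrite /= ?dvalM.
have [u Du e] := locm_reprP c; have [v Dv e'] := locm_reprP p.
set c' := repr (\pi_K c) in e *; set p' := repr _ in e' *.
exists (u * v); first exact: mspanM.
transitivity ((u * (dval c'.2 * (c.1 : S))) *: (v *: (dval p'.2 *: p.1))).
  by rewrite !scalerA; congr (_ *: _); ring.
have -> : u * (dval c'.2 * (c.1 : S)) = u * (dval c.2 * (c'.1 : S)) := e.
by rewrite e' !scalerA; congr (_ *: _); ring.
Qed.

End LocalizationScale.

Section LocalizationRing.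
Variables (R : comPzRingType) (D : set R).
Local Notation K := (locr D).

Definition locr_one : K := \pi_K (1, denom1 D).
Definition locr_mul : K -> K -> K := @locm_scale R D R^o.

Lemma locr_piM (b c : R^o * denom D) :
  locr_mul (\pi_K b) (\pi_K c) = \pi_K (frac_scale b c).
Proof. exact: (@locm_piZ R D R^o). Qed.

Lemma locr_piD (b c : R^o * denom D) :
  \pi_K b + \pi_K c = \pi_K (frac_add b c).
Proof. exact: (@locm_piD R D R^o). Qed.

Lemma locrP (b c : R^o * denom D) : \pi_K b = \pi_K c <->
  exists2 u, mspan D u & u * (dval c.2 * b.1) = u * (dval b.2 * c.1).
Proof. exact: (@locmP R D R^o). Qed.

Lemma locr_mulA : associative locr_mul.
Proof.
elim/quotW => a; elim/quotW => b; elim/quotW => c.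
rewrite !locr_piM; apply/locrP; exists 1; first exact: mspan1.
rewrite /= ?(dval1, dvalM) /GRing.scale /= ?(dval1, dvalM); ring.
Qed.

Lemma locr_mulC : commutative locr_mul.
Proof.
elim/quotW => b; elim/quotW => c.
rewrite !locr_piM; apply/locrP; exists 1; first exact: mspan1.
rewrite /= ?(dval1, dvalM) /GRing.scale /= ?(dval1, dvalM); ring.
Qed.

Lemma locr_mul1 : left_id locr_one locr_mul.
Proof.
elim/quotW => c; rewrite locr_piM.
apply/locrP; exists 1; first exact: mspan1.
rewrite /= ?(dval1, dvalM) /GRing.scale /= ?(dval1, dvalM); ring.
Qed.

Lemma locr_mulDl : left_distributive locr_mul +%R.
Proof.
elim/quotW => a; elim/quotW => b; elim/quotW => c.
rewrite !(locr_piD, locr_piM).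
apply/locrP; exists 1; first exact: mspan1.
rewrite /= ?(dval1, dvalM) /GRing.scale /= ?(dval1, dvalM); ring.
Qed.

HB.instance Definition _ := GRing.Zmodule_isComPzRing.Build K
  locr_mulA locr_mulC locr_mul1 locr_mulDl.

End LocalizationRing.

Section LocalizationModule.
Variables (S : comPzRingType) (D : set S) (V : lmodType S).
Local Notation L := (locm D V).
Local Notation K := (locr D).

Lemma locm_pi_add (p q : V * denom D) :
  \pi_L p + \pi_L q = \pi_L (frac_add p q).
Proof. exact: locm_piD. Qed.

Lemma locm_scaleA (b c : K) (x : L) :
  locm_scale b (locm_scale c x) = locm_scale (b * c) x.
Proof.
elim/quotW: b => b; elim/quotW: c => c; elim/quotW: x => x.
rewrite [_ * _]locr_piM !locm_piZ; apply/locmP; exists 1; first exact: mspan1.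
by rewrite /= ?(dval1, dvalM) !scalerA;
  congr (_ *: _); rewrite /GRing.scale /= ?(dval1, dvalM); ring.
Qed.

Lemma locm_scale1 : left_id 1 (@locm_scale S D V).
Proof.
elim/quotW => x; rewrite [X in locm_scale X]/(1 : K) locm_piZ.
apply/locmP; exists 1; first exact: mspan1.
by rewrite /= ?(dval1, dvalM) !scalerA; congr (_ *: _); ring.
Qed.

Lemma locm_scaleDr : right_distributive (@locm_scale S D V) +%R.
Proof.
elim/quotW => c; elim/quotW => x; elim/quotW => y.
rewrite !(locm_pi_add, locm_piZ).
apply/locmP; exists 1; first exact: mspan1.
rewrite /= ?(dval1, dvalM) !scalerDr !scalerA;
  congr (_ + _); congr (_ *: _); ring.
Qed.

Lemma locm_scaleDl (x : L) : {morph (@locm_scale S D V)^~ x : b c / b + c}.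
Proof.
elim/quotW: x => x; elim/quotW => b; elim/quotW => c.
rewrite locr_piD !locm_piZ locm_pi_add.
apply/locmP; exists 1; first exact: mspan1.
rewrite /= ?(dval1, dvalM) !scalerA -!scalerDl !scalerA; congr (_ *: _).
rewrite /GRing.scale /= ?(dval1, dvalM); ring.
Qed.

HB.instance Definition _ := GRing.Zmodule_isLmodule.Build K L
  locm_scaleA locm_scale1 locm_scaleDr locm_scaleDl.

End LocalizationModule.

Section RingNotions.
Variable R : comPzRingType.

Definition ideal (I : set R) : Prop := submodule R^o I.

Definition prime_ideal (P : set R) : Prop :=
  [/\ ideal P, ~ P 1 & forall x y, P (x * y) -> P x \/ P y].

Definition maximal_ideal (M : set R) : Prop :=
  [/\ ideal M, ~ M 1 & forall I, ideal I -> ~ I 1 -> M `<=` I -> I = M].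

Definition noetherian : Prop :=
  forall I, ideal I -> exists s : seq R^o, I = lspan [set` s].

End RingNotions.

Definition strict_chain T (C : set (set T)) (n : nat)
    (c : nat -> set T) : Prop :=
  (forall i, (i <= n)%N -> C (c i)) /\
  (forall i, (i < n)%N -> c i `<` c i.+1).

(* n is the supremum of the lengths of the chains in C. *)
Definition longest_chain T (C : set (set T)) (n : nat) : Prop :=
  (exists c, strict_chain C n c) /\ ~ (exists c, strict_chain C n.+1 c).

Definition krull_dim (R : comPzRingType) (n : nat) : Prop :=
  longest_chain (@prime_ideal R) n.

Definition height (R : comPzRingType) (P : set R) (n : nat) : Prop :=
  longest_chain [set Q | prime_ideal Q /\ Q `<=` P] n.

Section ModuleNotions.
Variables (S : comPzRingType) (V : lmodType S).

(* The junk value for a module of infinite length is 0. *)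
Definition mod_length : nat := xget 0%N (longest_chain (submodule V)).

Definition associated_primes : set (set S) :=
  [set P | prime_ideal P /\ exists x : V, P = [set a | a *: x = 0]].

Definition regular_seq (u : seq S) : Prop :=
  (forall i, (i < size u)%N ->
     forall x : lquot (smul V [set` take i u]), u`_i *: x = 0 -> x = 0) /\
  lspan (smul V [set` u]) <> setT.

(* grade (I, V) >= n, with grade (I, V) = +oo when I V = V *)
Definition grade_ge (I : set S) (n : nat) : Prop :=
  lspan (smul V I) = setT \/
  exists u : seq S, [/\ size u = n, [set` u] `<=` I & regular_seq u].

End ModuleNotions.
Arguments mod_length {S} V.
Arguments associated_primes {S} V.
Arguments regular_seq {S} V u.
Arguments grade_ge {S} V I n.

Definition associated_primes_height (S : comPzRingType) (V : lmodType S)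
    (n : nat) : set (set S) :=
  [set P | associated_primes V P /\ height P n].

(* In a local ring, the non-units form the maximal ideal. *)
Definition nonunits (L : comPzRingType) : set L :=
  [set x | ~ exists y, x * y = 1].

Definition depth (L : comPzRingType) (n : nat) : Prop :=
  grade_ge L^o (@nonunits L) n /\ ~ grade_ge L^o (@nonunits L) n.+1.

Definition cohen_macaulay (R : comPzRingType) : Prop :=
  noetherian R /\
  forall M : set R, maximal_ideal M ->
    exists n, krull_dim (locr (~` M)) n /\ depth (locr (~` M)) n.

Definition restrict_scalars (S R : comPzRingType) (f : {rmorphism S -> R}) : Type :=
  R.

Section RestrictionOfScalars.
Variables (S R : comPzRingType) (f : {rmorphism S -> R}).

HB.instance Definition _ := GRing.Zmodule.copy (restrict_scalars f) R.

Definition restrict_scale (a : S) (x : restrict_scalars f) :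
    restrict_scalars f :=
  f a * (x : R).

Lemma restrict_scaleA a b x :
  restrict_scale a (restrict_scale b x) = restrict_scale (a * b) x.
Proof. by rewrite /restrict_scale rmorphM mulrA. Qed.

Lemma restrict_scale1 : left_id 1 restrict_scale.
Proof. by move=> x; rewrite /restrict_scale rmorph1 mul1r. Qed.

Lemma restrict_scaleDr : right_distributive restrict_scale +%R.
Proof. by move=> a x y; apply: mulrDr. Qed.

Lemma restrict_scaleDl x : {morph restrict_scale^~ x : a b / a + b}.
Proof. by move=> a b; rewrite /restrict_scale rmorphD; apply: mulrDl. Qed.

HB.instance Definition _ := GRing.Zmodule_isLmodule.Build S (restrict_scalars f)
  restrict_scaleA restrict_scale1 restrict_scaleDr restrict_scaleDl.

End RestrictionOfScalars.

Section Gradings.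
Variable R : comPzRingType.
Implicit Type gr : nat -> set R.

Record grading gr : Prop := {
  grading0 : forall n, gr n 0;
  gradingB : forall n x y, gr n x -> gr n y -> gr n (x - y);
  grading1 : gr 0%N 1;
  gradingM : forall i j x y, gr i x -> gr j y -> gr (i + j)%N (x * y);
  grading_sum : forall x, exists (N : nat) (c : nat -> R),
    (forall n, gr n (c n)) /\ x = \sum_(n < N) c n;
  grading_direct : forall (N : nat) (c : nat -> R),
    (forall n, gr n (c n)) -> \sum_(n < N) c n = 0 ->
    forall n, (n < N)%N -> c n = 0
}.

(* The direct sum of the components of positive degree *)
Definition irrelevant gr : set R :=
  [set x | exists (N : nat) (c : nat -> R),
     (forall n, gr n (c n)) /\ x = \sum_(1 <= n < N) c n].

Definition homogeneous gr (x : R) : Prop := exists n, gr n x.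

Definition homogeneous_ideal gr (I : set R) : Prop :=
  ideal I /\
  forall (N : nat) (c : nat -> R), (forall n, gr n (c n)) ->
    I (\sum_(n < N) c n) -> forall n, (n < N)%N -> I (c n).

End Gradings.

Definition graded_inclusion (S R : comPzRingType)
    (grS : nat -> set S) (grR : nat -> set R) (f : S -> R) : Prop :=
  injective f /\ forall n x, grS n x -> grR n (f x).

Section ChowGroup.
Variables (R : comPzRingType) (gr : nat -> set R) (i : nat).

(* The homogeneous primes P with dim R/P = j *)
Definition hprime (j : nat) : Type :=
  {P : set R | `[< [/\ prime_ideal P, homogeneous_ideal gr P
                     & krull_dim (quotr P) j] >]}.
HB.instance Definition _ j := Choice.on (hprime j).

Definition chow_cycle : lmodType int := {freeg (hprime i) / int}.

(* The length over R_P of the localization at P of (R/Q) / x (R/Q).  The sum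
   in chow_div has finite support when R is noetherian. *)
Definition div_coef (Q : set R) (x : R) (P : set R) : nat :=
  mod_length (locm (~` P)
    (lquot (smul (lquot (Q : set R^o)) [set x]))).

Definition chow_div (Q : hprime i.+1) (x : R) : chow_cycle :=
  \sum_(P \in [set: hprime i]) << (div_coef (sval Q) x (sval P))%:Z *g P >>.

Definition principal_cycles : set chow_cycle :=
  [set z | exists (Q : hprime i.+1) (x : R),
     [/\ homogeneous gr x, ~ sval Q x & z = chow_div Q x]].

(* Quotient by the subgroup (i.e. the Z-submodule) generated *)
Definition chow : zmodType := lquot principal_cycles.

End ChowGroup.

Definition torsion_group (G : zmodType) : Prop :=
  forall x : G, exists2 n : nat, (0 < n)%N & x *+ n = 0.

Section PolynomialRings.
Variables (k : comNzRingType) (d : nat).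

(* The grading of k[X_1, ..., X_d] with deg X_i = e i *)
Definition mpoly_grading (e : 'I_d -> nat) (n : nat) : set (mpoly d k) :=
  [set p | forall a, a \in msupp p -> (\sum_(i < d) e i * a i)%N = n].

Variable A : comAlgType k.

Definition mpoly_eval (x : 'I_d -> A) : mpoly d k -> A :=
  mmap (GRing.in_alg A) x.

HB.instance Definition _ x := GRing.RMorphism.on (mpoly_eval x).

End PolynomialRings.

Definition fg_algebra (k : comNzRingType) (A : comAlgType k) : Prop :=
  exists (n : nat) (x : 'I_n -> A), forall a, exists p, mpoly_eval x p = a.

(* The subring k[x_1, ..., x_d] of A, identified with a polynomial ring by
   evaluation at x, is a Noether normalization of A, with deg x_i = e i. *)
Definition noether_normalization (k : comNzRingType) (A : comAlgType k)
    (gr : nat -> set A) (d : nat) (e : 'I_d -> nat) (x : 'I_d -> A) : Prop :=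
  [/\ forall i, gr (e i) (x i),
      injective (mpoly_eval x)
    & finite_module (restrict_scalars (mpoly_eval x))].
Arguments mpoly_grading k {d} e n.

(* Main.v *)
(* A homogeneous prime [P] of [R] with [dim R/P = 1] contracts to a prime
   [p] of [T] with [dim T/p = 1]; as [k] is algebraically closed, [p] is generated by
   [d - 1] linear forms [X_i - c_i X_j]. A prime of [A] over [p] is minimal over [pA],
   and it has height [d - 1]: since [A] is Cohen-Macaulay, its minimal primes contract
   to [0], and going down holds one linear form at a time. So by (2) there is only one
   prime of [A] over [p], and [P] is the only prime of [R] over [p]. Let [u] be one of
   the linear forms and [Q] a prime of [R] over the ideal generated by the others.
   Going up from [Q] reaches a prime over [p], that is, [P]. Every homogeneous prime of
   dimension one containing [Q] and [u] lies over [p], so [div(Q, u) = n [R/P]], and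
   [n > 0]. The length [n] is finite because the rank of [R/Q] over
   [T/(Q \cap T)] is at most the number of generators of the [T]-module [A]. *)
Require Import Defs.
From HB Require Import structures.
From mathcomp Require Import all_boot all_order all_algebra.
From mathcomp Require Import boolp classical_sets functions cardinality fsbigop.
From mathcomp Require Import freeg ring.
From mathcomp Require Import -(notations) mpoly.
Import GRing.Theory.
Local Open Scope classical_set_scope.
Local Open Scope ring_scope.
Local Open Scope quotient_scope.
Set Implicit Arguments.
Unset Strict Implicit.
Unset Printing Implicit Defensive.

(** * Ideals and noetherian rings *)

(** Hypothesis (2) counts only associated primes of height exactly [d - 1]. So a prime of [A] over
    [p] must be shown to be associated and to have height both at least and at most [d - 1]. The
    lower bound is the obstacle: [A] need not be a domain, and such a prime could lie above a
    minimal prime that meets [T] nontrivially. The Cohen-Macaulay condition at the graded maximal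
    ideal excludes this, because a minimal prime is associated and so starts a chain as long as the
    depth. Every bound on dimension is a statement on chains: chains of [T] are lifted to [R] or [A]
    and compared with the given dimension of [A], which thereby bounds the chains of [T] too. Ideals
    of linear forms are kernels of substitutions. Hence they are prime, and each form is a prime
    element modulo the preceding ones, which is what a single step of going down uses. Primes
    obtained by lifting need not be homogeneous. They are replaced by [hpart], the largest
    homogeneous ideal inside, which is again prime. As [mod_length] is 0 on modules of infinite
    length, the claim [n > 0] contains the finiteness of the length. *)

Section Ideals.
Variable R : comPzRingType.
Implicit Types (I J P : set R) (x y z : R).

Lemma ideal0 I : ideal I -> I 0.
Proof. by case. Qed.

Lemma idealD I x y : ideal I -> I x -> I y -> I (x + y).
Proof. by move=> [_ h] Ix Iy; have := h 1 x y Ix Iy; rewrite scale1r. Qed.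

Lemma idealM I a x : ideal I -> I x -> I (a * x).
Proof. by move=> [I0 h] Ix; have := h a x 0 Ix I0; rewrite addr0. Qed.

Lemma idealMr I a x : ideal I -> I x -> I (x * a).
Proof. by rewrite mulrC; apply: idealM. Qed.

Lemma idealN I x : ideal I -> I x -> I (- x).
Proof. by move=> hI Ix; rewrite -mulN1r; apply: idealM. Qed.

Lemma idealB I x y : ideal I -> I x -> I y -> I (x - y).
Proof. by move=> hI Ix Iy; apply: idealD => //; apply: idealN. Qed.

Lemma idealBr I x y : ideal I -> I (x - y) -> I y -> I x.
Proof. by move=> hI h Iy; rewrite -(subrK y x); apply: idealD. Qed.

Lemma idealBl I x y : ideal I -> I (x - y) -> I x -> I y.
Proof.
move=> hI h Ix; have -> : y = x - (x - y) by rewrite opprB addrC subrK.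
exact: idealB.
Qed.

Lemma ideal_sum I (K : Type) (r : seq K) (p : pred K) (F : K -> R) :
  ideal I -> (forall i, p i -> I (F i)) -> I (\sum_(i <- r | p i) F i).
Proof.
move=> hI h; elim/big_ind: _ => [|x y|i /h //]; first exact: ideal0.
exact: idealD.
Qed.

Lemma mk_ideal I : I 0 -> (forall x y, I x -> I y -> I (x + y)) ->
  (forall a x, I x -> I (a * x)) -> ideal I.
Proof. by move=> h0 hD hM; split=> // a x y Ix Iy; apply: hD => //; apply: hM. Qed.

Lemma zero_ideal : ideal [set 0 : R].
Proof. by apply: mk_ideal => [//|x y -> ->|b x ->] /=; rewrite ?addr0 ?mulr0. Qed.

Lemma ideal_setT I : ideal I -> I 1 -> I = setT.
Proof. by move=> hI I1; apply/seteqP; split=> // x _; rewrite -[x]mulr1;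
  apply: idealM. Qed.

Lemma prime_ideal_id P : prime_ideal P -> ideal P. Proof. by case. Qed.

Lemma primeX P x n : prime_ideal P -> P (x ^+ n) -> P x.
Proof.
move=> [_ P1 hP]; elim: n => [|n IH]; first by rewrite expr0.
by rewrite exprS => /hP[].
Qed.

Lemma primeNM P x y : prime_ideal P -> ~ P x -> ~ P y -> ~ P (x * y).
Proof. by move=> [_ _ hP] nx ny /hP[]. Qed.

Lemma prime_prod P (K : Type) (r : seq K) (F : K -> R) :
  prime_ideal P -> P (\prod_(i <- r) F i) -> exists i, P (F i).
Proof.
move=> [_ P1 hP]; elim: r => [|i r IH]; first by rewrite big_nil => /P1.
by rewrite big_cons => /hP[|/IH //]; exists i.
Qed.

Definition adjoin I x : set R := [set y | exists a, I (y - a * x)].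

Lemma adjoin_ideal I x : ideal I -> ideal (adjoin I x).
Proof.
move=> hI; apply: mk_ideal => [|y z [a ha] [b hb]|c y [a ha]].
- by exists 0; rewrite mul0r subr0; apply: ideal0.
- by exists (a + b); rewrite mulrDl opprD addrACA; apply: idealD.
- by exists (c * a); rewrite -mulrA -mulrBr; apply: idealM.
Qed.

Lemma adjoin_sub I x : ideal I -> I `<=` adjoin I x.
Proof. by move=> hI y Iy; exists 0; rewrite mul0r subr0. Qed.

Lemma adjoin_gen I x : ideal I -> adjoin I x x.
Proof. by move=> hI; exists 1; rewrite mul1r subrr; apply: ideal0. Qed.

Lemma adjoin_le I J x : ideal J -> I `<=` J -> J x -> adjoin I x `<=` J.
Proof.
move=> hJ sIJ Jx y [a /sIJ h]; rewrite -(subrK (a * x) y).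
by apply: idealD => //; apply: idealM.
Qed.

Lemma lspan_ideal (N : set R^o) : ideal (lspan N).
Proof. exact: lspan_submodule. Qed.

Lemma lspan_sub (N : set R^o) I : ideal I -> N `<=` I -> lspan N `<=` I.
Proof. by move=> hI sN x /(_ I); apply; split. Qed.

Lemma lspan_gen (S : comPzRingType) (V : lmodType S) (N : set V) : N `<=` lspan N.
Proof. by move=> x Nx M [_]; apply. Qed.

Lemma lspan_setE (I J : set R) : ideal J -> I `<=` J -> J `<=` lspan (I : set R^o) ->
  lspan (I : set R^o) = J.
Proof. by move=> hJ h1 h2; apply/seteqP; split=> //; apply: lspan_sub. Qed.

Lemma bigcup_chain_ideal (F : set (set R)) : F !=set0 ->
  (forall I, F I -> ideal I) -> total_on F subset -> ideal (\bigcup_(I in F) I).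
Proof.
move=> [I0 FI0] hF tF; split; first by exists I0 => //; exact: ideal0 (hF _ FI0).
move=> a x y [I FI Ix] [J FJ Jy]; case: (tF I J FI FJ) => s.
  by exists J => //; case: (hF J FJ) => _; apply => //; apply: s.
by exists I => //; case: (hF I FI) => _; apply => //; apply: s.
Qed.

(** If [x] and [y] were outside a maximal [P], both enlarged ideals would meet [S], and the product
    of the two meeting points would lie in [P] and in [S]. The last clause records maximality
    itself, from which [lying_over] draws its elements. *)
Lemma maximal_disjoint_prime I (S : set R) : ideal I -> S 1 ->
  (forall x y, S x -> S y -> S (x * y)) -> (forall x, I x -> ~ S x) ->
  exists P, [/\ prime_ideal P, I `<=` P, forall x, P x -> ~ S x
    & forall J, ideal J -> P `<=` J -> ~ J `<=` P -> exists2 x, J x & S x].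
Proof.
move=> hI S1 SM dis.
pose C J := J = set0 \/ [/\ ideal J, I `<=` J & forall x, J x -> ~ S x].
have [F FC tF|P [CP maxP]] := @Zorn_bigcup _ C.
  have [[J [FJ [x Jx]]]|none] := pselect (exists J, F J /\ J !=set0); last first.
    left; apply/seteqP; split=> // x [J FJ Jx].
    by apply: none; exists J; split=> //; exists x.
  pose F' := [set J | F J /\ J !=set0].
  have F'C K : F' K -> [/\ ideal K, I `<=` K & forall x, K x -> ~ S x].
    by move=> [FK [y Ky]]; case: (FC K FK) => // K0; rewrite K0 in Ky.
  have -> : \bigcup_(X in F) X = \bigcup_(X in F') X.
    apply/seteqP; split=> y [K FK Ky]; exists K => //; last by case: FK.
    by split=> //; exists y.
  have F'J : F' J by split=> //; exists x.
  right; split.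
  - apply: bigcup_chain_ideal; first by exists J.
      by move=> K /F'C[].
    by move=> K L [FK _] [FL _]; apply: tF.
  - by move=> y Iy; exists J => //; case: (F'C J F'J) => _ h _; exact: h.
  - by move=> y [K /F'C[_ _ h] Ky]; apply: h.
have {}CP : [/\ ideal P, I `<=` P & forall x, P x -> ~ S x].
  case: CP => // P0; exfalso; apply: (maxP I); last by right; split.
  by rewrite P0; split; [move=> ? []|move=> /(_ 0 (ideal0 hI))].
case: CP => idP sIP disP.
have maxP' J : ideal J -> P `<=` J -> ~ J `<=` P -> exists2 x, J x & S x.
  move=> hJ sPJ nJP; apply: contrapT => h.
  apply: (maxP J) => //; right; split=> //; first exact: subset_trans sPJ.
  by move=> x Jx Sx; apply: h; exists x.
exists P; split=> //; split=> //; first by move=> /disP.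
move=> x y Pxy; apply: contrapT => /not_orP[nx ny].
have ext z : ~ P z -> exists2 a, P a & exists b, S (a + b * z).
  move=> nz; case: (maxP' (adjoin P z)).
  - exact: adjoin_ideal.
  - exact: adjoin_sub.
  - by move=> h; apply: nz; apply: h; apply: adjoin_gen.
  - by move=> w [b hb] Sw; exists (w - b * z) => //; exists b; rewrite subrK.
have [a Pa [b Sab]] := ext x nx; have [c Pc [e Sce]] := ext y ny.
apply: (disP _ _ (SM _ _ Sab Sce)).
have -> : (a + b * x) * (c + e * y) = (c + e * y) * a + (b * x) * c + (b * e) * (x * y).
  by ring.
by do 2?[apply: idealD => //]; apply: idealM.
Qed.

Lemma minimal_prime P : prime_ideal P -> exists Q, [/\ prime_ideal Q, Q `<=` P
  & forall Q', prime_ideal Q' -> Q' `<=` Q -> Q' = Q].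
Proof.
move=> pP.
(* Zorn's lemma is available for unions of chains, so it is applied to complements of primes: a
   maximal complement is a minimal prime. *)
pose C (D : set R) := D = set0 \/ prime_ideal (~` D) /\ ~` P `<=` D.
have [F FC tF|D [CD maxD]] := @Zorn_bigcup _ C.
  have [[J [FJ [x Jx]]]|none] := pselect (exists J, F J /\ J !=set0); last first.
    left; apply/seteqP; split=> // x [J FJ Jx].
    by apply: none; exists J; split=> //; exists x.
  have F'C K : F K -> K !=set0 -> prime_ideal (~` K) /\ ~` P `<=` K.
    by move=> FK [y Ky]; case: (FC K FK) => // K0; rewrite K0 in Ky.
  have ne K z : ~ (\bigcup_(X in F) X) z -> F K -> ~ K z by move=> h FK Kz; apply: h;
    exists K.
  have FJ0 : J !=set0 by exists x.
  right; split; last first.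
    by move=> y Py; exists J => //; case: (F'C J FJ FJ0) => _; apply.
  split.
  - split=> [[K FK K0]|a y z hy hz [K FK Kayz]].
      by case: (F'C K FK (ex_intro _ _ K0)) => -[/ideal0 + _ _].
    case: (F'C K FK (ex_intro _ _ Kayz)) => -[[_ h] _ _] _.
    by move: Kayz; apply: h; apply: ne.
  - apply; exists J => //.
    by apply: contrapT; case: (F'C J FJ FJ0) => -[].
  - move=> y z nyz; apply: contrapT => /not_orP[/contrapT[K FK Ky] /contrapT[L FL Lz]].
    have [N [FN Ny Nz]] : exists N, [/\ F N, N y & N z].
      by case: (tF K L FK FL) => s; [exists L|exists K]; split=> //; apply: s.
    case: (F'C N FN (ex_intro _ _ Ny)) => -[_ _ h] _.
    by case: (h y z); first exact: ne nyz FN.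
have sPN : ~` P `<=` D.
  case: CD => [D0|[]//]; exfalso; case: (pP) => idP P1 _.
  apply: (maxD (~` P)); last by right; split=> //; rewrite setCK.
  by rewrite D0; split; [move=> ? []|move=> /(_ 1 P1)].
have pD : prime_ideal (~` D).
  case: CD => [D0|[]//]; exfalso; case: pP => _ P1 _.
  by have := sPN 1 P1; rewrite D0.
exists (~` D); split=> //.
  by move=> x nDx; apply: contrapT => /sPN.
move=> Q' pQ' sQ'; apply: contrapT => ne.
apply: (maxD (~` Q')).
  split; first by move=> x Dx /sQ'.
  move=> h; apply: ne; apply/seteqP; split=> // x nDx.
  by apply: contrapT => nq; apply: nDx; apply: h.
by right; rewrite setCK; split=> // x nPx /sQ' nDx; apply: nDx; apply: sPN.
Qed.

(** The annihilator of the class of [z] in [R / I]; the associated primes of [R / I] are the prime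
    ideals of this form. *)
Definition colon I z : set R := [set a | I (a * z)].

Lemma colon_ideal I z : ideal I -> ideal (colon I z).
Proof.
move=> hI; apply: mk_ideal => [|x y|a x]; rewrite /colon /=.
- by rewrite mul0r; apply: ideal0.
- by rewrite mulrDl; apply: idealD.
- by rewrite -mulrA; apply: idealM.
Qed.

End Ideals.

Section Preimage.
Variables (S R : comPzRingType) (f : {rmorphism S -> R}).

Lemma preim_ideal (I : set R) : ideal I -> ideal (f @^-1` I).
Proof.
move=> hI; apply: mk_ideal => [|x y|a x] /=.
- by rewrite rmorph0; apply: ideal0.
- by rewrite rmorphD; apply: idealD.
- by rewrite rmorphM; apply: idealM.
Qed.

Lemma preim_prime (P : set R) : prime_ideal P -> prime_ideal (f @^-1` P).
Proof.
move=> [hP P1 h]; split=> /=; first exact: preim_ideal.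
  by rewrite rmorph1.
by move=> x y; rewrite rmorphM => /h.
Qed.

End Preimage.

Section Noetherian.
Variables (S : comPzRingType) (V : lmodType S).

Lemma lspan_seqP (s : seq V) v : lspan [set` s] v <->
  exists c : nat -> S, v = \sum_(i < size s) c i *: s`_i.
Proof.
split=> [h|[c ->]].
  apply: (h [set v | exists c : nat -> S, v = \sum_(i < size s) c i *: s`_i]).
  split=> /=.
  - split; first by exists (fun=> 0); rewrite big1 // => i _; rewrite scale0r.
    move=> a x y [c ->] [e ->]; exists (fun i => a * c i + e i).
    rewrite scaler_sumr -big_split /=; apply: eq_bigr => i _.
    by rewrite scalerDl scalerA.
  - move=> x /= xs; exists (fun i => (i == index x s)%:R).
    have hi : (index x s < size s)%N by rewrite index_mem.
    rewrite (bigD1 (Ordinal hi)) //= eqxx scale1r nth_index // big1 ?addr0 //.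
    by move=> i /negPf ni; rewrite [_ == _]ni scale0r.
have [h0 hP] := lspan_submodule [set` s].
elim/big_ind: _ => [//|x y hx hy|i _].
  by rewrite -[x]scale1r; apply: hP.
by rewrite -[_ *: _]addr0; apply: hP => //; apply: lspan_gen; apply: mem_nth.
Qed.

End Noetherian.

Section NoetherianRing.
Variable R : comPzRingType.
Hypothesis noeR : noetherian R.

(** The ideal generated by all [c i] is finitely generated, hence generated by some initial segment.
    This form of the chain condition serves sequences built by repeated choice. *)
Lemma noetherian_seq (c : nat -> R) :
  exists N (e : nat -> R), c N = \sum_(i < N) e i * c i.
Proof.
pose sp N : set R := [set y | exists e : nat -> R, y = \sum_(i < N) e i * c i].
have spD N x y : sp N x -> sp N y -> sp N (x + y).
  move=> [e ->] [e' ->]; exists (fun i => e i + e' i).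
  by rewrite -big_split /=; apply: eq_bigr => i _; rewrite mulrDl.
have spM N a x : sp N x -> sp N (a * x).
  move=> [e ->]; exists (fun i => a * e i).
  by rewrite mulr_sumr; apply: eq_bigr => i _; rewrite mulrA.
have sp0 N : sp N 0.
  by exists (fun=> 0); rewrite big1 // => i _; rewrite mul0r.
have spid N : ideal (sp N) by apply: mk_ideal; [exact: sp0|exact: spD|exact: spM].
have spW N N' : (N <= N')%N -> sp N `<=` sp N'.
  move=> le x [e ->]; exists (fun i => if (i < N)%N then e i else 0).
  rewrite (big_ord_widen _ (fun i => e i * c i) le) big_mkcond /=.
  by apply: eq_bigr => i _; case: ifP => // _; rewrite mul0r.
have idI : ideal [set y | exists N, sp N y].
  apply: mk_ideal => [|x y [N hx] [N' hy]|a x [N hx]]; first by exists 0%N.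
    exists (maxn N N'); apply: spD;
      [exact: spW (leq_maxl _ _) _ hx|exact: spW (leq_maxr _ _) _ hy].
  by exists N; apply: spM.
have [s Is] := noeR idI.
have [N hN] : exists N, forall x, x \in s -> sp N x.
  have : forall x, x \in s -> exists N, sp N x.
    by move=> x xs; have : [set y | exists N, sp N y] x by rewrite Is; apply: lspan_gen.
  elim: s {Is} => [|x s IH] h; first by exists 0%N.
  have [N hN] := IH (fun y ys => h y (@mem_behead _ (x :: s) y ys)).
  have [N' hN'] := h x (mem_head _ _).
  exists (maxn N N') => y; rewrite inE => /orP[/eqP->|/hN hy].
    exact: spW (leq_maxr _ _) _ hN'.
  exact: spW (leq_maxl _ _) _ hy.
exists N; have : [set y | exists N, sp N y] (c N).
  by exists N.+1, (fun i => (i == N)%:R);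
    rewrite big_ord_recr /= eqxx mul1r big1 ?add0r //
   => i _; rewrite (ltn_eqF (ltn_ord i)) mul0r.
by rewrite Is => /(lspan_sub (spid N) (N := [set` s])) h; apply: h => x /= /hN.
Qed.

Lemma noetherian_max (F : set (set R)) : F !=set0 -> (forall I, F I -> ideal I) ->
  exists I, F I /\ forall J, F J -> I `<=` J -> J `<=` I.
Proof.
move=> [I0 FI0] hF; apply: contrapT => none.
have next (I : {I | F I}) : {J : {J | F J} | sval I `<=` sval J /\ ~ sval J `<=` sval I}.
  apply: cid; case: I => I FI /=; apply: contrapT => h; apply: none; exists I;
    split=> // J FJ sIJ.
  by apply: contrapT => nJI; apply: h; exists (exist _ J FJ).
pose ch := fix ch n : {I | F I} :=
  if n is n'.+1 then sval (next (ch n')) else exist _ I0 FI0.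
have chS n : sval (ch n) `<=` sval (ch n.+1) by have [] := svalP (next (ch n)).
have chle i j : (i <= j)%N -> sval (ch i) `<=` sval (ch j).
  by move=> /subnK<-; elim: (j - i)%N => // n IH; apply: subset_trans IH (chS _).
have chN n : {x | sval (ch n.+1) x /\ ~ sval (ch n) x}.
  apply: cid; have [_ h] := svalP (next (ch n)); apply: contrapT => h'; apply: h => x hx.
  by apply: contrapT => nx; apply: h'; exists x.
have [N [e eN]] := noetherian_seq (fun n => sval (chN n)).
have [_] := svalP (chN N); rewrite eN; apply.
have hid : ideal (sval (ch N)) by exact/hF/(svalP (ch N)).
apply: ideal_sum => // i _; apply: idealM => //.
by apply: (chle i.+1 N) => //; have [] := svalP (chN i).
Qed.

(** An annihilator that is maximal among those contained in [Q] is prime. Confining the choice to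
    [Q] gives an associated prime below [Q], so a prime minimal over [J] is itself associated. *)
Lemma prime_colon (J Q : set R) z : ideal J -> prime_ideal Q -> colon J z `<=` Q ->
  exists a, [/\ prime_ideal (colon J (a * z)), colon J (a * z) `<=` Q
     & colon J z `<=` colon J (a * z)].
Proof.
move=> hJ pQ sQ.
pose F := [set I | exists a, I = colon J (a * z) /\ I `<=` Q].
have [||I [[a [-> sI]] maxI]] := @noetherian_max F.
- by exists (colon J z); exists 1; rewrite mul1r.
- by move=> _ [a [-> _]]; apply: colon_ideal.
exists a; split=> //; last first.
  by move=> x; rewrite /colon /= mulrCA; apply: idealM.
split; [exact: colon_ideal|by move=> /sI; case: pQ|move=> x y hxy].
have [sxQ|nsxQ] := pselect (colon J (x * a * z) `<=` Q).
  right; apply: (maxI (colon J (x * a * z))); first by exists (x * a).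
  - move=> w; rewrite /colon /= => h.
    by rewrite (_ : _ * _ = x * (w * (a * z))); [apply: idealM|ring].
  - by move: hxy; rewrite /colon /= (mulrC x) -!mulrA.
(* Multiplying [a] by an [s] outside [Q] keeps the annihilator inside [Q], so maximality applies to
   [s * a] in place of [x * a]. *)
left; have [s [hs nQs]] : exists s, colon J (x * a * z) s /\ ~ Q s.
  by apply: contrapT => h; apply: nsxQ => s hs; apply: contrapT => ns; apply: h; exists s.
apply: (maxI (colon J (s * a * z))).
- exists (s * a); split=> // w; rewrite /colon /= => hw.
  have /sI : colon J (a * z) (w * s) by rewrite /colon /=; move: hw; rewrite !mulrA.
  by case: pQ => _ _ h /h[].
- move=> w; rewrite /colon /= => h.
  by rewrite (_ : _ * _ = s * (w * (a * z))); [apply: idealM|ring].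
- by move: hs; rewrite /colon /=; have -> : s * (x * a * z) = x * (s * a * z) by ring.
Qed.

End NoetherianRing.

(** * Chains of primes and integral extensions *)

Section Chains.
Variables (T : Type) (C : set (set T)).

(** The member [c n] is dropped in favour of [c' 0], so a weak inclusion at the joint suffices and
    the lengths add up. *)
Lemma strict_chain_cat n m c c' : strict_chain C n c -> strict_chain C m c' ->
  c n `<=` c' 0%N ->
  strict_chain C (n + m) (fun i => if (i < n)%N then c i else c' (i - n)%N).
Proof.
move=> [Cc sc] [Cc' sc'] cc'; split=> i hi.
  case: ltnP => h; first by apply: Cc; apply: ltnW.
  by apply: Cc'; rewrite leq_subLR.
case: ltnP => h; last first.
  by rewrite ltnNge (leqW h) /= subSn //; apply: sc'; rewrite ltn_subLR.
case: ltnP => h'; first exact: sc.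
have -> : (i.+1 - n = 0)%N by apply/eqP; rewrite subn_eq0.
have e : n = i.+1 by apply/eqP; rewrite eqn_leq h'.
have := sc i h; rewrite -e; move=> [s1 s2]; split; first exact: subset_trans cc'.
by move=> s3; apply: s2; apply: subset_trans s3.
Qed.

Lemma strict_chain_trunc n m c : (m <= n)%N -> strict_chain C n c -> strict_chain C m c.
Proof.
by move=> le [Cc sc]; split=> i hi; [apply: Cc|apply: sc]; apply: leq_trans le.
Qed.

Lemma strict_chain_cons n P c : strict_chain C n c -> C P -> P `<` c 0%N ->
  strict_chain C n.+1 (fun i => if i is j.+1 then c j else P).
Proof. by move=> [Cc sc] CP Pc; split=> -[|i] //; [apply: Cc|apply: sc]. Qed.

Lemma strict_chain_rcons n P c : strict_chain C n c -> C P -> c n `<` P ->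
  strict_chain C n.+1 (fun i => if (i <= n)%N then c i else P).
Proof.
move=> [Cc sc] CP Pc; split=> i hi; first by case: leqP => // h; apply: Cc.
rewrite ltnS in hi; rewrite hi; case: ltnP => h; first exact: sc.
by have -> : i = n by apply/eqP; rewrite eqn_leq hi.
Qed.

Lemma strict_chain0 P : C P -> strict_chain C 0 (fun=> P).
Proof. by move=> CP; split. Qed.

Lemma strict_chain_le n c i j : strict_chain C n c -> (i <= j)%N -> (j <= n)%N ->
  c i `<=` c j.
Proof.
move=> [_ sc]; elim: j => [|j IH]; first by rewrite leqn0 => /eqP-> _ x.
rewrite leq_eqVlt => /predU1P[-> _ x //|le lt].
by have [s1 _] := sc _ lt; move=> x /(IH le (ltnW lt)) /s1.
Qed.

End Chains.

Lemma strict_chain_map T T' (C : set (set T)) (C' : set (set T')) (F : set T ->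
  set T') n c :
  (forall P, C P -> C' (F P)) -> (forall P Q, C P -> C Q -> P `<` Q -> F P `<` F Q) ->
  strict_chain C n c -> strict_chain C' n (F \o c).
Proof.
move=> FC Fs [Cc sc]; split=> i hi; first exact/FC/Cc.
by apply: Fs; [apply: Cc; apply: ltnW|apply: Cc|apply: sc].
Qed.

Section Integral.
Variables (S A : comNzRingType) (f : {rmorphism S -> A}).

(* Expand [det (a - M)], where [a e_i] is congruent to [sum_j M_ij e_j]. *)
Lemma integral_modulo (I : set A) n (e : 'I_n -> A) : ideal I ->
  (forall a, exists c : 'I_n -> S, I (a - \sum_i f (c i) * e i)) ->
  forall a, exists2 p : {poly S}, p \is monic & I (map_poly f p).[a].
Proof.
move=> hI gen a.
have [M hM] : exists M : 'M[S]_n, forall i, I (a * e i - \sum_j f (M i j) * e j).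
  have [F hF] := choice (fun i => gen (a * e i)).
  by exists (\matrix_(i, j) F i j) => i; under eq_bigr do rewrite mxE.
exists (char_poly M); first exact: char_poly_monic.
rewrite map_char_poly /=; set B := map_mx f M.
have -> : (char_poly B).[a] = \det (a%:M - B).
  rewrite -[LHS]/(horner_eval a _) -det_map_mx; congr (\det _).
  apply/matrixP => i j; rewrite !mxE /= /horner_eval !hornerE.
  by rewrite hornerMn hornerX.
set N := a%:M - B.
have hN i : I ((N *m (\col_j e j)) i 0).
  have -> : (N *m (\col_j e j)) i 0 = a * e i - \sum_j f (M i j) * e j.
    rewrite mulmxBl mxE mul_scalar_mx !mxE; congr (_ - _).
    by apply: eq_bigr => j _; rewrite !mxE.
  exact: hM.
have hd i : I (\det N * e i).
  have -> : \det N * e i = (\adj N *m (N *m (\col_j e j))) i 0.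
    by rewrite mulmxA mul_adj_mx mul_scalar_mx !mxE.
  by rewrite mxE; apply: ideal_sum => // j _; apply: idealM.
have [c hc] := gen 1.
rewrite -[\det N]mulr1 -(subrK (\sum_i f (c i) * e i) 1) mulrDr.
apply: idealD => //; first exact: idealM.
rewrite mulr_sumr; apply: ideal_sum => // i _.
by rewrite mulrCA; apply: idealM.
Qed.

Definition integral_morphism :=
  forall a, exists2 p : {poly S}, p \is monic & (map_poly f p).[a] = 0.

Lemma finite_module_gen : finite_module (restrict_scalars f) ->
  exists n (e : 'I_n -> A), forall a, exists c : 'I_n -> S, a = \sum_i f (c i) * e i.
Proof.
move=> [s hs]; exists (size s), (fun i => s`_i) => a.
have : lspan [set` s] (a : restrict_scalars f) by rewrite hs.
by move=> /lspan_seqP[c ->]; exists (fun i => c i).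
Qed.

Lemma finite_integral : finite_module (restrict_scalars f) -> integral_morphism.
Proof.
move=> /finite_module_gen[n [e he]] a.
have [b|p pm /= pa] := integral_modulo (e := e) (@zero_ideal A) _ a; last by exists p.
by have [c ->] := he b; exists c; rewrite /= subrr.
Qed.

Hypothesis intf : integral_morphism.

(* If [t] in [p] were not in [Q], the maximality of [Q] gives [s] outside [p]
   with [s - t a] in [Q], and an integral equation of [a] multiplied by [t^n]
   shows [s^n] in [p]. *)
Lemma lying_over (I : set A) (p : set S) : ideal I -> prime_ideal p ->
  f @^-1` I `<=` p ->
  exists Q, [/\ prime_ideal Q, I `<=` Q & f @^-1` Q = p].
Proof.
move=> hI [idp p1 pM] sIp.
have [|||Q [pQ sIQ dis maxQ]] :=
    @maximal_disjoint_prime _ I [set x | exists2 s, ~ p s & f s = x] hI.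
- by exists 1 => //; rewrite rmorph1.
- move=> _ _ [s ps <-] [t pt <-]; exists (s * t); last by rewrite rmorphM.
  by move=> /pM[].
- by move=> x Ix [s ps fs]; apply: ps; apply: sIp; rewrite /= fs.
have idQ := prime_ideal_id pQ.
exists Q; split=> //; apply/seteqP; split=> t /= ht.
  by apply: contrapT => nt; apply: (dis _ ht); exists t.
apply: contrapT => nQt.
have [|||x [a hax] [s ps fsx]] := maxQ (adjoin Q (f t)).
- exact: adjoin_ideal.
- exact: adjoin_sub.
- by move=> h; apply: nQt; apply: h; apply: adjoin_gen.
have [P Pm Pa] := intf a.
have lP : (size P).-1.+1 = size P by rewrite prednK // lt0n size_poly_eq0 monic_neq0.
set n := (size P).-1 in lP.
have Pn : P`_n = 1 by move: Pm => /monicP.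
pose w := \sum_(i < n) P`_i * t ^+ (n - i) * s ^+ i.
have Qw : Q (f (s ^+ n + w)).
  have e0 : \sum_(i < n.+1) f (P`_i) * f t ^+ (n - i) * (a * f t) ^+ i = 0.
    transitivity (f t ^+ n * (map_poly f P).[a]); last by rewrite Pa mulr0.
    rewrite (@horner_coef_wide _ n.+1); last first.
      by rewrite size_map_poly_id0 ?lP // (monicP Pm) rmorph1 oner_neq0.
    rewrite mulr_sumr; apply: eq_bigr => i _; rewrite coef_map exprMn.
    have -> : f t ^+ n = f t ^+ (n - i) * f t ^+ i.
      by rewrite -exprD subnK // -ltnS.
    by ring.
  have e1 : f (s ^+ n + w) = \sum_(i < n.+1) f (P`_i) * f t ^+ (n - i) * f s ^+ i.
    rewrite big_ord_recr /= Pn rmorph1 subnn mulr1 mul1r rmorphD rmorphXn addrC /w rmorph_sum.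
    by congr (_ + _); apply: eq_bigr => i _; rewrite !(rmorphM, rmorphXn).
  rewrite e1; apply: (idealBr idQ) (_ :
    Q (\sum_(i < n.+1) f (P`_i) * f t ^+ (n - i) * (a * f t) ^+ i)); last first.
    by rewrite e0; apply: ideal0.
  rewrite -sumrB; apply: ideal_sum => // i _.
  rewrite -mulrBr; apply: idealM => //; rewrite subrXX; apply: idealMr => //.
  by rewrite fsx.
have pw : p w.
  apply: ideal_sum => // i _; apply: idealMr => //; apply: idealM => //.
  rewrite -(@prednK (n - i)) ?subn_gt0 // exprS; exact: idealMr.
have psn : p (s ^+ n).
  rewrite -(addrK w (s ^+ n)); apply: idealB => //.
  by apply: contrapT => nsw; apply: (dis _ Qw); exists (s ^+ n + w).
by apply: ps; apply: primeX psn.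
Qed.

(** Take a monic relation for [a] modulo [Q]. Its constant term lies in [Q'], hence in [Q] by the
    hypothesis on contractions, and the factor [a], being outside [Q], cancels. Induction on the
    list of lower coefficients ends with [1] in [Q]. *)
Lemma incomparable (Q Q' : set A) : prime_ideal Q -> ideal Q' -> Q `<=` Q' ->
  f @^-1` Q' `<=` f @^-1` Q -> Q' `<=` Q.
Proof.
move=> [idQ Q1 QM] idQ' sQ sf a Q'a; apply: contrapT => nQa.
have [P Pm Pa] := intf a.
suff H (l : seq S) : ~ Q (a ^+ size l + \sum_(i < size l) f l`_i * a ^+ i).
  apply: (H (take (size P).-1 P)).
  have lP : (size P).-1.+1 = size P by rewrite prednK // lt0n size_poly_eq0 monic_neq0.
  set n := (size P).-1 in lP *.
  have -> : size (take n P) = n by rewrite size_takel // -lP.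
  have e0 : \sum_(i < n.+1) f (P`_i) * a ^+ i = 0.
    transitivity (map_poly f P).[a] => //; rewrite (@horner_coef_wide _ n.+1).
      by apply: eq_bigr => i _; rewrite coef_map.
    by rewrite size_map_poly_id0 ?lP // (monicP Pm) rmorph1 oner_neq0.
  move: e0; rewrite big_ord_recr /=; have -> : P`_n = 1 by move/monicP: Pm.
  rewrite rmorph1 mul1r addrC => e0.
  under eq_bigr => i _ do rewrite nth_take //.
  by rewrite e0; apply: ideal0.
elim: l => [|c l IH]; first by rewrite /= expr0 big_ord0 addr0.
rewrite big_ord_recl /= expr0 mulr1 => h; apply: IH.
set E := _ + _.
have e : a ^+ (size l).+1 + (f c + \sum_(i < size l) f l`_i * a ^+ bump 0 i) = f c + a * E.
  rewrite addrCA; congr (_ + _); rewrite exprS mulrDr; congr (_ + _).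
  by rewrite mulr_sumr; apply: eq_bigr => i _; rewrite exprS mulrCA.
rewrite e in h.
have Qc : Q (f c).
  apply: sf; rewrite /= -(addrK (a * E) (f c)); apply: idealB => //; first exact: sQ.
  exact: idealMr.
by have /QM[] : Q (a * E) by rewrite -(addKr (f c) (a * E)) addrC; apply: idealB.
Qed.

Lemma incomparable_strict (Q Q' : set A) : prime_ideal Q -> ideal Q' -> Q `<` Q' ->
  f @^-1` Q `<` f @^-1` Q'.
Proof.
move=> pQ iQ' [s ns]; split; first by move=> x; apply: s.
by move=> h; apply: ns; apply: incomparable.
Qed.

Lemma incomparable_eq (Q Q' : set A) : prime_ideal Q -> ideal Q' -> Q `<=` Q' ->
  f @^-1` Q' `<=` f @^-1` Q -> Q' = Q.
Proof. by move=> pQ iQ' s h; apply/seteqP; split=> //; apply: incomparable. Qed.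

Lemma going_up (Q : set A) (p : set S) : ideal Q -> prime_ideal p ->
  f @^-1` Q `<` p ->
  exists Q', [/\ prime_ideal Q', Q `<` Q' & f @^-1` Q' = p].
Proof.
move=> iQ pp [s ns]; have [Q' [pQ' sQ' e]] := lying_over iQ pp s.
by exists Q'; split=> //; split=> // h; apply: ns; rewrite -e => x; apply: h.
Qed.

Lemma lift_chain (Q : set A) n c : prime_ideal Q -> f @^-1` Q = c 0%N ->
  strict_chain (@prime_ideal S) n c ->
  exists c', [/\ strict_chain (@prime_ideal A) n c', c' 0%N = Q & f @^-1` (c' n) = c n].
Proof.
move=> pQ e0; elim: n => [|n IH] sc.
  by exists (fun=> Q); split=> //; apply: strict_chain0.
have [c' [sc' c'0 c'n]] := IH (strict_chain_trunc (leqnSn n) sc).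
have [] := @going_up (c' n) (c n.+1).
- by case: (sc'.1 n (leqnn n)).
- exact: sc.1.
- by rewrite c'n; apply: sc.2.
move=> Q' [pQ' sQ' e]; exists (fun i => if (i <= n)%N then c' i else Q').
by split; [apply: strict_chain_rcons|by []|rewrite ltnn].
Qed.

Lemma contract_chain n c : strict_chain (@prime_ideal A) n c ->
  strict_chain (@prime_ideal S) n (fun i => f @^-1` (c i)).
Proof.
apply: (@strict_chain_map _ _ _ _ (fun Q => f @^-1` Q)) => [P|P Q pP [iQ _ _]].
  exact: preim_prime.
exact: incomparable_strict.
Qed.

End Integral.

Lemma integral_sub (S R A : comNzRingType) (f : {rmorphism S -> R})
    (g : {rmorphism R -> A}) (h : {rmorphism S -> A}) : injective g ->
  (forall s, g (f s) = h s) -> integral_morphism h -> integral_morphism f.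
Proof.
move=> gi gf hint a; have [p pm pa] := hint (g a); exists p => //.
apply: gi; rewrite -horner_map rmorph0 -pa -map_poly_comp; congr (_.[_]).
by apply: eq_map_poly => x; rewrite /= gf.
Qed.

Lemma integral_over_sub (S R A : comNzRingType) (f : {rmorphism S -> R})
    (g : {rmorphism R -> A}) (h : {rmorphism S -> A}) :
  (forall s, g (f s) = h s) -> integral_morphism h -> integral_morphism g.
Proof.
move=> gf hint a; have [p pm pa] := hint a; exists (map_poly f p).
  exact: monic_map.
by rewrite -pa -map_poly_comp; congr (_.[_]); apply: eq_map_poly => x; rewrite /= gf.
Qed.

(** * Graded rings *)

Section PolyPrime.
Variables (R : comNzRingType) (P : set R).
Hypothesis pP : prime_ideal P.

Lemma max_coef_notin (p : {poly R}) : ~ (forall n, P p`_n) ->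
  exists i, ~ P p`_i /\ forall j, (i < j)%N -> P p`_j.
Proof.
move=> h; have hex : exists n, `[< ~ P p`_n >].
  by apply: contrapT => nh; apply: h => n; apply: contrapT => hn; apply: nh; exists n;
    apply/asboolP.
have bnd n : `[< ~ P p`_n >] -> (n <= size p)%N.
  move=> /asboolP hn; rewrite leqNgt; apply/negP => lt; apply: hn.
  by rewrite nth_default ?(ltnW lt) //; exact: ideal0 (prime_ideal_id pP).
case: (ex_maxnP hex bnd) => i /asboolP hi imax; exists i; split=> // j ij.
by apply: contrapT => hj; have := imax j (asboolT hj); rewrite leqNgt ij.
Qed.

(** If [i] and [j] are the last indices with coefficients outside [P], the coefficient of index
    [i + j] is congruent to their product. Applied to [hpoly], this makes [hpart] of a prime ideal
    prime. *)
Lemma poly_prime (p q : {poly R}) : (forall n, P (p * q)`_n) ->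
  (forall n, P p`_n) \/ (forall n, P q`_n).
Proof.
have idP := prime_ideal_id pP.
move=> hpq; apply: contrapT =>
  /not_orP[/max_coef_notin[i [hi mi]] /max_coef_notin[j [hj mj]]].
case: (pP) => _ _ PM.
have := hpq (i + j)%N; rewrite coefM.
have lt : (i < (i + j).+1)%N by rewrite ltnS leq_addr.
rewrite (bigD1 (Ordinal lt)) //= addKn => h.
suff /(idealBr idP) : P (p`_i * q`_j - - \sum_(l < (i + j).+1 | l != Ordinal lt) p`_l * q`_(i + j - l)).
  move=> h'; have /PM[] // : P (p`_i * q`_j).
  apply: h'; apply: idealN => //; apply: ideal_sum => // l nl.
  have [il|li] := ltnP i l; first by apply: idealMr => //; apply: mi.
  have li' : (l < i)%N by rewrite ltn_neqAle li andbT; apply: contra nl => /eqP e;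
    apply/eqP/val_inj.
  by apply: idealM => //; apply: mj; rewrite ltn_subRL ltn_add2r.
by rewrite opprK.
Qed.

End PolyPrime.

Section Grading.
Variables (R : comNzRingType) (gr : nat -> set R).
Hypothesis hgr : grading gr.

Lemma gradingN n x : gr n x -> gr n (- x).
Proof. by move=> h; rewrite -sub0r; apply: gradingB => //; apply: grading0. Qed.

Lemma gradingD n x y : gr n x -> gr n y -> gr n (x + y).
Proof. by move=> hx hy; rewrite -[y]opprK; apply: gradingB => //; apply: gradingN. Qed.

Lemma grading_bigsum n (K : Type) (r : seq K) (p : pred K) (F : K -> R) :
  (forall i, p i -> gr n (F i)) -> gr n (\sum_(i <- r | p i) F i).
Proof.
move=> h; elim/big_ind: _ => [|x y|i /h //]; first exact: grading0.
exact: gradingD.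
Qed.

Lemma hpoly_ex x : exists p : {poly R}, (forall n, gr n p`_n) /\ p.[1] = x.
Proof.
have [N [c [hc ->]]] := grading_sum hgr x.
exists (\poly_(i < N) c i); split.
  by move=> n; rewrite coef_poly; case: ifP => // _; apply: grading0.
rewrite (@horner_coef_wide _ N); last exact: size_poly.
by apply: eq_bigr => i _; rewrite coef_poly ltn_ord expr1n mulr1.
Qed.

(* [sum_n x_n 'X^n], where the [x_n] are the homogeneous components of [x] *)
Definition hpoly x := sval (cid (hpoly_ex x)).

Lemma hpoly_gr x n : gr n (hpoly x)`_n.
Proof. by rewrite /hpoly; case: cid => p []. Qed.

Lemma hpolyK x : (hpoly x).[1] = x.
Proof. by rewrite /hpoly; case: cid => p []. Qed.

Lemma horner1 (p : {poly R}) : p.[1] = \sum_(i < size p) p`_i.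
Proof. by rewrite horner_coef; apply: eq_bigr => i _; rewrite expr1n mulr1. Qed.

Lemma hpoly_uniq (p : {poly R}) : (forall n, gr n p`_n) -> hpoly p.[1] = p.
Proof.
move=> hp; apply/eqP; rewrite -subr_eq0; set q := _ - _.
have hq n : gr n q`_n by rewrite coefB; apply: gradingB => //; apply: hpoly_gr.
have q1 : \sum_(i < size q) q`_i = 0.
  by rewrite -horner1 hornerD hornerN hpolyK subrr.
apply/eqP/polyP => i; rewrite coef0.
have [lt|le] := ltnP i (size q); first exact: (grading_direct hgr hq q1).
by rewrite nth_default.
Qed.

Lemma hpolyD x y : hpoly (x + y) = hpoly x + hpoly y.
Proof.
rewrite -[in LHS](hpolyK x) -[in LHS](hpolyK y) -hornerD hpoly_uniq // => n.
by rewrite coefD; apply: gradingD; apply: hpoly_gr.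
Qed.

Lemma hpolyM x y : hpoly (x * y) = hpoly x * hpoly y.
Proof.
rewrite -[in LHS](hpolyK x) -[in LHS](hpolyK y) -hornerM hpoly_uniq // => n.
rewrite coefM; apply: grading_bigsum => i _.
have := gradingM hgr (hpoly_gr x i) (hpoly_gr y (n - i)).
by rewrite subnKC // -ltnS.
Qed.

Lemma hpoly_hom n x : gr n x -> hpoly x = x *: 'X^n.
Proof.
move=> h; have {1}-> : x = (x *: 'X^n).[1] by rewrite hornerZ hornerXn expr1n mulr1.
rewrite hpoly_uniq // => i; rewrite coefZ coefXn.
by have [->|_] := eqVneq i n; [rewrite mulr1|rewrite mulr0; apply: grading0].
Qed.

Lemma hpoly0 : hpoly 0 = 0.
Proof. by rewrite (hpoly_hom (grading0 hgr 0)) scale0r. Qed.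

Lemma hpoly1 : hpoly 1 = 1.
Proof. by rewrite (hpoly_hom (grading1 hgr)) expr0 alg_polyC. Qed.

Lemma hpoly_sum N (c : nat -> R) : (forall n, gr n (c n)) ->
  hpoly (\sum_(n < N) c n) = \poly_(n < N) c n.
Proof.
move=> hc; have -> : \sum_(n < N) c n = (\poly_(n < N) c n).[1].
  rewrite (@horner_coef_wide _ N); last exact: size_poly.
  by apply: eq_bigr => i _; rewrite coef_poly ltn_ord expr1n mulr1.
by rewrite hpoly_uniq // => n; rewrite coef_poly; case: ifP => // _; apply: grading0.
Qed.

Lemma homogeneous_idealP I : ideal I ->
  homogeneous_ideal gr I <-> forall x n, I x -> I (hpoly x)`_n.
Proof.
move=> hI; split=> [[_ h] x n Ix|h].
  have [lt|le] := ltnP n (size (hpoly x)); last by rewrite nth_default //; apply: ideal0.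
  apply: (h (size (hpoly x)) (fun n => (hpoly x)`_n)) => //; first exact: hpoly_gr.
  by rewrite -horner1 hpolyK.
split=> // N c hc Ic n lt; have := h _ n Ic.
by rewrite hpoly_sum // coef_poly lt.
Qed.

Lemma homogeneous_idealW I : ideal I -> (forall x, I x -> forall n, I (hpoly x)`_n) ->
  homogeneous_ideal gr I.
Proof. by move=> hI h; apply/homogeneous_idealP => // x n /h. Qed.

(* The largest homogeneous ideal contained in the ideal [I] *)
Definition hpart (I : set R) : set R := [set x | forall n, I (hpoly x)`_n].

Lemma hpart_sub I : ideal I -> hpart I `<=` I.
Proof. by move=> hI x h; rewrite -(hpolyK x) horner1; apply: ideal_sum => // i _;
  apply: h. Qed.

Lemma hpart_ideal I : ideal I -> ideal (hpart I).
Proof.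
move=> hI; apply: mk_ideal => [n|x y hx hy n|a x hx n].
- by rewrite hpoly0 coef0; apply: ideal0.
- by rewrite hpolyD coefD; apply: idealD.
- by rewrite hpolyM coefM; apply: ideal_sum => // i _; apply: idealM.
Qed.

Lemma hpart_gen I n x : ideal I -> gr n x -> I x -> hpart I x.
Proof.
move=> hI hx Ix i; rewrite (hpoly_hom hx) coefZ coefXn.
exact: idealMr.
Qed.

Lemma hpart_prime P : prime_ideal P -> prime_ideal (hpart P).
Proof.
move=> pP; have idP := prime_ideal_id pP; split; first exact: hpart_ideal.
  by move=> /(hpart_sub idP); case: pP.
by move=> x y; rewrite /hpart /= hpolyM => /(poly_prime pP).
Qed.

Lemma hpart_homogeneous I : ideal I -> homogeneous_ideal gr (hpart I).
Proof.
move=> hI; apply: homogeneous_idealW => [|x hx n]; first exact: hpart_ideal.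
by apply: hpart_gen (hpoly_gr x n) (hx n).
Qed.

Lemma homogeneous_hpart I J : ideal J -> homogeneous_ideal gr I -> I `<=` J ->
  I `<=` hpart J.
Proof.
move=> hJ [hI h] s x Ix n; apply: s; exact: (homogeneous_idealP hI).1.
Qed.

(* Modulo [P], which is homogeneous, a multiple of [y 'X^m - 1] is not a nonzero
   monomial. *)
Lemma homogeneous_dehomog P m g y z h : prime_ideal P -> homogeneous_ideal gr P ->
  (0 < m)%N -> gr m y -> ~ P y -> gr g z -> P (z - h * (y - 1)) -> P z.
Proof.
move=> pP hP m0 ym nPy zg hz; have idP := prime_ideal_id pP.
have PM := let: And3 _ _ h := pP in h.
set H := hpoly h.
have rel n : P (z *+ (n == g) - ((if (n < m)%N then 0 else y * H`_(n - m)) - H`_n)).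
  have := (homogeneous_idealP idP).1 hP _ n hz.
  have -> : z - h * (y - 1) = z + (h + (- y) * h) by ring.
  rewrite 2!hpolyD hpolyM (hpoly_hom zg) (hpoly_hom (gradingN ym)) !coefD coefZ coefXn.
  rewrite -scalerAl coefZ coefXnM -/H mulr_natr opprB.
  by congr P; congr (_ + (_ + _)); case: ifP => _; rewrite ?mulNr // mulr0 oppr0.
have [allH|/max_coef_notin[//|n1 [hn1 max1]]] := pselect (forall n, P H`_n).
  have := rel g; rewrite eqxx mulr1n => /(idealBr idP); apply.
  apply: idealB => //; case: ifP => _; first exact: ideal0.
  exact: idealM.
(* The last index [n1] of [H] outside [P] forces degree [n1 + m] to be the degree [g] of [z]. The
   first such index [n0] is then smaller than [g], yet also survives in the product, a
   contradiction. *)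
have e1 : (n1 + m)%N = g.
  have := rel (n1 + m)%N; rewrite ltnNge leq_addl /= addnK.
  case: eqP => // _; rewrite mulr0n sub0r => /(idealN idP); rewrite opprK.
  move=> /(idealBr idP) h'; have /PM[] // : P (y * H`_n1).
  by apply: h'; apply: max1; rewrite -addn1 leq_add2l.
have hex : exists n, `[< ~ P H`_n >] by exists n1; apply/asboolP.
case: (ex_minnP hex) => n0 /asboolP hn0 min0; exfalso.
have le01 : (n0 <= n1)%N by apply: min0; apply/asboolP.
have := rel n0; have -> : (n0 == g) = false.
  by apply/negbTE; rewrite neq_ltn -e1 (leq_ltn_trans le01) // -addn1 leq_add2l.
rewrite mulr0n sub0r opprB => /(idealBr idP) h'; apply: hn0; apply: h'.
case: ltnP => lt; first exact: ideal0.
apply: idealM => //; apply: contrapT => hm; have := min0 _ (asboolT hm).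
by rewrite leqNgt ltn_subrL m0 (leq_trans m0 lt).
Qed.

End Grading.

(** * Depth and localization *)

Section ModuleQuotient.
Variables (S : comPzRingType) (V : lmodType S) (N : set V).

Lemma lquot_pi_eq0 x : (\pi_(lquot N) x = 0) <-> lspan N x.
Proof.
have pi0 : \pi_(lquot N) 0 = 0.
  have := lquot_piD N 0 0; rewrite addr0 => e.
  by apply: (addrI (\pi_(lquot N) 0)); rewrite addr0 -e.
split=> [|h]; last by rewrite -pi0; apply/eqP/lquotP; rewrite subr0.
by rewrite -pi0 => /eqP/lquotP; rewrite subr0.
Qed.

Lemma lquot_regularP a : (forall x : lquot N, a *: x = 0 -> x = 0) <->
  (forall v, lspan N (a *: v) -> lspan N v).
Proof.
have piZ v : a *: \pi_(lquot N) v = \pi_(lquot N) (a *: v) by exact: lquot_piZ.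
split=> h; first by move=> v hv; apply/lquot_pi_eq0/h; rewrite piZ; apply/lquot_pi_eq0.
by elim/quotW => v; rewrite piZ => /lquot_pi_eq0/h/lquot_pi_eq0.
Qed.

End ModuleQuotient.

Section PrefixIdeal.
Variable R : comPzRingType.
Implicit Types (u : seq R) (I : set R).

(* In the form that occurs in [regular_seq] *)
Definition seq_ideal u : set R := lspan (smul (R^o) [set` u]).

Lemma seq_ideal_ideal u : ideal (seq_ideal u).
Proof. exact: lspan_ideal. Qed.

Lemma seq_ideal_gen u x : x \in u -> seq_ideal u x.
Proof. by move=> xu; apply: lspan_gen; exists x => //; exists 1 => //; exact: mulr1. Qed.

Lemma seq_ideal_le u I : ideal I -> (forall x, x \in u -> I x) -> seq_ideal u `<=` I.
Proof.
move=> hI h; apply: (lspan_sub (N := smul R^o [set` u])) => // _ [x /= /h Ix [y _ <-]].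
exact: idealMr.
Qed.

Lemma seq_ideal_rcons u x : seq_ideal (rcons u x) = adjoin (seq_ideal u) x.
Proof.
have idu := seq_ideal_ideal u; apply/seteqP; split.
  apply: seq_ideal_le; first exact: adjoin_ideal.
  move=> y; rewrite mem_rcons inE => /orP[/eqP->|yu]; first exact: adjoin_gen.
  by apply: adjoin_sub => //; apply: seq_ideal_gen.
apply: adjoin_le; first exact: seq_ideal_ideal.
- apply: seq_ideal_le; first exact: seq_ideal_ideal.
  by move=> y yu; apply: seq_ideal_gen; rewrite mem_rcons inE yu orbT.
- by apply: seq_ideal_gen; rewrite mem_rcons mem_head.
Qed.

Lemma seq_ideal_nil : seq_ideal [::] = [set 0].
Proof.
apply/seteqP; split; last by move=> _ ->; exact: ideal0 (seq_ideal_ideal _).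
by apply: seq_ideal_le => //; exact: zero_ideal.
Qed.

Lemma regular_seqP u : regular_seq R^o u <->
  (forall i, (i < size u)%N -> forall x, seq_ideal (take i u) (u`_i * x) ->
     seq_ideal (take i u) x) /\ ~ seq_ideal u 1.
Proof.
split=> [[h1 h2]|[h1 h2]]; split.
- by move=> i lt x; move/lquot_regularP: (h1 i lt); apply.
- by move=> /(ideal_setT (seq_ideal_ideal u)); exact: h2.
- by move=> i lt; apply/lquot_regularP => x; exact: h1.
- by move=> e; apply: h2; rewrite /seq_ideal e.
Qed.

End PrefixIdeal.

Section Depth.
Variable L : comPzRingType.
Hypotheses (noeL : noetherian L) (locL : prime_ideal (@nonunits L)).

Lemma proper_nonunits (I : set L) : ideal I -> ~ I 1 -> I `<=` @nonunits L.
Proof. by move=> hI I1 x Ix [y xy]; apply: I1; rewrite -xy; apply: idealMr. Qed.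

(* If every [z] with [q z] in [J] were in [J + y L], then [z = j + y w] where [w]
   has the same property, and iterating would contradict noetherianity as in the
   proof of Nakayama's lemma. *)
Lemma depth_step (J : set L) x y : ideal J -> prime_ideal (colon J x) ->
  nonunits y -> (forall z, J (y * z) -> J z) ->
  exists x', prime_ideal (colon (adjoin J y) x') /\ colon J x `<` colon (adjoin J y) x'.
Proof.
move=> hJ pq ny reg; set q := colon J x.
have hJ' := adjoin_ideal y hJ.
pose U z := forall a, q a -> J (a * z).
(* Strictness of the inclusion will be witnessed by [y]: it lies in every colon of [adjoin J y], but
   not in [q], as it is regular modulo [J]. *)
have qy : ~ q y by rewrite /q /colon /= => /reg h; case: pq => _ + _; apply;
  rewrite /colon /= mul1r.
have [z [Uz nz]] : exists z, U z /\ ~ adjoin J y z.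
  apply: contrapT => none.
  have next (w : {w | U w}) : {w' : {w | U w} | J (sval w - y * sval w')}.
    apply: cid; case: w => w Uw /=; apply: contrapT => h; apply: none; exists w;
      split=> // -[a ha].
    have Ua : U a.
      move=> b qb; apply: reg.
      have -> : y * (b * a) = b * w - b * (w - a * y) by ring.
      by apply: idealB => //; [apply: Uw|apply: idealM].
    by apply: h; exists (exist _ a Ua); rewrite /= mulrC.
  have Ux : U x by [].
  pose w := fix w n : {w | U w} :=
    if n is n'.+1 then sval (next (w n')) else exist _ x Ux.
  have wS n : J (sval (w n) - y * sval (w n.+1)) by exact: svalP (next (w n)).
  have wN i n : J (sval (w i) - y ^+ n * sval (w (i + n)%N)).
    elim: n => [|n IH]; first by rewrite addn0 expr0 mul1r subrr; apply: ideal0.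
    have -> : sval (w i) - y ^+ n.+1 * sval (w (i + n.+1)%N) =
      (sval (w i) - y ^+ n * sval (w (i + n)%N)) +
      y ^+ n * (sval (w (i + n)%N) - y * sval (w (i + n).+1)).
      by rewrite addnS exprS; ring.
    by apply: idealD => //; apply: idealM.
  have [N [e eN]] := noetherian_seq noeL (fun n => sval (w n)).
  have [l hl] : exists l, J (sval (w N) - y * l * sval (w N)).
    exists (\sum_(i < N) e i * y ^+ (N - i).-1).
    rewrite [X in X - _]eN mulr_sumr mulr_suml -sumrB.
    apply: ideal_sum => // i _; have := wN i (N - i)%N.
    rewrite subnKC ?(ltnW (ltn_ord i)) // -(@prednK (N - i)) ?subn_gt0 //= exprS => h.
    have -> : e i * sval (w i) - y * (e i * y ^+ (N - i).-1) * sval (w N) =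
       e i * (sval (w i) - y * y ^+ (N - i).-1 * sval (w N)) by ring.
    exact: idealM.
  (* [1 - y * l] is a unit: otherwise [1] would be a sum of two nonunits of a local ring. *)
  have Jx : J (sval (w N)).
    have [[v hv]|nu] := pselect (exists v, (1 - y * l) * v = 1).
      have -> : sval (w N) = v * (sval (w N) - y * l * sval (w N)).
        by rewrite -[LHS]mul1r -hv; ring.
      exact: idealM.
    exfalso; case: (locL) => idm m1 _; apply: m1.
    rewrite -(subrK (y * l) 1); apply: (idealD idm); first exact: nu.
    exact: (idealMr l idm).
  case: pq => _ + _; apply; rewrite /colon /= mul1r.
  have := wN 0%N N; rewrite add0n => /(idealBr hJ); apply.
  exact: idealM.
have [|a [pa _ sa]] := @prime_colon _ noeL (adjoin J y) (@nonunits L) z hJ' locL.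
  apply: proper_nonunits; first exact: colon_ideal.
  by rewrite /colon /= mul1r.
exists (a * z); split=> //; split.
  by move=> b qb; apply: sa; apply: adjoin_sub => //; apply: Uz.
move=> h; apply: qy; apply: h; apply: sa.
by exists z; rewrite mulrC subrr; apply: ideal0.
Qed.

(** This is the inequality [depth L <= dim L / q] for an associated prime [q], with the chain made
    explicit: each element of the regular sequence enlarges the current associated prime strictly by
    [depth_step]. *)
Lemma depth_chain (u : seq L) z : regular_seq L^o u -> (forall x, x \in u ->
  nonunits x) ->
  prime_ideal (colon [set 0] z) ->
  exists c, strict_chain (@prime_ideal L) (size u) c /\ c 0%N = colon [set 0] z.
Proof.
move=> /regular_seqP[reg _] hu pq.
suff H n : (n <= size u)%N -> exists c, [/\ strict_chain (@prime_ideal L) n c,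
    c 0%N = colon [set 0] z & exists x, c n = colon (seq_ideal (take n u)) x].
  by have [c [h1 h2 _]] := H _ (leqnn _); exists c.
elim: n => [_|n IH lt].
  exists (fun=> colon [set 0] z); split=> //.
  by exists z; rewrite take0 seq_ideal_nil.
have [c [sc c0 [x cn]]] := IH (ltnW lt).
have [||||x' [px' sx']] := @depth_step (seq_ideal (take n u)) x u`_n.
- exact: seq_ideal_ideal.
- by rewrite -cn; case: sc => + _; apply.
- by apply: hu; apply: mem_nth.
- exact: reg.
have e : seq_ideal (take n.+1 u) = adjoin (seq_ideal (take n u)) u`_n.
  by rewrite (take_nth 0) // seq_ideal_rcons.
rewrite -e in px' sx'.
exists (fun i => if (i <= n)%N then c i else colon (seq_ideal (take n.+1 u)) x');
  split=> //.
  by apply: strict_chain_rcons => //; rewrite cn.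
by exists x'; rewrite ltnn.
Qed.

End Depth.

Section Localization.
Variables (A : comPzRingType) (M : set A).
Hypothesis pM : prime_ideal M.
Local Notation L := (locr (~` M)).

Lemma mspan_prime : mspan (~` M) = ~` M.
Proof.
apply/seteqP; split=> x; last by move=> Mx N [_]; apply.
apply; split=> //; split=> /=; first by case: pM.
by move=> s t; apply: primeNM.
Qed.

Definition loc_frac (a : A) (s : denom (~` M)) : L := \pi_L (a : A^o, s).
Definition loc_in (a : A) : L := loc_frac a (denom1 _).

Lemma dval_notin (s : denom (~` M)) : ~ M (dval s).
Proof. by have := denomP s; rewrite mspan_prime. Qed.

Lemma loc_fracP a s b t : loc_frac a s = loc_frac b t <->
  exists2 u, ~ M u & u * (dval t * a) = u * (dval s * b).
Proof.
apply: iff_trans (locrP (a : A^o, s) (b : A^o, t)) _.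
by split=> -[u hu e]; exists u => //; move: hu; rewrite mspan_prime.
Qed.


Lemma loc_fracD a s b t :
  loc_frac a s + loc_frac b t = loc_frac (dval t * a + dval s * b) (denomM s t).
Proof. exact: (locr_piD (a : A^o, s) (b : A^o, t)). Qed.

Lemma loc_fracM a s b t : loc_frac a s * loc_frac b t = loc_frac (a * b) (denomM s t).
Proof. exact: (locr_piM (a : A^o, s) (b : A^o, t)). Qed.

Lemma loc_frac_ind (Q : L -> Prop) : (forall a s, Q (loc_frac a s)) -> forall x, Q x.
Proof. by move=> h; elim/quotW => -[a s]; exact: h. Qed.

Lemma notM1 : ~ M 1. Proof. by case: pM. Qed.

Lemma loc_in_zmod : zmod_morphism loc_in.
Proof.
move=> x y; apply: (canRL (addrK _)); rewrite loc_fracD; apply/loc_fracP.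
by exists 1; [exact: notM1|rewrite !dvalM !dval1; ring].
Qed.

Lemma loc_in_monoid : monoid_morphism loc_in.
Proof.
split=> // x y; rewrite loc_fracM; apply/loc_fracP.
by exists 1; [exact: notM1|rewrite !dvalM !dval1; ring].
Qed.

HB.instance Definition _ := GRing.isZmodMorphism.Build A L loc_in loc_in_zmod.
HB.instance Definition _ := GRing.isMonoidMorphism.Build A L loc_in loc_in_monoid.

Lemma loc_inE a s : loc_in a = loc_in (dval s) * loc_frac a s.
Proof.
rewrite loc_fracM; apply/loc_fracP.
by exists 1; [exact: notM1|rewrite !dvalM !dval1; ring].
Qed.

Lemma loc_frac_inE a s : loc_frac a s = loc_frac 1 s * loc_in a.
Proof.
rewrite loc_fracM; apply/loc_fracP.
by exists 1; [exact: notM1|rewrite !dvalM !dval1; ring].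
Qed.

Lemma loc_in0 : loc_in 0 = 0.
Proof. exact: rmorph0. Qed.

Lemma loc_ideal_frac (I : set L) a s : ideal I -> I (loc_frac a s) <-> I (loc_in a).
Proof.
move=> hI; split=> h; first by rewrite (loc_inE a s); apply: idealM.
by rewrite loc_frac_inE; apply: idealM.
Qed.

Lemma loc_in_unit s : ~ M s -> exists y, loc_in s * y = 1.
Proof.
move=> hs; have Ds : mspan (~` M) s by rewrite mspan_prime.
exists (loc_frac 1 (mkdenom Ds)); rewrite loc_fracM; apply/loc_fracP.
by exists 1; [exact: notM1|rewrite !dvalM !dval1 /dval /=; ring].
Qed.

Definition loc_ext (P : set A) : set L := [set x | exists a s, P a /\ x = loc_frac a s].

Lemma loc_extP P a s : prime_ideal P -> P `<=` M -> loc_ext P (loc_frac a s) <-> P a.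
Proof.
move=> [idP P1 PM] sPM; split=> [[b [t [Pb /loc_fracP[u nu e]]]]|Pa]; last by exists a, s.
have : P (u * (dval t * a)) by rewrite e; do 2!apply: idealM => //.
case/PM; first by move=> /sPM.
by case/PM => // /sPM /dval_notin.
Qed.

Lemma loc_ext_prime P : prime_ideal P -> P `<=` M -> prime_ideal (loc_ext P).
Proof.
move=> pP sPM; have idP := prime_ideal_id pP; split.
- apply: mk_ideal.
  + by exists 0, (denom1 _); split; [exact: ideal0|rewrite -[LHS](rmorph0 loc_in)].
  + elim/loc_frac_ind => a s; elim/loc_frac_ind => b t.
    rewrite loc_fracD !loc_extP // => Pa Pb.
    by apply: idealD => //; apply: idealM.
  + elim/loc_frac_ind => a s; elim/loc_frac_ind => b t.
    by rewrite loc_fracM !loc_extP // => Pb; apply: idealM.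
- have -> : (1 : L) = loc_frac 1 (denom1 _) by [].
  by rewrite loc_extP //; case: pP.
- elim/loc_frac_ind => a s; elim/loc_frac_ind => b t.
  by rewrite loc_fracM !loc_extP //; case: pP => _ _; apply.
Qed.

Lemma loc_extK P : prime_ideal P -> P `<=` M -> loc_in @^-1` (loc_ext P) = P.
Proof.
by move=> pP sPM; apply/seteqP; split=> x /=; rewrite loc_extP.
Qed.

Lemma loc_ext_strict P Q : prime_ideal P -> prime_ideal Q -> Q `<=` M -> P `<` Q ->
  loc_ext P `<` loc_ext Q.
Proof.
move=> pP pQ sQM [sPQ nQP]; have sPM := subset_trans sPQ sQM; split.
  by move=> x [a [s [/sPQ Qa ->]]]; exists a, s.
move=> h; apply: nQP => x Qx.
have /h : loc_ext Q (loc_in x) by rewrite loc_extP.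
by rewrite loc_extP.
Qed.

Lemma loc_contract_sub (I : set L) : ideal I -> ~ I 1 -> loc_in @^-1` I `<=` M.
Proof.
move=> hI I1 x /= Ix; apply: contrapT => /loc_in_unit[y xy]; apply: I1.
by rewrite -xy; apply: idealMr.
Qed.

Lemma loc_contract_strict (I J : set L) : ideal I -> ideal J -> I `<` J ->
  loc_in @^-1` I `<` loc_in @^-1` J.
Proof.
move=> hI hJ [s ns]; split; first by move=> x; apply: s.
move=> h; apply: ns; elim/loc_frac_ind => a t.
by rewrite !loc_ideal_frac //; apply: h.
Qed.

Lemma loc_nonunits : @nonunits L = loc_ext M.
Proof.
apply/seteqP; split; elim/loc_frac_ind => a s.
  rewrite loc_extP // => nu; apply: contrapT => /loc_in_unit[y ay]; apply: nu.
  exists (loc_in (dval s) * y).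
  by rewrite mulrA [loc_frac a s * _]mulrC -loc_inE.
rewrite loc_extP // => Ma [y hy]; have [_ + _] := loc_ext_prime pM (@subset_refl _ M);
  apply.
rewrite -hy; apply: idealMr; last by rewrite loc_extP.
by have [] := loc_ext_prime pM (@subset_refl _ M).
Qed.

(** An ideal of the localization is generated by the images of the generators of its contraction. *)
Lemma loc_noetherian : noetherian A -> noetherian L.
Proof.
move=> noeA I hI; have [s hs] := noeA _ (preim_ideal loc_in hI).
exists (map loc_in s : seq L^o); apply/seteqP; split; last first.
  apply: lspan_sub => // _ /= /mapP[x xs ->].
  have : lspan [set` s] x by apply: lspan_gen.
  by rewrite -hs.
elim/loc_frac_ind => a t; rewrite !loc_ideal_frac //; last exact: lspan_ideal.
have h : ideal (loc_in @^-1` (lspan [set` map loc_in s : seq L^o] : set L)).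
  by apply: preim_ideal; apply: lspan_ideal.
move=> Ia; have : lspan [set` s] a by rewrite -hs.
apply: (lspan_sub (N := [set` s]) h) => x /= xs.
by apply: lspan_gen; apply: map_f.
Qed.

Lemma loc_chain_ext n c : strict_chain (@prime_ideal A) n c -> c n `<=` M ->
  strict_chain (@prime_ideal L) n (fun i => loc_ext (c i)).
Proof.
move=> sc cM; have s i : (i <= n)%N -> c i `<=` M.
  by move=> le; apply: subset_trans cM; exact: strict_chain_le sc le (leqnn n).
split=> i hi; first by apply: loc_ext_prime (s _ hi); exact: sc.1.
apply: loc_ext_strict; [| |exact: s|].
- by case: sc => + _; apply; apply: ltnW.
- by case: sc => + _; apply.
- by case: sc => _; apply.
Qed.

Lemma loc_chain_contract n c : strict_chain (@prime_ideal L) n c ->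
  strict_chain (@prime_ideal A) n (fun i =>
    loc_in @^-1` (c i)) /\ loc_in @^-1` (c n) `<=` M.
Proof.
move=> sc; split; last by have [h1 h2 _] := sc.1 n (leqnn n); exact: loc_contract_sub.
apply: (@strict_chain_map _ _ _ _ (fun I => loc_in @^-1` I)) sc => [P|P Q].
  exact: preim_prime.
by move=> [iP _ _] [iQ _ _]; exact: loc_contract_strict.
Qed.

End Localization.

(* A minimal prime [q] is associated, so it starts a chain of length [depth A_M],
   which is [dim A_M]; if its contraction to [S] were not [0], adjoining [0] to the
   contracted chain and lifting it back would give a longer chain below [M]. *)
Lemma minimal_prime_contract (S A : comNzRingType) (f : {rmorphism S -> A}) (M q :
  set A) :
  integral_morphism f -> injective f -> prime_ideal [set 0 : S] ->
  cohen_macaulay A -> maximal_ideal M -> prime_ideal M ->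
  (forall Q, prime_ideal Q -> f @^-1` Q = f @^-1` M -> Q `<=` M) ->
  prime_ideal q -> (forall q', prime_ideal q' -> q' `<=` q -> q' = q) -> q `<=` M ->
  f @^-1` q = [set 0].
Proof.
move=> intf injf p0 [noeA cmA] mM pM hM pq qmin sqM.
have [n [kdim [dep _]]] := cmA M mM.
have noeL := loc_noetherian pM noeA.
have locL : prime_ideal (@nonunits (locr (~` M))).
  by rewrite loc_nonunits //; apply: loc_ext_prime.
(* The case of infinite grade would put [1] among the nonunits. *)
have [|[u [szu hu reg]]] := dep.
  move=> e; exfalso; case: (locL) => idm m1 _; apply: m1.
  have : lspan (smul (locr (~` M))^o (@nonunits (locr (~` M)))) 1 by rewrite e.
  apply: (lspan_sub (N := smul (locr (~` M))^o _) idm) => // _ [x nx [y _ <-]].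
  exact: (idealMr y idm nx).
have [|a [pa sa _]] := @prime_colon _ noeA [set 0] q 1 (@zero_ideal A) pq.
  by move=> x; rewrite /colon /= mulr1 => ->; exact: ideal0 (prime_ideal_id pq).
rewrite mulr1 in pa sa; have {sa} qE : colon [set 0] a = q by apply: qmin.
have qeE : colon [set 0] (loc_in M a) = loc_ext q.
  apply/seteqP; split; elim/loc_frac_ind => b s.
    rewrite loc_extP // /colon /= loc_fracM // -(loc_in0 pM) => /(loc_fracP pM)[v nv].
    rewrite mulr0 mulr0 => e.
    have : q (v * (dval (denom1 (~` M)) * b)) by rewrite -qE /colon /= -!mulrA.
    by rewrite dval1 mul1r; case: pq => _ _ h /h[] // /sqM.
  rewrite loc_extP // -qE /colon /= loc_fracM // => ->.
  by rewrite (loc_frac_inE pM) (loc_in0 pM) mulr0.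
have pqe : prime_ideal (loc_ext q : set (locr (~` M))) by exact: loc_ext_prime.
have [||c [sc c0]] := @depth_chain _ noeL locL u (loc_in M a) reg.
- by move=> x xu; apply: hu.
- by rewrite qeE.
rewrite szu in sc; rewrite qeE in c0.
have [scA cM] := loc_chain_contract pM sc.
have scS := contract_chain intf scA; rewrite /= in scS.
apply: contrapT => nq0.
have scS' := @strict_chain_cons _ _ _ [set 0] _ scS p0.
have {scS'} scS' : strict_chain (@prime_ideal S) n.+1
  (fun i => if i is j.+1 then f @^-1` (loc_in M @^-1` (c j)) else [set 0]).
  apply: scS'; rewrite c0 loc_extK //; split.
    by move=> _ ->; rewrite /= rmorph0; exact: ideal0 (prime_ideal_id pq).
  move=> h; apply: nq0; apply/seteqP; split=> // _ ->.
  by rewrite /= rmorph0; exact: ideal0 (prime_ideal_id pq).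
have [|Q0 [pQ0 _ Q0E]] := @lying_over _ _ f intf [set 0] [set 0] (@zero_ideal A) p0.
  by move=> x /= h; apply: injf; rewrite rmorph0.
have [c' [sc' _ c'n]] := lift_chain intf pQ0 Q0E scS'.
(* Only the contraction of the top of the lifted chain is known, not its position relative to [M]. A
   prime above it with the contraction of [M] lies in [M] by [hM], so the whole chain does. *)
have [|||N [pN sN NE]] := @lying_over _ _ f intf (c' n.+1) (f @^-1` M).
- by have [] := sc'.1 n.+1 (leqnn _).
- exact: preim_prime.
- by rewrite c'n => x; apply: cM.
have c'M := subset_trans sN (hM N pN NE).
have := loc_chain_ext pM sc' c'M.
by move=> h; case: kdim => _; apply; eexists; exact: h.
Qed.

(** * Going down along a principal prime *)

Section GoingDown.
Variables (S A : comNzRingType) (f : {rmorphism S -> A}).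

(** A basis over the fraction field of [S / (Q \cap S)], chosen greedily from [l] and stated without
    fractions: the [e i] are independent modulo [Q], and [s] is a common denominator for the
    elements of [l]. *)
Lemma max_independent (Q : set A) (l : seq A) : prime_ideal Q ->
  exists r (e : nat -> A) s, [/\ ~ Q (f s),
    forall t : nat -> S, Q (\sum_(i < r) f (t i) * e i) ->
      forall i, (i < r)%N -> Q (f (t i))
    & forall x, x \in l -> exists b : nat -> S, Q (f s * x - \sum_(i < r) f (b i) * e i)].
Proof.
move=> pQ; have idQ := prime_ideal_id pQ; have [_ Q1 QM] := pQ.
elim: l => [|x l [r [e [s [hs ind gen]]]]].
  by exists 0%N, (fun=> 0), 1; split=> //; rewrite rmorph1.
have [[w [hw [b hb]]]|none] := pselect (exists w, ~ Q (f w) /\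
    exists b : nat -> S, Q (f w * x - \sum_(i < r) f (b i) * e i)).
  exists r, e, (w * s); split=> //; first by rewrite rmorphM => /QM[].
  move=> y; rewrite inE => /orP[/eqP->|/gen[b' hb']].
    exists (fun i => s * b i); rewrite rmorphM (mulrC (f w)) -mulrA.
    under eq_bigr do rewrite rmorphM -mulrA.
    by rewrite -mulr_sumr -mulrBr; apply: idealM.
  exists (fun i => w * b' i); rewrite rmorphM -mulrA.
  under eq_bigr do rewrite rmorphM -mulrA.
  by rewrite -mulr_sumr -mulrBr; apply: idealM.
exists r.+1, (fun i => if i is j.+1 then e j else x), s; split=> //.
  move=> t; rewrite big_ord_recl /= => ht.
  have Qt0 : Q (f (t 0%N)).
    apply: contrapT => nt; apply: none; exists (t 0%N); split=> //.
    exists (fun i => - t i.+1); under eq_bigr do rewrite rmorphN mulNr.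
    by rewrite sumrN opprK.
  move=> [//|i]; rewrite ltnS; apply: (ind (fun i => t i.+1)).
  apply: (idealBl idQ) (_ : Q (f (t 0%N) * x + \sum_(i < r) f (t i.+1) * e i)) => //.
  by rewrite addrK; apply: idealMr.
move=> y; rewrite inE => /orP[/eqP->|/gen[b hb]].
  exists (fun i => if i is 0 then s else 0).
  rewrite big_ord_recl /= big1 ?addr0 ?subrr; first exact: ideal0.
  by move=> i _; rewrite rmorph0 mul0r.
exists (fun i => if i is j.+1 then b j else 0).
by rewrite big_ord_recl /= rmorph0 mul0r add0r.
Qed.

(** In the domain [S / q] the element [u] is prime and does not divide [t], so the factors [u] of
    [u ^+ n * c] can be moved to [b] one at a time. *)
Lemma prime_power_quotient (q : set S) u t b c n m : prime_ideal q -> ~ q u ->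
  prime_ideal (adjoin q u) -> ~ adjoin q u t -> (m <= n)%N ->
  q (t ^+ n * b - u ^+ n * c) -> exists b', q (b - u ^+ m * b').
Proof.
move=> pq nu pq' nt; have idq := prime_ideal_id pq; have [_ _ qM] := pq.
move=> + h; elim: m => [_|m IH lt].
  by exists b; rewrite expr0 mul1r subrr; apply: ideal0.
have [b' hb'] := IH (ltnW lt).
have : q (u ^+ m * (t ^+ n * b' - u ^+ (n - m) * c)).
  have -> : u ^+ m * (t ^+ n * b' - u ^+ (n - m) * c) =
    (t ^+ n * b - (u ^+ m * u ^+ (n - m)) * c) - t ^+ n * (b - u ^+ m * b') by ring.
  rewrite -exprD subnKC; last exact: ltnW.
  by apply: idealB => //; apply: idealM.
case/qM => [/(primeX pq) //|h'].
have [_ _ q'M] := pq'.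
have : adjoin q u (t ^+ n * b').
  exists (u ^+ (n - m).-1 * c).
  have -> : u ^+ (n - m).-1 * c * u = u ^+ (n - m).-1.+1 * c by rewrite exprS; ring.
  by rewrite prednK ?subn_gt0.
case/q'M => [/(primeX pq') //|[b'' hb'']].
exists b''; rewrite (_ : _ - _ = (b - u ^+ m * b') + u ^+ m * (b' - b'' * u)).
  by apply: idealD => //; apply: idealM.
by rewrite exprS; ring.
Qed.

Hypotheses (noeA : noetherian A) (finf : finite_module (restrict_scalars f)).

(* If [t b = u c] modulo [Q] with [t] outside [q + u S], multiplying [b^n] by a
   denominator [s] of [A / Q] over a free [S / q]-submodule shows that [u^n] divides
   [s b^n] for all [n]; by noetherianity [b / u] is integral, and [b] lies in every
   prime containing [Q] and [u]. *)
Lemma going_down_principal (Q N : set A) u : prime_ideal Q -> prime_ideal N ->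
  Q `<=` N -> N (f u) -> ~ Q (f u) -> prime_ideal (adjoin (f @^-1` Q) u) ->
  exists Q', [/\ prime_ideal Q', Q `<` Q', Q' `<=` N & f @^-1` Q' = adjoin (f @^-1` Q) u].
Proof.
move=> pQ pN sQN Nu nQu pq'; set q' := adjoin _ u.
have idQ := prime_ideal_id pQ; have idN := prime_ideal_id pN.
have pq : prime_ideal (f @^-1` Q) by exact: preim_prime.
have [_ Q1 QM] := pQ; have [_ N1 NM] := pN; have [idq' q'1 q'M] := pq'.
have key t b : ~ q' t -> ~ N b -> ~ adjoin Q (f u) (f t * b).
  move=> nt nb [c hc]; apply: nb.
  have [n [g hg]] := finite_module_gen finf.
  have [r [e [s [hs ind gen]]]] := max_independent [seq g i | i <- enum 'I_n] pQ.
  have {}gen x : exists b : nat -> S, Q (f s * x - \sum_(i < r) f (b i) * e i).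
    have [a ->] := hg x.
    have [B hB] := choice (fun i => gen _ (map_f g (mem_enum 'I_n i))).
    exists (fun i => \sum_j a j * B j i).
    have -> : \sum_(i < r) f (\sum_j a j * B j i) * e i =
        \sum_j f (a j) * \sum_(i < r) f (B j i) * e i.
      under [RHS]eq_bigr do rewrite mulr_sumr.
      rewrite exchange_big /=; apply: eq_bigr => i _.
      rewrite rmorph_sum mulr_suml; apply: eq_bigr => j _.
      by rewrite rmorphM mulrA.
    rewrite mulr_sumr -sumrB; apply: ideal_sum => // j _.
    by rewrite mulrCA -mulrBr; apply: idealM.
  have pow m : Q ((f t * b) ^+ m - (c * f u) ^+ m).
    by rewrite subrXX; apply: idealMr.
  have div m : exists z, Q (f s * b ^+ m - f u ^+ m * z).
    have [be hbe] := gen (b ^+ m); have [ga hga] := gen (c ^+ m).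
    have hq j : (j < r)%N -> (f @^-1` Q) (t ^+ m * be j - u ^+ m * ga j).
      apply: (ind (fun i => t ^+ m * be i - u ^+ m * ga i)).
      have -> : \sum_(i < r) f (t ^+ m * be i - u ^+ m * ga i) * e i =
          f s * ((f t * b) ^+ m - (c * f u) ^+ m)
          - f t ^+ m * (f s * b ^+ m - \sum_(i < r) f (be i) * e i)
          + f u ^+ m * (f s * c ^+ m - \sum_(i < r) f (ga i) * e i).
        transitivity (f t ^+ m * (\sum_(i < r) f (be i) * e i) - f u ^+ m * (\sum_(i < r) f (ga i) * e i)).
          rewrite !mulr_sumr -sumrB; apply: eq_bigr => i _.
          by rewrite rmorphB !rmorphM !rmorphXn mulrBl !mulrA.
        by rewrite !exprMn; ring.
      apply: idealD => //; last exact: idealM.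
      by apply: idealB => //; apply: idealM.
    have [de hde] : exists de : nat -> S, forall j, (j < r)%N ->
      Q (f (be j - u ^+ m * de j)).
      have h j : exists z, (j < r)%N -> Q (f (be j - u ^+ m * z)).
        have [lt|ge] := ltnP j r; last by exists 0.
        have [z hz] := prime_power_quotient pq nQu pq' nt (leqnn m) (hq j lt).
        by exists z.
      by have [de hde] := choice h; exists de.
    exists (\sum_(i < r) f (de i) * e i).
    have -> : f s * b ^+ m - f u ^+ m * (\sum_(i < r) f (de i) * e i) =
      (f s * b ^+ m - \sum_(i < r) f (be i) * e i) + \sum_(i < r) f (be i - u ^+ m * de i) * e i.
      have -> : \sum_(i < r) f (be i - u ^+ m * de i) * e i =
         \sum_(i < r) f (be i) * e i - f u ^+ m * (\sum_(i < r) f (de i) * e i).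
        rewrite mulr_sumr -sumrB; apply: eq_bigr => i _.
        by rewrite rmorphB rmorphM rmorphXn mulrBl mulrA.
      by ring.
    apply: idealD => //; apply: ideal_sum => // i _.
    by apply: idealMr => //; apply: hde.
  have [z hz] := choice div.
  (* Writing [z m] in terms of earlier [z i] and multiplying by [f u ^+ m] gives an equation in
     which [f s] cancels modulo [Q]. It expresses [b ^+ m] by terms divisible by [f u], all of which
     lie in [N]. *)
  have [m [a ha]] := noetherian_seq noeA z.
  apply: (primeX (n := m)) pN _.
  have : Q (f s * (b ^+ m - \sum_(i < m) a i * f u ^+ (m - i) * b ^+ i)).
    have -> : f s * (b ^+ m - \sum_(i < m) a i * f u ^+ (m - i) * b ^+ i) =
      (f s * b ^+ m - f u ^+ m * z m) -
      \sum_(i < m) a i * f u ^+ (m - i) * (f s * b ^+ i - f u ^+ i * z i).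
      have -> : f u ^+ m * z m = \sum_(i < m) a i * f u ^+ (m - i) * (f u ^+ i * z i).
        rewrite ha mulr_sumr; apply: eq_bigr => i _.
        by rewrite -{1}(subnK (ltnW (ltn_ord i))) exprD; ring.
      rewrite -addrA -opprD -big_split /= mulrBr mulr_sumr; congr (_ - _).
      by apply: eq_bigr => i _; ring.
    apply: idealB => //; apply: ideal_sum => // i _; exact: idealM.
  case/QM => // /sQN /(idealBr idN); apply.
  apply: ideal_sum => // i _; apply: idealMr => //; apply: idealM => //.
  rewrite -(@prednK (m - i)) ?subn_gt0 // exprS; exact: idealMr.
(* A prime that avoids all these products lies in [N] (take [t = 1]) and contracts into [q'] (take
   [b = 1]). *)
have [|||P [pP sP dis _]] := @maximal_disjoint_prime _ (adjoin Q (f u))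
    [set x | exists t b, [/\ ~ q' t, ~ N b & x = f t * b]] (adjoin_ideal _ idQ).
- by exists 1, 1; split=> //; rewrite rmorph1 mulr1.
- move=> _ _ [t [b [nt nb ->]]] [t' [b' [nt' nb' ->]]]; exists (t * t'), (b * b').
  by split; [move=> /q'M[]|move=> /NM[]|rewrite rmorphM; ring].
- by move=> x hx [t [b [nt nb e]]]; move: hx; rewrite e; apply: key.
have sQP : Q `<=` P by move=> x Qx; apply: sP; apply: adjoin_sub.
have Pu : P (f u) by apply: sP; apply: adjoin_gen.
exists P; split=> //.
- by split=> // /(_ _ Pu).
- by move=> x Px; apply: contrapT => nx; apply: (dis _ Px); exists 1, x;
  rewrite rmorph1 mul1r.
- apply/seteqP; split=> x /= Px.
    by apply: contrapT => nx; apply: (dis _ Px); exists x, 1; rewrite mulr1.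
  have [a ha] := Px; have := sQP _ ha; rewrite rmorphB rmorphM =>
    /(idealBr (prime_ideal_id pP)).
  by apply; apply: idealM => //; exact: prime_ideal_id.
Qed.

End GoingDown.

(** * Linear forms in a polynomial ring *)

Lemma ideal_prodB (R : comPzRingType) (I : set R) (K : Type) (r : seq K) (F G : K -> R) :
  ideal I -> (forall i, I (F i - G i)) -> I (\prod_(i <- r) F i - \prod_(i <- r) G i).
Proof.
move=> hI h; elim: r => [|i r IH]; first by rewrite !big_nil subrr; apply: ideal0.
rewrite !big_cons; set x := \prod_(j <- r) F j; set y := \prod_(j <- r) G j.
have -> : F i * x - G i * y = F i * (x - y) + y * (F i - G i) by ring.
by apply: idealD => //; apply: idealM.
Qed.

Lemma ideal_zero_prime (S : idomainType) : prime_ideal [set 0 : S].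
Proof.
split; [exact: zero_ideal|by apply/eqP; rewrite oner_eq0|].
by move=> x y /= /eqP; rewrite mulf_eq0 => /orP[]/eqP; [left|right].
Qed.

Section PolynomialRing.
Variables (k : fieldType) (d : nat).
Local Notation T := (mpoly d k).
Definition mvar (i : 'I_d) : T := mpolyX k (mnm1 i).

Lemma mpoly_ring_ind (Q : T -> Prop) : (forall c, Q (mpolyC d c)) -> (forall i,
  Q (mvar i)) ->
  (forall p q, Q p -> Q q -> Q (p + q)) -> (forall p q, Q p -> Q q -> Q (p * q)) ->
  forall p, Q p.
Proof.
move=> hC hX hD hM p; elim/mpolyind: p => [|c a p _ _ IH]; first by rewrite -mpolyC0.
apply: (hD) => //; rewrite -mul_mpolyC; apply: (hM) => //.
rewrite mpolyXE_id; apply: (@big_ind _ Q) => [||i _]; [by rewrite -mpolyC1|exact: (hM)|].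
elim: (a i) => [|n IHn]; first by rewrite expr0 -mpolyC1.
by rewrite exprS; apply: hM => //; exact: hX.
Qed.

(** The ideal generated by the variables, given as the kernel of evaluation at the origin, so that
    primality is immediate. *)
Definition mpoly_plus : set T := [set p | meval (fun=> 0) p = 0].

Lemma mpoly_plus_prime : prime_ideal mpoly_plus.
Proof. exact: (preim_prime (meval (fun _ : 'I_d => 0 : k)) (ideal_zero_prime k)). Qed.

Lemma mpoly_plus_var i : mpoly_plus (mvar i).
Proof. by rewrite /mpoly_plus /= mevalXU. Qed.

Lemma mpoly_plus_sub (I : set T) : ideal I -> (forall i, I (mvar i)) -> mpoly_plus `<=` I.
Proof.
move=> hI hX p p0.
suff : I (p - mpolyC d (meval (fun=> 0) p)) by rewrite p0 mpolyC0 subr0.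
elim/mpoly_ring_ind: p {p0} => [c|i|p q hp hq|p q hp hq].
- by rewrite mevalC subrr; apply: ideal0.
- by rewrite mevalXU mpolyC0 subr0.
- by rewrite mevalD mpolyCD opprD addrACA; apply: idealD.
- rewrite mevalM mpolyCM; set a := mpolyC d _; set b := mpolyC d _ in hq *.
  have -> : p * q - a * b = q * (p - a) + a * (q - b) by ring.
  by apply: idealD => //; apply: idealM.
Qed.

Section Linear.
Variables (c : 'I_d -> k) (j : 'I_d).

(** The forms with [i != j] cut out the point of projective space whose [j]-th coordinate is 1 and
    whose other coordinates are the [c i]. *)
Definition lin (i : 'I_d) : T := mvar i - mpolyC d (c i) * mvar j.

Definition lin_subst (s : seq 'I_d) : T -> T :=
  mmap (@mpolyC d k) (fun i => if i \in s then mpolyC d (c i) * mvar j else mvar i).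

HB.instance Definition _ s := GRing.RMorphism.on (lin_subst s).

Lemma lin_substC s a : lin_subst s (mpolyC d a) = mpolyC d a.
Proof. by rewrite /lin_subst mmapC. Qed.

Lemma lin_substX s i :
  lin_subst s (mvar i) = if i \in s then mpolyC d (c i) * mvar j else mvar i.
Proof. by rewrite /lin_subst mmapX mmap1U. Qed.

(** Each polynomial is congruent to its image under the substitution, as one checks on constants and
    variables. Since [j] is outside [s], the substitution fixes the variable of index [j] and so
    kills the forms. Being a kernel into a domain, the ideal is prime. *)
Lemma lin_ideal_ker s : j \notin s ->
  seq_ideal (map lin s) = lin_subst s @^-1` [set 0].
Proof.
move=> js; have hI := seq_ideal_ideal (map lin s); apply/seteqP; split.
  apply: seq_ideal_le; first exact: preim_ideal (@zero_ideal _).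
  move=> _ /mapP[i si ->];
    rewrite /= rmorphB rmorphM /= lin_substC !lin_substX si (negPf js).
  by rewrite subrr.
move=> p p0; suff : seq_ideal (map lin s) (p - lin_subst s p) by rewrite p0 subr0.
elim/mpoly_ring_ind: p {p0} => [a|i|p q hp hq|p q hp hq].
- by rewrite lin_substC subrr; exact: ideal0 hI.
- rewrite lin_substX; case: ifP => [si|_]; last by rewrite subrr; exact: ideal0 hI.
  by apply: seq_ideal_gen; apply: map_f.
- by rewrite rmorphD /= opprD addrACA; exact: idealD hI hp hq.
- rewrite rmorphM /=; set a := lin_subst s p; set b := lin_subst s q.
  have -> : p * q - a * b = q * (p - a) + a * (q - b) by ring.
  by apply: (idealD hI); [exact: (idealM q hI)|exact: (idealM a hI)].
Qed.

Lemma lin_ideal_prime s : j \notin s -> prime_ideal (seq_ideal (map lin s)).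
Proof. by move=> js; rewrite lin_ideal_ker //;
  apply: preim_prime (ideal_zero_prime _). Qed.

Lemma mvar_inj (i l : 'I_d) a : mvar i = mpolyC d a * mvar l -> i = l.
Proof.
move=> /(congr1 (mcoeff (mnm1 i))); rewrite /mvar mul_mpolyC mcoeffZ !mcoeffX eqxx.
case: eqP => [e _|_]; last by rewrite mulr0 => /eqP; rewrite oner_eq0.
by move/(congr1 (fun m : multinom d => m i)): e; rewrite !mnm1E eqxx; case: eqP => // ->.
Qed.

Lemma mvar_neq0 i : mvar i <> 0.
Proof.
by move=> /(congr1 (mcoeff (mnm1 i))); rewrite mcoeffX eqxx mcoeff0 => /eqP;
  rewrite oner_eq0.
Qed.

Lemma lin_notin s i : j \notin s -> i \notin s -> i != j ->
  ~ seq_ideal (map lin s) (lin i).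
Proof.
move=> js si ij; rewrite lin_ideal_ker //= rmorphB rmorphM /= lin_substC !lin_substX (negPf si) (negPf js).
by move=> /eqP; rewrite subr_eq0 => /eqP/mvar_inj e; rewrite e eqxx in ij.
Qed.

Lemma var_notin s : j \notin s -> ~ seq_ideal (map lin s) (mvar j).
Proof. by move=> js; rewrite lin_ideal_ker //= lin_substX (negPf js);
  apply: mvar_neq0. Qed.

Lemma lin_ideal_plus s : seq_ideal (map lin s) `<=` mpoly_plus.
Proof.
have idp := prime_ideal_id mpoly_plus_prime.
apply: seq_ideal_le => // _ /mapP[i _ ->]; apply: idealB => //; last apply: idealM => //;
  exact: mpoly_plus_var.
Qed.

(** Each initial segment generates a prime ideal that omits the next form. *)
Lemma lin_regular s : uniq s -> j \notin s -> regular_seq T^o (map lin s).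
Proof.
move=> us js; apply/regular_seqP; split; last by have [] := lin_ideal_prime js.
move=> i; rewrite size_map => lt x; rewrite (nth_map j) // -map_take.
have jt : j \notin take i s by apply: contra js; apply: mem_take.
have it : nth j s i \notin take i s.
  by move: us; rewrite -{1}(cat_take_drop i s) cat_uniq (drop_nth j lt) =>
    /and3P[_ /norP[]].
have ij : nth j s i != j by apply: contra js => /eqP {1}<-; apply: mem_nth.
by have [_ _ h] := lin_ideal_prime jt; case/h => // /(lin_notin jt it ij).
Qed.

End Linear.

Lemma homog_grading m n p : p \is ishomog1 n mdeg -> mpoly_grading k (fun _ : 'I_d =>
  m) (m * n)%N p.
Proof. by move=> /dhomogP h a /h /= <-; rewrite mdegE big_distrr. Qed.

Lemma mvar_homog i : mvar i \is ishomog1 1 mdeg.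
Proof. by rewrite /mvar dhomogX /= mdeg1. Qed.

Lemma mpolyC_homog (a : k) : mpolyC d a \is ishomog1 0 mdeg.
Proof. by apply/dhomogP => b; rewrite msuppC; case: ifP => // _; rewrite inE =>
  /eqP-> /=; rewrite mdeg0. Qed.

Lemma lin_homog c j i : lin c j i \is ishomog1 1 mdeg.
Proof.
rewrite rpredB ?mvar_homog // -[1%N]add0n.
by apply: dhomogM; [exact: mpolyC_homog|exact: mvar_homog].
Qed.

Lemma pihomog_mulX n p j : pihomog mdeg n.+1 (p * mvar j) = pihomog mdeg n p * mvar j.
Proof.
have h e : pihomog mdeg e p * mvar j \is ishomog1 e.+1 mdeg.
  by rewrite -addn1; apply: dhomogM; [exact: pihomogP|exact: mvar_homog].
pose N := maxn (msize p) n.+1.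
rewrite {1}(@pihomog_partitionE _ _ mdeg N p) ?leq_maxl // mulr_suml raddf_sum.
have lt : (n < N)%N by rewrite leq_max ltnSn orbT.
rewrite (bigD1 (Ordinal lt)) //= (pihomog_dE (h n)) big1 ?addr0 // => i ni.
by apply: pihomog_ne0 (h i); rewrite eqSS; apply: contra ni => /eqP e; apply/eqP/val_inj.
Qed.

End PolynomialRing.

Section LinearForms.
Variables (k : closedFieldType) (d : nat).
Local Notation T := (mpoly d k).

(* Modulo [I + (X_j - 1)] every monomial of degree more than [d N] is congruent to a
   form of smaller degree, so that the quotient is finite over [k] and [X_i] is a
   root of a monic polynomial over [k]. *)
Lemma dehomog_split (I : set T) j : ideal I ->
  (forall i, exists N h, h \is ishomog1 N mdeg /\ I (mvar k i ^+ N.+1 - h * mvar k j)) ->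
  forall i, exists cs : seq k,
    adjoin I (mvar k j - 1) (\prod_(a <- cs) (mvar k i - mpolyC d a * mvar k j)).
Proof.
move=> hI hN i; set J := adjoin I _; have hJ : ideal J by exact: adjoin_ideal.
have {hN} [N hN] : exists N, forall i, exists2 h,
  h \is ishomog1 N mdeg & I (mvar k i ^+ N.+1 - h * mvar k j).
  have [M hM] := choice hN; exists (\max_i M i) => l.
  have [h [hh Ih]] := hM l; have le : (M l <= \max_i M i)%N by exact: leq_bigmax.
  exists (h * mvar k l ^+ (\max_i M i - M l)).
    rewrite -[X in ishomog1 X](subnKC le); apply: dhomogM => //.
    by have := dhomogMn (\max_i M i - M l) (mvar_homog k l); rewrite mul1n.
  have -> : mvar k l ^+ (\max_i M i).+1 - h * mvar k l ^+ (\max_i M i - M l) * mvar k j =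
     mvar k l ^+ (\max_i M i - M l) * (mvar k l ^+ (M l).+1 - h * mvar k j).
    by rewrite mulrBr -exprD addnS subnK //; congr (_ - _); ring.
  exact: idealM.
(* The bound is the pigeonhole one: in degree above [d * N] some variable has exponent at least
   [N.+1], so its power can be replaced by [h * mvar k j], and then by [h], of degree one less. *)
pose B := bmultinom d (d * N).+1.
pose e (l : 'I_#|{: B}|) : T := mpolyX k (bmnm (enum_val l)).
pose W p := exists b : 'I_#|{: B}| -> k, J (p - \sum_l mpolyC d (b l) * e l).
have WD p q : W p -> W q -> W (p + q).
  move=> [b hb] [b' hb']; exists (fun l => b l + b' l).
  under eq_bigr do rewrite mpolyCD mulrDl.
  by rewrite big_split /= opprD addrACA; apply: idealD.
have WZ a p : W p -> W (a *: p).
  move=> [b hb]; exists (fun l => a * b l).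
  under eq_bigr do rewrite mpolyCM -mulrA.
  by rewrite -mulr_sumr -mul_mpolyC -mulrBr; apply: idealM.
have W0 : W 0.
  exists (fun=> 0); rewrite big1 ?subrr; first exact: ideal0.
  by move=> l _; rewrite mpolyC0 mul0r.
have Whom n p : (forall a, mdeg a = n -> W (mpolyX k a)) -> p \is ishomog1 n mdeg -> W p.
  move=> hn /dhomogP hp; rewrite (mpolyE p) big_seq.
  by elim/big_ind: _ => // a /hp /hn h; apply: WZ.
have WJ p q : J (p - q) -> W q -> W p.
  move=> Jpq [b hb]; exists b; rewrite -(subrK q p) -addrA; exact: idealD.
have Wmon n a : mdeg a = n -> W (mpolyX k a).
  elim/ltn_ind: n a => n IH a an.
  have [le|gt] := leqP n (d * N).
    have lt : (mdeg a < (d * N).+1)%N by rewrite an ltnS.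
    exists (fun l => (l == enum_rank (BMultinom lt))%:R).
    rewrite (bigD1 (enum_rank (BMultinom lt))) //= eqxx big1 ?addr0.
      by rewrite /e enum_rankK mpolyC1 mul1r subrr; apply: ideal0.
    by move=> l /negPf->; rewrite mpolyC0 mul0r.
  have [l hl] : exists l, (N < a l)%N.
    apply: contrapT => none; move: gt; rewrite ltnNge => /negP; apply.
    rewrite -an mdegE -[d in (d * N)%N]card_ord -sum_nat_const leq_sum // => l _.
    by rewrite leqNgt; apply/negP => lt; apply: none; exists l.
  have [h hh Ih] := hN l.
  pose a' := mnm_sub a (mnm_muln (mnm1 l) N.+1).
  have ea : a = mnm_add a' (mnm_muln (mnm1 l) N.+1).
    apply/mnmP => i'; rewrite mnmDE mnmBE mulmnE mnm1E.
    by case: eqP => [<-|_]; rewrite ?mul1n ?mul0n ?subn0 ?addn0 // subnK.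
  have en : n = (mdeg a' + N.+1)%N by rewrite -an {1}ea mdegD mdegMn mdeg1 mul1n.
  have eX : mpolyX k a = mpolyX k a' * mvar k l ^+ N.+1 by rewrite {1}ea mpolyXD mpolyXn.
  apply: (WJ _ (mpolyX k a' * h)).
    rewrite eX -mulrBr; apply: idealM => //.
    have -> : mvar k l ^+ N.+1 - h = (mvar k l ^+ N.+1 - h * mvar k j) + h * (mvar k j - 1) by ring.
    by apply: idealD => //; [apply: adjoin_sub|apply: idealM => //; apply: adjoin_gen].
  have lt : (mdeg a' + N < n)%N by rewrite en addnS.
  apply: (Whom (mdeg a' + N)%N) => [b hb|]; first exact: IH lt b hb.
  by apply: dhomogM => //; rewrite dhomogX.
have gen p : W p.
  rewrite (mpolyE p); elim/big_ind: _ => // a _; exact/WZ/Wmon.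
have [P Pm JP] := @integral_modulo k T (@mpolyC d k) J _ e hJ gen (mvar k i).
have [cs Pcs] := closed_field_poly_normal P.
rewrite (monicP Pm) scale1r in Pcs.
exists cs.
have JP' : J (\prod_(a <- cs) (mvar k i - mpolyC d a)).
  move: JP; rewrite Pcs rmorph_prod horner_prod.
  by under eq_bigr do rewrite rmorphB /= map_polyX map_polyC hornerXsubC.
(* Rehomogenization: modulo [mvar k j - 1] each factor [mvar k i - mpolyC d a] is congruent to a
   linear form. *)
apply: (idealBr hJ) JP'; apply: ideal_prodB => // a.
rewrite (_ : _ - _ = - mpolyC d a * (mvar k j - 1)); last by ring.
by apply: idealM => //; apply: adjoin_gen.
Qed.

End LinearForms.

(** * Quotients and graded morphisms *)

Section QuotientPrimes.
Variables (R : comPzRingType) (P : set R).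
Hypothesis idP : ideal P.
Local Notation Q := (quotr P).

Definition quotr_in (x : R) : Q := \pi_Q x.

Lemma quotr_in_zmod : zmod_morphism quotr_in.
Proof. by move=> x y; apply: (canRL (addrK _)); rewrite -quotr_piD subrK. Qed.

Lemma quotr_in_monoid : monoid_morphism quotr_in.
Proof. by split=> // x y; exact: (esym (quotr_piM P x y)). Qed.

HB.instance Definition _ := GRing.isZmodMorphism.Build R Q quotr_in quotr_in_zmod.
HB.instance Definition _ := GRing.isMonoidMorphism.Build R Q quotr_in quotr_in_monoid.

Lemma quotr_in_eq x y : quotr_in x = quotr_in y <-> P (x - y).
Proof.
have h : lspan (P : set R^o) = P by apply: lspan_setE => // z; exact: lspan_gen.
split=> [/eqP/(@lquotP _ _ (P : set R^o))|hP]; first by rewrite h.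
by apply/eqP/(@lquotP _ _ (P : set R^o)); rewrite h.
Qed.

Lemma quotr_in_surj (y : Q) : exists x, y = quotr_in x.
Proof. by elim/quotW: y => x; exists x. Qed.

Lemma quotr_preim_strict (I J : set Q) : I `<` J -> quotr_in @^-1` I `<` quotr_in @^-1` J.
Proof.
move=> [s ns]; split; first by move=> x; apply: s.
by move=> h; apply: ns => y; have [x ->] := quotr_in_surj y; apply: h.
Qed.

Lemma quotr_imageP (I : set R) x : ideal I -> P `<=` I ->
  (quotr_in @` I) (quotr_in x) <-> I x.
Proof.
move=> hI sPI; split=> [[y Iy /quotr_in_eq/sPI h]|Ix]; last by exists x.
exact: idealBl h Iy.
Qed.

Lemma quotr_image_prime I : prime_ideal I -> P `<=` I -> prime_ideal (quotr_in @` I).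
Proof.
move=> pI sPI; have idI := prime_ideal_id pI; have [_ I1 IM] := pI; split.
- apply: mk_ideal.
  + by rewrite -(rmorph0 quotr_in); apply/quotr_imageP => //; apply: ideal0.
  + move=> _ _ [x Ix <-] [y Iy <-]; rewrite -rmorphD; apply/quotr_imageP => //;
    exact: idealD.
  + move=> a _ [x Ix <-]; have [b ->] := quotr_in_surj a.
    by rewrite -rmorphM; apply/quotr_imageP => //; exact: idealM.
- by rewrite -(rmorph1 quotr_in) quotr_imageP.
- move=> x y; have [a ->] := quotr_in_surj x; have [b ->] := quotr_in_surj y.
  by rewrite -rmorphM !quotr_imageP //; apply: IM.
Qed.

Lemma krull_dim_quotr n : krull_dim (quotr P) n <->
  longest_chain [set I | prime_ideal I /\ P `<=` I] n.
Proof.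
have up m : (exists c, strict_chain (@prime_ideal Q) m c) ->
    exists c, strict_chain [set I | prime_ideal I /\ P `<=` I] m c.
  move=> [c sc]; eexists.
  apply: (@strict_chain_map _ _ _ _ (fun I => quotr_in @^-1` I)) sc => [I pI|I J _ _].
    split; first exact: preim_prime.
    move=> x Px; have -> : (quotr_in @^-1` I) x = I (quotr_in x) by [].
    suff -> : quotr_in x = 0 by exact: ideal0 (prime_ideal_id pI).
    by rewrite -(rmorph0 quotr_in); apply/quotr_in_eq; rewrite subr0.
  exact: quotr_preim_strict.
have down m : (exists c, strict_chain [set I | prime_ideal I /\ P `<=` I] m c) ->
    exists c, strict_chain (@prime_ideal Q) m c.
  move=> [c sc]; eexists.
  apply: (@strict_chain_map _ _ _ _ (fun I => quotr_in @` I)) sc => [I []|I J].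
    exact: quotr_image_prime.
  move=> [pI sI] [pJ sJ] [sIJ nIJ]; split; first by move=> _ [x /sIJ Jx <-]; exists x.
  move=> h; apply: nIJ => x Jx; apply/(quotr_imageP x (prime_ideal_id pI) sI)/h.
  by exists x.
by split=> -[h1 h2]; split; [exact: up|move=> /down|exact: down|move=> /up].
Qed.

End QuotientPrimes.

Section GradedMorphism.
Variables (k : fieldType) (d m : nat) (B : comNzRingType) (gr : nat -> set B).
Variable h : {rmorphism mpoly d k -> B}.
Hypotheses (hgr : grading gr) (m0 : (0 < m)%N).
Hypothesis hh : forall n x, mpoly_grading k (fun=> m) n x -> gr n (h x).

Lemma graded_homog n p : p \is ishomog1 n mdeg -> gr (m * n)%N (h p).
Proof. by move=> /homog_grading /hh. Qed.

Lemma graded_var i : gr m (h (mvar k i)).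
Proof. by have := graded_homog (mvar_homog k i); rewrite muln1. Qed.

(** As [m > 0], the component of degree 0 of [h p] is the image of the constant term of [p]. A
    homogeneous [P] contains it, and a nonzero constant would be a unit in [P]. *)
Lemma graded_plus P : homogeneous_ideal gr P -> ~ P 1 -> h @^-1` P `<=` @mpoly_plus k d.
Proof.
move=> hP P1 p Pp; have idP := hP.1; rewrite /mpoly_plus /=; set a := meval _ p.
pose I : set (mpoly d k) := [set q | (hpoly hgr (h q))`_0 = 0].
have idI : ideal I.
  apply: mk_ideal => [|x y|x y]; rewrite /I /=.
  - by rewrite rmorph0 hpoly0 coef0.
  - by rewrite rmorphD hpolyD coefD => -> ->; rewrite addr0.
  - by rewrite rmorphM hpolyM coef0M => ->; rewrite mulr0.
have Ipa : I (p - mpolyC d a).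
  apply: (mpoly_plus_sub idI) => [i|].
    by rewrite /I /= (hpoly_hom hgr (graded_var i)) coefZ coefXn ltn_eqF // mulr0.
  by rewrite /mpoly_plus /= mevalB mevalC subrr.
have ha : gr 0%N (h (mpolyC d a)).
  by have := graded_homog (mpolyC_homog d a); rewrite muln0.
have Pa : P (h (mpolyC d a)).
  have -> : h (mpolyC d a) = (hpoly hgr (h p))`_0.
    rewrite -(subrK (mpolyC d a) p) rmorphD hpolyD coefD Ipa add0r.
    by rewrite (hpoly_hom hgr ha) coefZ coefXn eqxx mulr1.
  exact: (homogeneous_idealP hgr idP).1.
apply: contrapT => /eqP na; apply: P1.
have -> : 1 = h (mpolyC d a^-1) * h (mpolyC d a).
  by rewrite -rmorphM -mpolyCM mulVf // mpolyC1 rmorph1.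
exact: idealM.
Qed.

(** The homogeneous parts of [p] map to different degrees [m * n], because [m > 0]; so they give the
    components of [h p]. *)
Lemma graded_pihomog P n p : homogeneous_ideal gr P -> P (h p) ->
  P (h (pihomog mdeg n p)).
Proof.
move=> hP Pp; pose N := maxn (msize p) n.+1.
have lt : (n < N)%N by rewrite leq_max ltnSn orbT.
pose q := \sum_(e < N) h (pihomog mdeg e p) *: 'X^(m * e).
have hq : hpoly hgr (h p) = q.
  have -> : h p = q.[1].
    rewrite {1}(@pihomog_partitionE _ _ mdeg N p) ?leq_maxl // rmorph_sum horner_sum.
    by apply: eq_bigr => e _; rewrite hornerZ hornerXn expr1n mulr1.
  apply: hpoly_uniq => i; rewrite coef_sum; apply: (grading_bigsum hgr) => e _.
  rewrite coefZ coefXn; have [->|_] := eqVneq i (m * e)%N.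
    by rewrite mulr1; apply: graded_homog; exact: pihomogP.
  by rewrite mulr0; exact: grading0.
have := (homogeneous_idealP hgr hP.1).1 hP _ (m * n)%N Pp.
rewrite hq coef_sum (bigD1 (Ordinal lt)) //= coefZ coefXn eqxx mulr1 big1 ?addr0 //.
move=> e ne; rewrite coefZ coefXn eqn_pmul2l // eq_sym.
by case: eqP => [E|_]; [case/eqP: ne; exact/val_inj|rewrite mulr0].
Qed.

End GradedMorphism.

(** * Lengths of localized cyclic modules *)

Section ModuleLength.
Variables (S : comPzRingType) (V : lmodType S).

Lemma longest_chain_exists (T : Type) (C : set (set T)) N :
  (exists c, strict_chain C 1 c) -> ~ (exists c, strict_chain C N c) ->
  exists n, longest_chain C n.
Proof.
move=> h1 hN; apply: contrapT => none; apply: hN.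
have h n : exists c, strict_chain C n.+1 c.
  by elim: n => [//|n IH]; apply: contrapT => hn; apply: none; exists n.+1.
by have [c sc] := h N; exists c; exact: strict_chain_trunc (leqnSn N) sc.
Qed.

Lemma mod_lengthP n : longest_chain (submodule V) n ->
  longest_chain (submodule V) (mod_length V).
Proof. by move=> h; rewrite /mod_length; apply: xgetPex; exists n. Qed.

Lemma zero_submodule : submodule V [set 0].
Proof. by split=> // a x y -> ->; rewrite scaler0 addr0. Qed.

(** The bound on chains matters as much as the nonzero element: a module of infinite length has
    [mod_length] 0. *)
Lemma mod_length_gt0 N : (exists x : V, x <> 0) ->
  ~ (exists c, strict_chain (submodule V) N c) -> (0 < mod_length V)%N.
Proof.
move=> [x nx] hN.
have h1 : exists c, strict_chain (submodule V) 1 c.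
  exists (fun i => if i is 0 then [set 0] else setT); split=> -[|[|//]] // _.
    exact: zero_submodule.
  by split=> // /(_ x I).
have [n /mod_lengthP[_ h]] := longest_chain_exists h1 hN.
by rewrite lt0n; apply/eqP => e; apply: h; rewrite e.
Qed.

Lemma mod_length_trivial : (forall x : V, x = 0) -> mod_length V = 0%N.
Proof.
move=> triv; rewrite /mod_length; case: xgetP => // n _ [[c [Cc sc]] _].
case: n Cc sc => // n Cc sc; have [_ h] := sc 0%N isT.
exfalso; apply: h => x _; rewrite (triv x); exact: (Cc 0%N isT).1.
Qed.

End ModuleLength.

Section LocalizedQuotient.
Variables (R : comNzRingType) (Q : set R) (x : R).
Hypothesis idQ : ideal Q.
Local Notation V := (lquot (smul (lquot (Q : set R^o)) [set x])).

Definition cyc_in (r : R) : V :=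
  \pi_V (\pi_(lquot (Q : set R^o)) (r : R^o) : lquot (Q : set R^o)).

Lemma lspan_idealE : lspan (Q : set R^o) = Q.
Proof. by apply: lspan_setE => // z; exact: lspan_gen. Qed.

Lemma cyc_inD r s : cyc_in (r + s) = cyc_in r + cyc_in s.
Proof. by rewrite /cyc_in -lquot_piD; congr (\pi_V _); exact: (lquot_piD (Q :
  set R^o)). Qed.

Lemma cyc_inZ a r : cyc_in (a * r) = a *: cyc_in r.
Proof.
rewrite /cyc_in -[RHS]/(lquot_scale a _) lquot_piZ; congr (\pi_V _).
exact/esym/(lquot_piZ (Q : set R^o)).
Qed.

Lemma cyc_in_surj (v : V) : exists r, v = cyc_in r.
Proof. by elim/quotW: v => v; elim/quotW: v => r; exists r. Qed.

(** Identifies the iterated quotient in [div_coef] with the cyclic module [R / (Q + x R)]. *)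
Lemma cyc_in_eq0 r : cyc_in r = 0 <-> adjoin Q x r.
Proof.
apply: iff_trans (lquot_pi_eq0 _ _) _; split=> [h|[a ha]].
  pose N := [set w | exists r', w = \pi_(lquot (Q : set R^o)) (r' :
    R^o) /\ adjoin Q x r'].
  have : N (\pi_(lquot (Q : set R^o)) (r : R^o)).
    apply: h; split.
      split.
        exists 0; split; last exact: ideal0 (adjoin_ideal x idQ).
        by apply/esym/lquot_pi_eq0; rewrite lspan_idealE; exact: ideal0.
      move=> b _ _ [r1 [-> h1]] [r2 [-> h2]]; exists (b * r1 + r2); split.
        rewrite -[_ *: _]/(lquot_scale b _) lquot_piZ; exact/esym/(lquot_piD (Q :
          set R^o)).
      apply: idealD (adjoin_ideal x idQ) _ h2; exact: idealM (adjoin_ideal x idQ) h1.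
    move=> _ [_ -> [w _ <-]]; elim/quotW: w => r'; exists (x * r'); split.
      by rewrite -[LHS]/(lquot_scale x _) lquot_piZ.
    by exists r'; rewrite mulrC subrr; exact: ideal0.
  move=> [r' [/eqP/lquotP]]; rewrite lspan_idealE => hr [b hb]; exists b.
  by rewrite (_ : r - b * x = (r - r') + (r' - b * x)); [exact: idealD|ring].
apply: lspan_gen; exists x => //; exists (\pi_(lquot (Q : set R^o)) (a : R^o)) => //.
rewrite -[LHS]/(lquot_scale x _) lquot_piZ; apply/eqP/lquotP; rewrite lspan_idealE.
by rewrite -opprB; apply: (idealN idQ); rewrite mulrC in ha.
Qed.

Section AtPrime.
Variable P : set R.
Hypothesis pP : prime_ideal P.
Local Notation W := (locm (~` P) V).

Definition cyc_loc (r : R) : W := \pi_W (cyc_in r, denom1 (~` P)).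

Lemma locm_zeroE : (0 : W) = \pi_W (0, denom1 (~` P)).
Proof. by []. Qed.

Lemma cyc_loc_eq0 r : cyc_loc r = 0 <-> exists2 s, ~ P s & adjoin Q x (s * r).
Proof.
rewrite locm_zeroE; apply: iff_trans (locmP _ _) _; split=> -[s hs e].
  exists s; first by rewrite mspan_prime in hs.
  apply/cyc_in_eq0; rewrite cyc_inZ.
  by move: e; rewrite /= dval1 !scale1r scaler0.
exists s; first by rewrite mspan_prime.
by rewrite /= dval1 !scale1r scaler0 -cyc_inZ; apply/cyc_in_eq0.
Qed.

Lemma cyc_locD r s : cyc_loc (r + s) = cyc_loc r + cyc_loc s.
Proof.
rewrite [RHS]locm_pi_add; apply/locmP; exists 1; first exact: mspan1.
by rewrite /= dvalM !dval1 mulr1 !scale1r cyc_inD.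
Qed.

Lemma cyc_loc0 : cyc_loc 0 = 0.
Proof. by apply: (addrI (cyc_loc 0)); rewrite addr0 -cyc_locD addr0. Qed.

Lemma cyc_loc_sum n (F : 'I_n -> R) : cyc_loc (\sum_i F i) = \sum_i cyc_loc (F i).
Proof. exact: (big_morph _ cyc_locD cyc_loc0). Qed.

Lemma cyc_locZ a r : cyc_loc (a * r) = loc_in P a *: cyc_loc r.
Proof.
rewrite -[RHS]/(locm_scale _ _) [RHS]locm_piZ; apply/locmP; exists 1; first exact: mspan1.
by rewrite /= dvalM !dval1 mulr1 !scale1r cyc_inZ.
Qed.

(** A fraction and its numerator generate the same submodule, so strict inclusions of submodules are
    witnessed by elements of [R]. *)
Lemma cyc_loc_gen (w : W) : exists r (u u' : locr (~` P)),
  cyc_loc r = u *: w /\ w = u' *: cyc_loc r.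
Proof.
elim/quotW: w => -[v s]; have [r ->] := cyc_in_surj v.
exists r, (loc_in P (dval s)), (loc_frac 1 s); split.
  rewrite -[RHS]/(locm_scale _ _) [RHS]locm_piZ; apply/locmP; exists 1;
    first exact: mspan1.
  by rewrite /= dvalM !dval1 mul1r !scale1r.
rewrite -[RHS]/(locm_scale _ _) [RHS]locm_piZ; apply/locmP; exists 1; first exact: mspan1.
by rewrite /= dvalM !dval1 mulr1 !scale1r.
Qed.

Lemma submoduleZ (S : comPzRingType) (U : lmodType S) (N : set U) a u :
  submodule U N -> N u -> N (a *: u).
Proof. by move=> [N0 h] Nu; rewrite -[_ *: _]addr0; apply: h. Qed.

Lemma submoduleD (S : comPzRingType) (U : lmodType S) (N : set U) u v :
  submodule U N -> N u -> N v -> N (u + v).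
Proof. by move=> [_ h] Nu Nv; have := h 1 u v Nu Nv; rewrite scale1r. Qed.

Lemma submodule_sum (S : comPzRingType) (U : lmodType S) (N : set U) (K : Type)
    (r : seq K) (p : pred K) (F : K -> U) :
  submodule U N -> (forall i, p i -> N (F i)) -> N (\sum_(i <- r | p i) F i).
Proof.
move=> hN h; elim/big_ind: _ => [|u v|i /h //]; first by case: hN.
exact: submoduleD.
Qed.

(* In a relation [sum_i t_i v_i = 0] the last [v_i] whose coefficient is invertible
   lies in the span of the preceding ones, as the later coefficients act by zero. *)
Lemma chain_bound n :
  (forall v : 'I_n -> R, exists t : 'I_n -> R, [/\ exists i, ~ P (t i),
     forall i, P (t i) -> adjoin Q x (t i) & adjoin Q x (\sum_i t i * v i)]) ->
  ~ exists c, strict_chain (submodule W) n c.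
Proof.
move=> dep [c [Cc sc]].
have idJ := adjoin_ideal x idQ.
have pick (i : 'I_n) : exists r, c i.+1 (cyc_loc r) /\ ~ c i (cyc_loc r).
  have [s ns] := sc i (ltn_ord i).
  have [w [cw ncw]] : exists w, c i.+1 w /\ ~ c i w.
    by apply: contrapT => h; apply: ns => w cw; apply: contrapT => nw; apply: h; exists w.
  have [r [u [u' [e e']]]] := cyc_loc_gen w; exists r; split.
    by rewrite e; apply: submoduleZ => //; exact: Cc.
  by move=> h; apply: ncw; rewrite e'; apply: submoduleZ => //; apply: Cc; apply: ltnW.
have [v hv] := choice pick; have [t [[i0 ni0] tP trel]] := dep v.
have hex : exists i : nat, `[< exists2 j : 'I_n, i = j :> nat & ~ P (t j) >].
  by exists i0; apply/asboolP; exists i0.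
have bnd (i : nat) : `[< exists2 j : 'I_n, i = j :> nat & ~ P (t j) >] -> (i <= n)%N.
  by move=> /asboolP[j -> _]; exact: ltnW.
case: (ex_maxnP hex bnd) => _ /asboolP[j -> nj] jmax.
have Cj : submodule W (c j) by apply: Cc; exact: ltnW.
have e0 : \sum_i loc_in P (t i) *: cyc_loc (v i) = 0.
  transitivity (cyc_loc (\sum_i t i * v i)).
    by rewrite cyc_loc_sum; apply: eq_bigr => i _; rewrite cyc_locZ.
  by apply/cyc_loc_eq0; exists 1; [case: pP|rewrite mul1r].
have [_ nvj] := hv j; apply: nvj.
have [y hy] := loc_in_unit pP nj.
have -> : cyc_loc (v j) = y *: (loc_in P (t j) *: cyc_loc (v j)).
  by rewrite scalerA mulrC hy scale1r.
apply: submoduleZ => //.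
move: e0; rewrite (bigD1 j) //= => /eqP; rewrite addr_eq0 => /eqP->.
rewrite -scaleN1r; apply: submoduleZ => //; apply: submodule_sum => // i ij.
have [lt|le] := ltnP i j.
  apply: submoduleZ => //; have [ci _] := hv i.
  have chle a b : (a <= b)%N -> (b <= n)%N -> c a `<=` c b
    by apply: strict_chain_le (conj Cc sc).
  by apply: chle ci => //; exact: ltnW.
have lt : (j < i)%N by rewrite ltn_neqAle le andbT eq_sym; apply: contra ij => /eqP E;
  apply/eqP/val_inj.
have Pi : P (t i).
  apply: contrapT => ni; have : `[< exists2 j : 'I_n, i = j :> nat & ~ P (t j) >]
    by apply/asboolP; exists i.
  by move=> /jmax; rewrite leqNgt lt.
rewrite -cyc_locZ; have -> : cyc_loc (t i * v i) = 0.
  apply/cyc_loc_eq0; exists 1; first by case: pP.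
  by rewrite mul1r; apply: idealMr => //; exact: tP.
by case: Cj.
Qed.

End AtPrime.

(** An element outside [P] that kills the cyclic module becomes invertible at [P], so the
    localization vanishes. *)
Lemma div_coef_eq0 P s : prime_ideal P -> ~ P s -> adjoin Q x s -> div_coef Q x P = 0%N.
Proof.
move=> pP ns hs; apply: mod_length_trivial => w.
have [r [u [u' [_ ->]]]] := cyc_loc_gen w.
rewrite (_ : cyc_loc P r = 0) ?scaler0 //; apply/(cyc_loc_eq0 pP); exists s => //.
by apply: idealMr => //; exact: adjoin_ideal.
Qed.

Lemma div_coef_gt0 P n : prime_ideal P -> Q `<=` P -> P x ->
  (forall v : 'I_n -> R, exists t : 'I_n -> R, [/\ exists i, ~ P (t i),
     forall i, P (t i) -> adjoin Q x (t i) & adjoin Q x (\sum_i t i * v i)]) ->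
  (0 < div_coef Q x P)%N.
Proof.
move=> pP sQP Px /(chain_bound pP); apply: mod_length_gt0.
exists (cyc_loc P 1) => /(cyc_loc_eq0 pP)[s ns]; rewrite mulr1.
by move=> /(adjoin_le (prime_ideal_id pP) sQP Px).
Qed.

End LocalizedQuotient.

Section ChowTorsion.
Variables (R : comNzRingType) (gr : nat -> set R) (i : nat).

Lemma chow_div_single (Q : hprime gr i.+1) x (P : hprime gr i) :
  (forall P' : hprime gr i, P' <> P -> div_coef (sval Q) x (sval P') = 0%N) ->
  chow_div Q x = << (div_coef (sval Q) x (sval P))%:Z *g P >>.
Proof.
move=> h; rewrite /chow_div -(fsbig_widen [set P]) ?fsbig_set1 // => P' [_ /= ne].
by rewrite h // freegU0.
Qed.

Lemma chow_torsion : (forall P : hprime gr i, exists2 n : nat, (0 < n)%N &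
    lspan (@principal_cycles R gr i) << n%:Z *g P >>) ->
  torsion_group (chow gr i).
Proof.
move=> h; elim/quotW => z.
suff [n n0 hn] : exists2 n : nat, (0 < n)%N & lspan (@principal_cycles R gr i) (z *+ n).
  exists n => //; have -> :
    \pi_(chow gr i) z *+ n = \pi_(lquot (@principal_cycles R gr i)) (z *+ n).
    elim: (n) => [|l IH]; last by rewrite !mulrS lquot_piD IH.
    by rewrite !mulr0n; apply/esym/lquot_pi_eq0;
      case: (lspan_submodule (@principal_cycles R gr i)).
  exact/lquot_pi_eq0.
have sub := lspan_submodule (@principal_cycles R gr i).
elim/freeg_ind_dom0: z => [|a P D _ _ [n n0 hn]].
  by exists 1%N => //; rewrite mul0rn; case: sub.
have [l l0 hl] := h P; exists (l * n)%N; first by rewrite muln_gt0 l0.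
rewrite mulrnDl; apply: (submoduleD sub); last first.
  rewrite mulnC mulrnA.
  have -> : D *+ n *+ l = l%:Z *: (D *+ n : chow_cycle gr i).
    by rewrite -[in RHS](intz l%:Z) scaler_int.
  exact: (submoduleZ _ sub hn).
have -> : << a *g P >> *+ (l * n) = (n%:Z * a) *: (<< l%:Z *g P >> : chow_cycle gr i).
  rewrite -[in RHS](intz (n%:Z * a)) scaler_int freeg_mulz freeg_muln; congr << _ *g _ >>.
  by rewrite -mulr_natr -mulrzr intz natz PoszM; ring.
exact: (submoduleZ _ sub hl).
Qed.

End ChowTorsion.

(** * The finite extension *)

Lemma mpoly_plus_maximal (k : fieldType) d (q : set (mpoly d k)) : ideal q -> ~ q 1 ->
  @mpoly_plus k d `<=` q -> q `<=` @mpoly_plus k d.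
Proof.
move=> iq q1 sq x qx; rewrite /mpoly_plus /=; set a := meval _ x.
have qa : q (mpolyC d a).
  apply: idealBl iq _ qx; apply: sq.
  by rewrite /mpoly_plus /= mevalB mevalC subrr.
apply: contrapT => /eqP na; apply: q1.
rewrite -mpolyC1 -(mulVf na) mpolyCM; exact: idealM.
Qed.

Definition others d (j : 'I_d) := [seq i <- enum 'I_d | i != j].

Lemma others_uniq d (j : 'I_d) : uniq (others j).
Proof. by rewrite filter_uniq // enum_uniq. Qed.

Lemma others_notin d (j : 'I_d) : j \notin others j.
Proof. by rewrite mem_filter eqxx. Qed.

Lemma others_size d (j : 'I_d) : size (others j) = d.-1.
Proof.
have := cardC1 j; rewrite card_ord => <-; rewrite -(card_uniqP (others_uniq j)).
by apply: eq_card => i; rewrite mem_filter mem_enum !inE andbT.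
Qed.

Lemma lin_chain (k : fieldType) d (c : 'I_d -> k) (j : 'I_d) (s : seq 'I_d) : uniq s ->
  j \notin s ->
  strict_chain (@prime_ideal (mpoly d k)) (size s) (fun i =>
    seq_ideal (map (lin c j) (take i s))).
Proof.
move=> us js; have jt i : j \notin take i s by apply: contra js; apply: mem_take.
split=> i hi; first exact: lin_ideal_prime.
have e : take i.+1 s = rcons (take i s) (nth j s i) by rewrite (take_nth j).
rewrite e map_rcons seq_ideal_rcons; split; first exact: adjoin_sub (seq_ideal_ideal _).
move=> h; apply: (@lin_notin _ _ c j (take i s) (nth j s i)) => //.
- by move: us; rewrite -{1}(cat_take_drop i s) cat_uniq (drop_nth j hi) =>
  /and3P[_ /norP[]].
- by apply: contra js => /eqP {1}<-; apply: mem_nth.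
- by apply: h; apply: adjoin_gen; exact: seq_ideal_ideal.
Qed.

(** Over the fraction field of [S / q] these are [n + 1] vectors in dimension [n]. *)
Lemma prime_dependent (S : comPzRingType) (q : set S) n (M : 'I_n.+1 -> 'I_n -> S) :
  prime_ideal q -> exists t : 'I_n.+1 -> S,
    (exists i, ~ q (t i)) /\ forall b, q (\sum_i t i * M i b).
Proof.
move=> pq; have idq := prime_ideal_id pq; have [_ q1 _] := pq.
elim: n M => [|n IH] M; first by exists (fun=> 1); split=> [|[]//]; exists ord0.
have [all0|/existsNP[i0 npiv]] := pselect (forall i, q (M i ord0)).
  have [t [[i ni] ht]] := IH (fun i b => M (fintype.lift ord0 i) (fintype.lift ord0 b)).
  exists (fun i => if unlift ord0 i is Some i' then t i' else 0); split.
    by exists (fintype.lift ord0 i); rewrite liftK.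
  move=> b; have [b' ->|->] := unliftP ord0 b; last first.
    by apply: ideal_sum => // l _; apply: idealM.
  rewrite (bigD1_ord ord0) //= unlift_none mul0r add0r.
  by under eq_bigr do rewrite liftK; exact: ht.
(* Elimination without fractions: cross-multiplying with the pivot clears the first column, whose
   relation then dictates the coefficient of row [i0]. Multiplying by [pv] keeps a coefficient
   outside the prime [q]. *)
set pv := M i0 ord0 in npiv.
have [t [[i ni] ht]] := IH (fun i b => pv * M (fintype.lift i0 i) (fintype.lift ord0 b)
  - M (fintype.lift i0 i) ord0 * M i0 (fintype.lift ord0 b)).
exists (fun i => if unlift i0 i is Some i' then pv * t i'
  else - \sum_l t l * M (fintype.lift i0 l) ord0); split.
  by exists (fintype.lift i0 i); rewrite liftK; exact: primeNM.
move=> b; rewrite (bigD1_ord i0) //= unlift_none.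
under [X in _ + X]eq_bigr do rewrite liftK.
have [b' ->|->] := unliftP ord0 b.
  rewrite (_ : _ + _ = \sum_l t l * (pv * M (fintype.lift i0 l) (fintype.lift ord0 b')
     - M (fintype.lift i0 l) ord0 * M i0 (fintype.lift ord0 b'))); first exact: ht.
  rewrite mulNr mulr_suml addrC -sumrB; apply: eq_bigr => l _; ring.
rewrite (_ : _ + _ = 0); first exact: ideal0.
rewrite mulNr mulr_suml addrC -sumrB big1 // => l _; rewrite -/pv; ring.
Qed.

Lemma hprime_inj (R : comPzRingType) (gr : nat -> set R) i (P P' : hprime gr i) :
  sval P = sval P' -> P = P'.
Proof.
case: P => P hP; case: P' => P' hP' /= e; move: hP'; rewrite -e => hP'.
by congr exist; exact: bool_irrelevance.
Qed.

Section FiniteExtension.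
Variables (k : closedFieldType) (A : comAlgType k) (grA : nat -> set A) (d m : nat).
Variables (X : 'I_d -> A) (R : comNzRingType) (grR : nat -> set R).
Variables (f : {rmorphism mpoly d k -> R}) (g : {rmorphism R -> A}).
Local Notation T := (mpoly d k).
Local Notation phi := (mpoly_eval X).
Hypotheses (hgA : grading grA) (A0 : grA 0%N = range (GRing.in_alg A)).
Hypotheses (d2 : (2 <= d)%N) (dimA : krull_dim A d) (cmA : cohen_macaulay A).
Hypothesis noeth : noether_normalization grA (fun=> m) X.
Hypothesis uniqA : forall u : (d.-1).-tuple T,
  [set` u] `<=` mpoly_grading k (fun=> m) m -> regular_seq T^o u ->
  (associated_primes_height
     (lquot ([set mpoly_eval X v | v in [set` u]] : set A^o)) d.-1 #= `I_1)%card.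
Hypotheses (hgR : grading grR) (hf : graded_inclusion (mpoly_grading k (fun=> m)) grR f).
Hypotheses (hg : graded_inclusion grR grA g) (gf : forall t, g (f t) = phi t).

Lemma phi_mvar i : phi (mvar k i) = X i.
Proof. by rewrite /mpoly_eval /mvar mmapX mmap1U. Qed.

(** In degree 0 the [X i] would be scalars, against their algebraic independence. *)
Lemma m_gt0 : (0 < m)%N.
Proof.
rewrite lt0n; apply/eqP => m0; have [hX inj _] := noeth.
pose i : 'I_d := Ordinal (ltnW d2).
have := hX i; rewrite m0 A0 => -[a _ e].
have : mvar k i = mpolyC d a by apply: inj; rewrite phi_mvar -e /mpoly_eval mmapC.
move=> /(congr1 (mcoeff (mnm1 i))); rewrite mcoeffX eqxx mcoeffC.
have -> : (mnm1 i == mnm0 :> multinom d) = false.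
  by apply/eqP => /(congr1 (@mdeg d)); rewrite mdeg1 mdeg0.
by rewrite mulr0 => /eqP; rewrite oner_eq0.
Qed.

Lemma phi_integral : integral_morphism phi.
Proof. by have [_ _ h] := noeth;
  exact: (@finite_integral _ _ (phi : {rmorphism T -> A})). Qed.

Lemma f_integral : integral_morphism f.
Proof. exact: (@integral_sub _ _ _ f g (phi : {rmorphism T -> A}) hg.1 gf phi_integral). Qed.

Lemma g_integral : integral_morphism g.
Proof. exact: (@integral_over_sub _ _ _ f g (phi : {rmorphism T -> A}) gf phi_integral). Qed.

Lemma phi_graded n t : mpoly_grading k (fun=> m) n t -> grA n (phi t).
Proof. by move=> /(hf.2 n) /(hg.2 n); rewrite gf. Qed.

(** A chain of [T] lifts to a chain of the same length in the integral extension [A], whose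
    dimension is [d]. *)
Lemma T_dim c : ~ strict_chain (@prime_ideal T) d.+1 c.
Proof.
move=> sc; have [_ inj _] := noeth.
have p0 := sc.1 0%N isT.
have [|Q [pQ _ QE]] := lying_over phi_integral (@zero_ideal A) p0.
  move=> x /= x0; have -> : x = 0 by apply: inj; rewrite x0 /mpoly_eval mmap0.
  exact: ideal0 (prime_ideal_id p0).
have [c' [sc' _ _]] := lift_chain phi_integral pQ QE sc.
by case: dimA => _; apply; exists c'.
Qed.

(** * Homogeneous primes of dimension one and points of projective space *)

Section HomogeneousCurve.
Variable P : set R.
Hypotheses (pP : prime_ideal P) (hP : homogeneous_ideal grR P) (dimP :
  krull_dim (quotr P) 1).
Let p := f @^-1` P.

Lemma curve_chain_above c : ~ strict_chain [set I | prime_ideal I /\ P `<=` I] 2 c.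
Proof.
by move=> sc; have [_] := (krull_dim_quotr (prime_ideal_id pP) 1).1 dimP; apply; exists c.
Qed.

(** Such a [q] would give a chain of length 2 that lifts to a chain of [R] starting at [P]. *)
Lemma curve_between q : prime_ideal q -> p `<` q -> q `<` @mpoly_plus k d -> False.
Proof.
move=> pq pltq qlt.
have sc : strict_chain (@prime_ideal T) 2
    (fun i => if i is i.+1 then if i is 0 then q else @mpoly_plus k d else p).
  split=> -[|[|[|//]]] // _; [exact: preim_prime|exact: mpoly_plus_prime].
have [c [sc' c0 _]] := lift_chain f_integral pP erefl sc.
apply: (@curve_chain_above c); split; last exact: sc'.2.
move=> i hi; split; first exact: sc'.1.
by rewrite -c0; exact: strict_chain_le sc' _ hi.
Qed.

Lemma curve_plus_sub : p `<=` @mpoly_plus k d.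
Proof. by apply: (graded_plus hgR m_gt0 hf.2 hP); case: pP. Qed.

(** If [p] were this maximal ideal, all primes above [P] would have the same contraction, and
    incomparability would make [R / P] zero-dimensional. *)
Lemma curve_ne_plus : p `<` @mpoly_plus k d.
Proof.
split; first exact: curve_plus_sub.
move=> plus_p; have [[c [Cc sc]] _] := (krull_dim_quotr (prime_ideal_id pP) 1).1 dimP.
have [pc0 sPc0] := Cc 0%N isT; have [pc1 sPc1] := Cc 1%N isT.
have [s ns] := sc 0%N isT; apply: ns.
apply: (incomparable f_integral pc0 (prime_ideal_id pc1) s) => x /= Qx.
apply: sPc0; apply: (plus_p); apply: (@mpoly_plus_maximal _ _ (f @^-1` c 1%N)) Qx.
- exact: preim_ideal (prime_ideal_id pc1).
- by rewrite /= rmorph1; case: pc1.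
- by move=> y /plus_p; apply: sPc1.
Qed.

Lemma curve_var : exists j, ~ p (mvar k j).
Proof.
apply: contrapT => none; have [_ h] := curve_ne_plus; apply: h.
apply: mpoly_plus_sub; first exact: preim_ideal (prime_ideal_id pP).
by move=> j; apply: contrapT => nj; apply: none; exists j.
Qed.

Lemma curve_linear j : ~ p (mvar k j) -> exists c, forall i, p (lin c j i).
Proof.
move=> npj; have idp : ideal p := preim_ideal f (prime_ideal_id pP).
have hN i : exists N h, h \is ishomog1 N mdeg /\ p (mvar k i ^+ N.+1 - h * mvar k j).
  (* If all powers were missed, a prime [q] over [p] would contain the variable of index [j] and
     omit that of index [i], and would lead to a prime strictly between [p] and [mpoly_plus]. *)
  have [N hN] : exists N, adjoin p (mvar k j) (mvar k i ^+ N.+1).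
    apply: contrapT => none.
    have [|x y [n ->] [n' ->]|x hx [n e]|q [pq sq dis _]] := @maximal_disjoint_prime _
      (adjoin p (mvar k j)) [set x | exists n, x = mvar k i ^+ n] (adjoin_ideal _ idp).
    - by exists 0%N; rewrite expr0.
    - by exists (n + n')%N; rewrite exprD.
    - apply: none; exists n; rewrite exprS -e; apply: idealM => //; exact: adjoin_ideal.
    have [|Q [pQ sQ QE]] := lying_over f_integral (prime_ideal_id pP) pq.
      by move=> x px; apply: sq; apply: adjoin_sub.
    have idQ := prime_ideal_id pQ.
    (* The prime [q] need not lie in [mpoly_plus], but the contraction of a homogeneous prime does.
       Passing to [hpart] changes neither the inclusion of [p] nor which variables occur, as these
       are homogeneous. *)
    pose Q' := hpart hgR Q.
    have pQ' : prime_ideal Q' := hpart_prime hgR pQ.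
    have Qvar l : Q' (f (mvar k l)) <-> q (mvar k l).
      rewrite -QE; split; first by apply: hpart_sub.
      by move=> h; apply: (@hpart_gen _ _ hgR Q m _ idQ _ h); exact: (graded_var hf.2).
    apply: (@curve_between (f @^-1` Q')); first exact: preim_prime.
      split; first by move=> x px; exact: (homogeneous_hpart hgR idQ hP sQ px).
      move=> h; apply: npj; apply: h; apply/Qvar; apply: sq; exact: adjoin_gen.
    split.
      apply: (graded_plus hgR m_gt0 hf.2); last by case: pQ'.
      exact: hpart_homogeneous.
    move=> h; apply: (dis (mvar k i)); last by exists 1%N; rewrite expr1.
    by apply/Qvar; apply: h; exact: mpoly_plus_var.
  case: hN => a hNa; exists N, (pihomog mdeg N a); split; first exact: pihomogP.
  have := graded_pihomog hgR m_gt0 hf.2 N.+1 hP hNa.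
  rewrite pihomogB pihomog_mulX pihomog_dE //.
  by have := dhomogMn N.+1 (mvar_homog k i); rewrite mul1n.
suff h i : exists a, p (mvar k i - mpolyC d a * mvar k j).
  by have [c hc] := choice h; exists c.
have [cs [a hcs]] := dehomog_split idp hN i.
(* The product of linear forms lies in [p] only modulo [mvar k j - 1]. Being homogeneous, it lies in
   [p] outright by [homogeneous_dehomog], and primality selects one factor. *)
have hom : mpoly_grading k (fun=> m) (m * size cs)%N
    (\prod_(a <- cs) (mvar k i - mpolyC d a * mvar k j)).
  apply: homog_grading; elim: cs {hcs} => [|b cs IH].
    by rewrite big_nil -mpolyC1; exact: mpolyC_homog.
  rewrite big_cons /= -add1n; apply: dhomogM => //.
  exact: (lin_homog (fun=> b) j i).
have : P (f (\prod_(a <- cs) (mvar k i - mpolyC d a * mvar k j))).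
  apply: (homogeneous_dehomog (m := m) (y := f (mvar k j)) (h :=
    f a) hgR pP hP m_gt0 _ npj (hf.2 _ _ hom)).
    exact: (graded_var hf.2).
  by rewrite -(rmorph1 f) -rmorphB -rmorphM -rmorphB.
rewrite rmorph_prod => /(prime_prod pP)[b hb]; by exists b.
Qed.

(** Were the linear forms to generate less than [p], their chain of length [d - 1] followed by [p]
    and [mpoly_plus] would have length [d + 1] in [T]. *)
Lemma curve_contraction : exists j c, p = seq_ideal (map (lin c j) (others j)).
Proof.
have [j npj] := curve_var; have [c hc] := curve_linear npj; exists j, c.
have s : seq_ideal (map (lin c j) (others j)) `<=` p.
  apply: seq_ideal_le; first exact: preim_ideal (prime_ideal_id pP).
  by move=> _ /mapP[i _ ->].
apply: contrapT => ne.
have sc := lin_chain c (others_uniq j) (others_notin j); rewrite others_size in sc.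
have sc1 : strict_chain (@prime_ideal T) 1 (fun i =>
  if i is 0 then p else @mpoly_plus k d).
  by split=> -[|[|//]] // _;
    [exact: preim_prime|exact: mpoly_plus_prime|exact: curve_ne_plus].
have tk : take d.-1 (others j) = others j by rewrite -(others_size j) take_size.
have sc2 := @strict_chain_cons _ _ _ (seq_ideal (map (lin c j) (others j))) _ sc1.
have {}sc2 : strict_chain (@prime_ideal T) 2 (fun i => if i is i.+1 then
    if i is 0 then p else @mpoly_plus k d else seq_ideal (map (lin c j) (others j))).
  apply: sc2; first by apply: lin_ideal_prime; exact: others_notin.
  by split=> // h; apply: ne; apply/seteqP.
have := strict_chain_cat sc sc2; rewrite /= tk addn2 prednK; last exact: ltnW.
by move=> h; apply: (T_dim (h _)).
Qed.

End HomogeneousCurve.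

(** The graded maximal ideal of [A], where the equality of depth and dimension is applied. *)
Let M : set A := [set x | (hpoly hgA x)`_0 = 0].

Lemma degree0_scalar x : exists a, (hpoly hgA x)`_0 = GRing.in_alg A a.
Proof. by have := hpoly_gr hgA x 0; rewrite A0 => -[a _ <-]; exists a. Qed.

Lemma hpoly_scalar a : hpoly hgA (GRing.in_alg A a) = (GRing.in_alg A a)%:P.
Proof.
have h : grA 0%N (GRing.in_alg A a) by rewrite A0; exists a.
by rewrite (hpoly_hom hgA h) expr0 alg_polyC.
Qed.

Lemma M_prime : prime_ideal M.
Proof.
split.
- apply: mk_ideal => [|x y|x y]; rewrite /M /=.
  + by rewrite hpoly0 coef0.
  + by rewrite hpolyD coefD => -> ->; rewrite addr0.
  + by rewrite hpolyM coef0M => ->; rewrite mulr0.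
- by rewrite /M /= hpoly1 coef1 => /eqP; rewrite oner_eq0.
- move=> x y; rewrite /M /= hpolyM coef0M.
  have [a ->] := degree0_scalar x; have [b ->] := degree0_scalar y.
  rewrite -rmorphM => /eqP; rewrite fmorph_eq0 mulf_eq0 => /orP[]/eqP->.
    by left; rewrite rmorph0.
  by right; rewrite rmorph0.
Qed.

Lemma scalar_notin (I : set A) x : ideal I -> ~ I 1 -> I (hpoly hgA x)`_0 -> M x.
Proof.
move=> hI I1; rewrite /M /=; have [a ->] := degree0_scalar x => Ia.
have [->|na] := eqVneq a 0; first by rewrite rmorph0.
exfalso; apply: I1; rewrite -(rmorph1 (GRing.in_alg A)) -(mulVf na) rmorphM.
exact: idealM.
Qed.

Lemma M_maximal : maximal_ideal M.
Proof.
have pM := M_prime; split; [by case: pM|by case: pM|].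
move=> I hI I1 sMI; apply/seteqP; split=> // x Ix; apply: (scalar_notin hI I1).
apply: idealBl hI _ Ix; apply: sMI; rewrite /M /=.
have [a e] := degree0_scalar x; rewrite e.
have := congr1 (fun q : {poly A} =>
  q`_0) (hpolyD hgA (x - GRing.in_alg A a) (GRing.in_alg A a)).
by rewrite subrK coefD hpoly_scalar coefC eqxx e -[X in X = _]add0r => /addIr.
Qed.

Lemma homogeneous_M I : homogeneous_ideal grA I -> ~ I 1 -> I `<=` M.
Proof.
move=> hI I1 x Ix; apply: (scalar_notin hI.1 I1).
exact: (homogeneous_idealP hgA hI.1).1.
Qed.

Lemma M_homogeneous : homogeneous_ideal grA M.
Proof.
have idM := prime_ideal_id M_prime.
apply: (@homogeneous_idealW _ _ hgA M idM) => x Mx n; rewrite /M /=.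
rewrite (hpoly_hom hgA (hpoly_gr hgA x n)) coefZ coefXn.
by case: n => [|n]; rewrite ?mulr0 // eqxx mulr1.
Qed.

Lemma A_minimal_contract q : prime_ideal q ->
  (forall q', prime_ideal q' -> q' `<=` q -> q' = q) -> phi @^-1` q = [set 0].
Proof.
move=> pq qmin; have idq := prime_ideal_id pq.
have [_ inj _] := noeth.
apply: (minimal_prime_contract (f := phi : {rmorphism T -> A}) phi_integral inj
  (ideal_zero_prime _) cmA M_maximal M_prime _ pq qmin).
(* [hpart] of [Q] still contains all the [X i], so it has the same contraction as [Q] and equals [Q]
   by incomparability. Thus [Q] is homogeneous and lies in [M]. *)
- move=> Q pQ QM; have idQ := prime_ideal_id pQ.
  have M1 : ~ M 1 by case: M_prime.
  have var i : M (X i).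
    have [hX _ _] := noeth.
    by rewrite /M /= (hpoly_hom hgA (hX i)) coefZ coefXn ltn_eqF ?m_gt0 // mulr0.
  have s : hpart hgA Q `<=` M.
    apply: homogeneous_M; first exact: hpart_homogeneous.
    by case: (hpart_prime hgA pQ).
  apply: subset_trans s.
  apply: (incomparable phi_integral (hpart_prime hgA pQ) idQ (@hpart_sub _ _ hgA Q idQ)).
  rewrite QM; have sM : phi @^-1` M `<=` @mpoly_plus k d.
    exact: (graded_plus (h := phi : {rmorphism T -> A}) hgA m_gt0 phi_graded M_homogeneous).
  apply: subset_trans sM _; apply: mpoly_plus_sub.
    exact: (preim_ideal (phi : {rmorphism T -> A}) (@hpart_ideal _ _ hgA Q idQ)).
  move=> i; rewrite /= phi_mvar; have [hX _ _] := noeth.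
  apply: (@hpart_gen _ _ hgA Q m _ idQ _ _) => //.
  have : (phi @^-1` Q) (mvar k i) by rewrite QM /= phi_mvar.
  by rewrite /= phi_mvar.
(* A minimal prime is homogeneous, since its [hpart] is a prime inside it. *)
- have e : hpart hgA q = q by apply: qmin; [exact: hpart_prime|exact: hpart_sub].
  by rewrite -e; apply: homogeneous_M; [exact: hpart_homogeneous|rewrite e; case: pq].
Qed.

(** The chain is built upwards from a minimal prime inside [N], which contracts to 0. Each
    application of [going_down_principal] inserts a prime below [N] over the ideal enlarged by one
    more linear form. *)
Lemma A_chain_below c j N : prime_ideal N ->
  phi @^-1` N = seq_ideal (map (lin c j) (others j)) ->
  exists c', strict_chain (@prime_ideal A) d.-1 c' /\ c' d.-1 `<=` N.
Proof.
move=> pN NE; set s := others j in NE *.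
have us : uniq s := others_uniq j; have js : j \notin s := others_notin j.
have sz : size s = d.-1 := others_size j.
have [q [pq sq qmin]] := minimal_prime pN.
have q0 := A_minimal_contract pq qmin.
have sc := lin_chain c us js.
suff H i : (i <= size s)%N -> exists c', [/\ strict_chain (@prime_ideal A) i c',
  c' i `<=` N
    & phi @^-1` (c' i) = seq_ideal (map (lin c j) (take i s))].
  by have [c' [h1 h2 _]] := H _ (leqnn _); rewrite sz in h1 h2; exists c'.
elim: i => [_|i IH hi].
  by exists (fun=> q); split=> //; rewrite take0 seq_ideal_nil.
have [c' [sc' sN e]] := IH (ltnW hi).
have pci := sc'.1 i (leqnn i).
have [pS [sS nS]] := (sc.1 i.+1 hi, sc.2 i hi).
have E : seq_ideal (map (lin c j) (take i.+1 s)) = adjoin (phi @^-1` c' i) (lin c j (nth j s i)).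
  by rewrite (take_nth j) // map_rcons seq_ideal_rcons e.
have lin_s : seq_ideal (map (lin c j) s) (lin c j (nth j s i)).
  by apply: seq_ideal_gen; apply: map_f; apply: mem_nth.
have [||||Q' [pQ' ltQ' sQ' Q'E]] :=
  @going_down_principal _ _ (phi : {rmorphism T -> A}) cmA.1 _
    (c' i) N (lin c j (nth j s i)) pci pN sN.
- by case: noeth.
- by have : (phi @^-1` N) (lin c j (nth j s i)) by rewrite NE.
- move=> h; apply: nS; rewrite E; apply: adjoin_le => //; last by rewrite -e.
    exact: seq_ideal_ideal.
  by rewrite e.
- by rewrite /= -E.
exists (fun l => if (l <= i)%N then c' l else Q'); rewrite ltnn; split=> //.
  exact: strict_chain_rcons.
by rewrite E.
Qed.

Lemma A_unique c j Q1 Q2 : prime_ideal Q1 -> prime_ideal Q2 ->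
  phi @^-1` Q1 = seq_ideal (map (lin c j) (others j)) ->
  phi @^-1` Q2 = seq_ideal (map (lin c j) (others j)) -> Q1 = Q2.
Proof.
move=> pQ1 pQ2 e1 e2; set s := others j in e1 e2.
have us : uniq s := others_uniq j; have js : j \notin s := others_notin j.
have sz : size (map (lin c j) s) == d.-1 by rewrite size_map others_size.
pose u : (d.-1).-tuple T := Tuple sz.
have us1 : [set` u] `<=` mpoly_grading k (fun=> m) m.
  move=> _ /mapP[i _ ->].
  by have := homog_grading m (lin_homog c j i); rewrite muln1.
have /eq_cardSP[Q0 _] := uniqA us1 (lin_regular c us js).
rewrite II0 card_eq0 => /eqP uq.
set J := [set mpoly_eval X v | v in [set` u]] in Q0 uq.
suff H N : prime_ideal N -> phi @^-1` N = seq_ideal (map (lin c j) s) -> N = Q0.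
  by rewrite (H Q1) // (H Q2).
move=> pN NE; apply: contrapT => ne.
suff : (associated_primes_height (lquot (J : set A^o)) d.-1 `\ Q0) N by rewrite uq.
have idN := prime_ideal_id pN.
have idJ : ideal (lspan (J : set A^o)) := lspan_ideal _.
have JN : lspan (J : set A^o) `<=` N.
  apply: (lspan_sub (N := J)) => // _ [v vu <-].
  have : (phi @^-1` N) v by rewrite NE; apply: seq_ideal_gen.
  by [].
split=> //; split; first split=> //.
  (* An associated prime inside [N] contains the linear forms, so its contraction is that of [N],
     and incomparability makes it equal to [N]. *)
  have [|a [pa sa _]] := @prime_colon _ cmA.1 _ N 1 idJ pN.
    by move=> x; rewrite /colon /= mulr1; apply: JN.
  rewrite mulr1 in pa sa; exists (\pi_(lquot (J : set A^o)) (a : A^o)).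
  have <- : colon (lspan (J : set A^o)) a = N.
    symmetry; apply: (incomparable_eq phi_integral pa idN sa).
    rewrite NE; apply: seq_ideal_le; first exact: (preim_ideal (phi : {rmorphism T -> A}) (prime_ideal_id pa)).
    move=> v vs; apply: (idealMr a idJ).
    by apply: (lspan_gen (V := A^o)); exists v.
  have E x : x *: \pi_(lquot (J : set A^o)) (a : A^o) = \pi_(lquot (J :
    set A^o)) (x * a : A^o).
    exact: (lquot_piZ (J : set A^o) x (a : A^o)).
  apply/seteqP; split=> x /= h; first by rewrite E; apply/lquot_pi_eq0; exact: h.
  by move: h; rewrite E => /lquot_pi_eq0.
split.
  have [c' [sc' sN]] := A_chain_below pN NE; exists c'; split; last exact: sc'.2.
  move=> i hi; split; first exact: sc'.1.
  by apply: subset_trans sN; exact: strict_chain_le sc' hi (leqnn _).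
rewrite prednK ?(ltnW d2) // => -[c' sc'].
(* Upper bound on the height: a chain of length [d] below [N], extended by a prime over
   [mpoly_plus], would exceed the dimension of [A]. *)
have [|N' [pN' ltN' _]] := going_up phi_integral idN (@mpoly_plus_prime k d).
  rewrite NE; split; first exact: lin_ideal_plus.
  by move=> h; apply: (@var_notin k d c j s js); apply: h; exact: mpoly_plus_var.
have scA : strict_chain (@prime_ideal A) d c'.
  by split; [move=> i /sc'.1[]|exact: sc'.2].
have lt : c' d `<` N'.
  have [_ sN] := sc'.1 d (leqnn d); case: ltN' => s1 s2; split;
    first exact: subset_trans s1.
  by move=> h; apply: s2; apply: subset_trans sN.
have := strict_chain_rcons scA pN' lt => h.
by case: dimA => _; apply; eexists; exact: h.
Qed.

(** Both primes are contractions of primes of the integral extension [A], and these coincide by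
    [A_unique]. *)
Lemma R_unique c j P1 P2 : prime_ideal P1 -> prime_ideal P2 ->
  f @^-1` P1 = seq_ideal (map (lin c j) (others j)) ->
  f @^-1` P2 = seq_ideal (map (lin c j) (others j)) -> P1 = P2.
Proof.
move=> pP1 pP2 e1 e2; have inj := hg.1.
have lift (P : set R) : prime_ideal P -> exists2 Q, prime_ideal Q & g @^-1` Q = P.
  move=> pP; have [|Q [pQ _ QE]] := lying_over g_integral (@zero_ideal A) pP; last
    by exists Q.
  move=> x /= gx; have -> : x = 0 by apply: inj; rewrite gx rmorph0.
  exact: ideal0 (prime_ideal_id pP).
have [Q1 pQ1 E1] := lift _ pP1; have [Q2 pQ2 E2] := lift _ pP2.
have pre (Q : set A) : phi @^-1` Q = f @^-1` (g @^-1` Q).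
  by apply/seteqP; split=> t /=; rewrite gf.
rewrite -E1 -E2; congr (_ @^-1` _).
by apply: (A_unique (c := c) (j := j)) => //; rewrite pre ?E1 ?E2.
Qed.

(** * The divisor of a linear form on a surface over the remaining forms *)

Section DivisorOfLinearForm.
Variables (c : 'I_d -> k) (j l : 'I_d) (s : seq 'I_d).
Hypotheses (sl : others j = rcons s l).
Local Notation q := (seq_ideal (map (lin c j) s)).
Local Notation u := (lin c j l).

Lemma rcons_notin : [/\ j \notin s, l \notin s, l != j & uniq s].
Proof.
have := others_uniq j; have := others_notin j; rewrite sl mem_rcons inE rcons_uniq.
by move=> /norP[jl js] /andP[ls us]; split=> //; rewrite eq_sym.
Qed.

Lemma others_adjoin : seq_ideal (map (lin c j) (others j)) = adjoin q u.
Proof. by rewrite sl map_rcons seq_ideal_rcons. Qed.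

Lemma q_prime : prime_ideal q.
Proof. by case: rcons_notin => js _ _ _; exact: lin_ideal_prime. Qed.

Lemma u_notin_q : ~ q u.
Proof. by case: rcons_notin => js ls lj _; exact: lin_notin. Qed.

Lemma size_s : size s = d.-2.
Proof. by have := others_size j; rewrite sl size_rcons => <-. Qed.

Variable Q : set R.
Hypotheses (pQ : prime_ideal Q) (QE : f @^-1` Q = q).

(** The generators of [q] are homogeneous, so [hpart] of [Q] already contracts to [q], and
    incomparability applies. *)
Lemma q_homogeneous : homogeneous_ideal grR Q.
Proof.
have idQ := prime_ideal_id pQ.
suff -> : Q = hpart hgR Q by exact: hpart_homogeneous.
apply: (incomparable_eq f_integral (hpart_prime hgR pQ) idQ (@hpart_sub _ _ hgR Q idQ)).
rewrite QE; apply: seq_ideal_le; first exact: preim_ideal (@hpart_ideal _ _ hgR Q idQ).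
move=> _ /mapP[i si ->]; apply: (@hpart_gen _ _ hgR Q (m * 1)%N _ idQ).
  by apply: (graded_homog hf.2); exact: lin_homog.
have : (f @^-1` Q) (lin c j i) by rewrite QE; apply: seq_ideal_gen; exact: map_f.
by [].
Qed.

(* Divide a relation modulo [Q] by [u] until some coefficient leaves [q + u T]. *)
Lemma divide_relation N n (v : 'I_N -> R) (t : 'I_N -> T) :
  (exists i, ~ q (t i) /\ (msize (lin_subst c j s (t i)) <= n)%N) ->
  Q (\sum_i f (t i) * v i) ->
  exists t' : 'I_N -> T, (exists i, ~ adjoin q u (t' i)) /\ Q (\sum_i f (t' i) * v i).
Proof.
have [js ls lj _] := rcons_notin; have [iq _ _] := q_prime.
have idQ := prime_ideal_id pQ.
have ker x : q x <-> lin_subst c j s x = 0 by rewrite lin_ideal_ker.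
elim: n t => [|n IH] t [i [ni sz]] rel.
  exfalso; apply: ni; apply/ker/eqP; rewrite -msize_poly_eq0 -leqn0; exact: sz.
have [ex|none] := pselect (exists i, ~ adjoin q u (t i)); first by exists t.
have hall i' : exists a, q (t i' - a * u).
  by apply: contrapT => h; apply: none; exists i'.
have [a ha] := choice hall.
have Qfu : ~ Q (f u).
  by move=> h; apply: u_notin_q; have : (f @^-1` Q) u by []; rewrite QE.
have nai : ~ q (a i).
  by move=> h; apply: ni; apply: (idealBr iq (ha i)); exact: (idealMr u iq h).
apply: (IH a).
  exists i; split=> //.
  (* The substitution fixes [u], a form of degree 1. So the degree of the image, that is, the degree
     modulo [q], drops with each division; this is the induction measure. *)
  have : lin_subst c j s (t i) = lin_subst c j s (a i) * u.
    have /ker := ha i; rewrite rmorphB rmorphM /= => /eqP; rewrite subr_eq0 => /eqP->.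
    by rewrite /lin rmorphB rmorphM /= lin_substC !lin_substX (negPf ls) (negPf js).
  move=> E; rewrite E in sz; rewrite -ltnS; apply: leq_trans sz.
  have u2 : (1 < msize u)%N.
    have <- : mdeg (mnm1 l) = 1%N by rewrite mdeg1.
    apply: msize_mdeg_lt;
      rewrite mcoeff_msupp /lin mcoeffB mul_mpolyC mcoeffZ !mcoeffX eqxx.
    have -> : (mnm1 j == mnm1 l :> multinom d) = false.
      apply/eqP => /(congr1 (fun b : multinom d => b l)); rewrite !mnm1E eqxx.
      by case: eqP => // e; rewrite e eqxx in lj.
    by rewrite mulr0 subr0 oner_eq0.
  have na0 : lin_subst c j s (a i) != 0 by apply/eqP => /ker.
  have u0 : u != 0 by rewrite -msize_poly_eq0 -lt0n ltnW.
  rewrite msizeM //; move: u2; case: (msize u) => [//|[//|e]] _.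
  by rewrite addnS /= addnS ltnS leq_addr.
have [_ _ QM] := pQ.
suff /QM[] : Q (f u * \sum_i' f (a i') * v i') by [].
apply: (idealBl idQ _ rel); rewrite mulr_sumr -sumrB; apply: ideal_sum => // i' _.
have -> : f (t i') * v i' - f u * (f (a i') * v i') = f (t i' - a i' * u) * v i'.
  by rewrite [f (t i' - _)]rmorphB [f (a i' * _)]rmorphM; ring.
apply: (idealMr _ idQ); have : (f @^-1` Q) (t i' - a i' * u) by rewrite QE.
by [].
Qed.

(** With [r] generators of [A] over [T], any [r + 1] elements of [R] satisfy a nontrivial relation
    over [T / q]; a prime [N] of [A] over [Q] carries it back to [R]. Division by [u] brings some
    coefficient outside [P]. Those in [P] lie in [q + u T], hence in [Q + u R], as [chain_bound]
    demands. *)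
Lemma bounded_relation (P : set R) : f @^-1` P = adjoin q u ->
  exists N, forall v : 'I_N -> R, exists t : 'I_N -> R, [/\ exists i, ~ P (t i),
     forall i, P (t i) -> adjoin Q (f u) (t i) & adjoin Q (f u) (\sum_i t i * v i)].
Proof.
move=> PE; have [_ _ fin] := noeth; have idQ := prime_ideal_id pQ.
have [r [e he]] := @finite_module_gen _ _ (phi : {rmorphism T -> A}) fin.
exists r.+1 => v.
have [B hB] := choice (fun i => he (g (v i))).
have [t [[i ni] ht]] := prime_dependent B q_prime.
have [|N [pN _ NE]] := lying_over g_integral (@zero_ideal A) pQ.
  move=> x /= gx; have -> : x = 0 by apply: hg.1; rewrite gx rmorph0.
  exact: ideal0.
have idN := prime_ideal_id pN.
have rel : Q (\sum_i f (t i) * v i).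
  rewrite -NE /= rmorph_sum.
  have -> : \sum_i g (f (t i) * v i) = \sum_b phi (\sum_i t i * B i b) * e b.
    transitivity (\sum_i \sum_b phi (t i) * (phi (B i b) * e b)).
      by apply: eq_bigr => i' _; rewrite rmorphM gf hB mulr_sumr.
    rewrite exchange_big /=; apply: eq_bigr => b _.
    rewrite rmorph_sum mulr_suml; apply: eq_bigr => i' _.
    by rewrite rmorphM mulrA.
  apply: ideal_sum => // b _; apply: idealMr => //; rewrite -gf.
  have : (f @^-1` (g @^-1` N)) (\sum_i t i * B i b) by rewrite NE QE; exact: ht.
  by [].
have [t' [[i' ni'] rel']] := divide_relation (ex_intro _ i (conj ni (leqnn _))) rel.
exists (fun i => f (t' i)); split.
- exists i'; move=> h; apply: ni'; rewrite -PE; exact: h.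
- move=> i'' h; have [a ha] : adjoin q u (t' i'') by rewrite -PE.
  exists (f a); rewrite -rmorphM -rmorphB.
  have : (f @^-1` Q) (t' i'' - a * u) by rewrite QE.
  by [].
- exact: adjoin_sub.
Qed.

(** A prime over [mpoly_plus] prolongs [Q] and [P] to length 2. A chain of length 3 above [Q],
    contracted and preceded by the [d - 2] linear steps up to [q], would have length [d + 1] in
    [T]. *)
Lemma Q_dim (P : set R) : prime_ideal P -> Q `<` P -> f @^-1` P `<` @mpoly_plus k d ->
  krull_dim (quotr Q) 2.
Proof.
move=> pP ltQP ltP; have idQ := prime_ideal_id pQ.
apply/(krull_dim_quotr idQ); split.
  have [P2 [pP2 ltP2 _]] :=
    going_up f_integral (prime_ideal_id pP) (@mpoly_plus_prime k d) ltP.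
  exists (fun i => if i is i.+1 then if i is 0 then P else P2 else Q).
  split=> -[|[|[|//]]] // _; split=> //; first exact: ltQP.1.
  by apply: subset_trans ltQP.1 ltP2.1.
move=> [c' sc].
have sc' : strict_chain (@prime_ideal R) 3 c' by split; [move=> i /sc.1[]|exact: sc.2].
have [js _ _ us] := rcons_notin.
have := strict_chain_cat (lin_chain c us js) (contract_chain f_integral sc').
rewrite take_size -QE => h.
have {}h := h (fun x => (sc.1 0%N isT).2 (f x)).
rewrite size_s in h; apply: (T_dim (c := _)).
have e : (d.-2 + 3 = d.+1)%N by move: d2; case: (d) => [|[|n]] //= _; rewrite addn3.
by rewrite e in h; exact: h.
Qed.

End DivisorOfLinearForm.

Lemma hprime_multiple (P : hprime grR 1) :
  exists2 n : nat, (0 < n)%N & lspan (@principal_cycles R grR 1) << n%:Z *g P >>.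
Proof.
have /asboolP[pP hP dimP] := svalP P; set P0 := sval P in pP hP dimP.
have [j [c pE]] := curve_contraction pP hP dimP.
have [l [s sl]] : exists l s, others j = rcons s l.
  case/lastP: (others j) (others_size j) => [|s l _]; last by exists l, s.
  by move=> /= e; move: d2; rewrite ltnNge -(ltn_predK (ltnW d2)) -e.
have pq := q_prime c sl.
have idP := prime_ideal_id pP.
have [|Q [pQ _ QE]] := lying_over f_integral (@zero_ideal R) pq.
  move=> x /= fx; have -> : x = 0 by apply: hf.1; rewrite fx rmorph0.
  exact: ideal0 (prime_ideal_id pq).
have idQ := prime_ideal_id pQ.
have padj := others_adjoin c sl; rewrite -pE in padj.
have uq := @u_notin_q c _ _ _ sl.
have sQP : Q `<=` P0.
  have [|P' [pP' sP' PE']] := lying_over f_integral idQ (preim_prime f pP).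
    by rewrite QE padj; apply: adjoin_sub; exact: prime_ideal_id.
  by rewrite (R_unique (c := c) (j := j) pP pP') // PE'.
have Pu : P0 (f (lin c j l)).
  have : (f @^-1` P0) (lin c j l) by rewrite padj; apply: adjoin_gen;
    exact: prime_ideal_id.
  by [].
have nQu : ~ Q (f (lin c j l)) by move=> h; apply: uq; rewrite -QE.
have ltQP : Q `<` P0 by split=> // /(_ _ Pu).
have hQ : `[< [/\ prime_ideal Q, homogeneous_ideal grR Q & krull_dim (quotr Q) 2] >].
  apply/asboolP; split=> //; first exact: (q_homogeneous (c := c) (j := j) (s :=
    s) pQ QE).
  exact: (Q_dim sl pQ QE pP ltQP (curve_ne_plus pP hP dimP)).
pose Q2 : hprime grR 2 := exist _ Q hQ.
exists (div_coef Q (f (lin c j l)) P0).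
  have [N hN] := bounded_relation sl pQ QE padj.
  exact: (div_coef_gt0 idQ pP sQP Pu hN).
rewrite -(@chow_div_single _ _ _ Q2) /=; last first.
  (* If [P'] contains [Q] and the form, its contraction contains that of [P]; equality follows from
     [curve_between], and [R_unique] gives [P' = P]. Otherwise some element of [Q + u R] is outside
     [P'] and the coefficient vanishes. *)
  move=> P' neP; have /asboolP[pP' hP' dimP'] := svalP P'.
  have [[sQP' Pu']|] := pselect (Q `<=` sval P' /\ sval P' (f (lin c j l))).
    exfalso; apply: neP; apply: hprime_inj; apply: (R_unique (c := c) (j := j)) => //.
    rewrite -pE; apply: contrapT => ne.
    apply: (curve_between pP dimP (q := f @^-1` sval P')); first exact: preim_prime.
      split; first by rewrite padj; apply: adjoin_le => //;
        [exact: preim_ideal (prime_ideal_id pP')|by rewrite -QE => x; exact: sQP'].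
      rewrite padj => h; apply: ne; apply/seteqP; split; first by rewrite padj.
      by rewrite padj; apply: adjoin_le => //;
        [exact: preim_ideal (prime_ideal_id pP')|rewrite -QE => x; exact: sQP'].
    exact: (curve_ne_plus pP' hP' dimP').
  move=> h; have [x [nx hx]] : exists x, ~ sval P' x /\ adjoin Q (f (lin c j l)) x.
    apply: contrapT => none; apply: h; split=> [x Qx|]; apply: contrapT => nx;
      apply: none.
      by exists x; split=> //; apply: adjoin_sub.
    by exists (f (lin c j l)); split=> //; apply: adjoin_gen.
  exact: (div_coef_eq0 idQ pP' nx hx).
apply: lspan_gen; exists Q2, (f (lin c j l)); split=> //.
by exists m; have := graded_homog hf.2 (lin_homog c j l); rewrite muln1.
Qed.

End FiniteExtension.

Theorem theorem1p3 (k : closedFieldType) (A : comAlgType k)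
    (grA : nat -> set A) (d m : nat) (X : 'I_d -> A)
    (R : comNzRingType) (grR : nat -> set R)
    (f : {rmorphism mpoly d k -> R}) (g : {rmorphism R -> A}) :
  grading grA ->
  grA 0%N = range (GRing.in_alg A) ->
  fg_algebra A ->
  (2 <= d)%N ->
  krull_dim A d ->
  cohen_macaulay A ->
  noether_normalization grA (fun=> m) X ->
  (forall u : (d.-1).-tuple (mpoly d k),
     [set` u] `<=` mpoly_grading k (fun=> m) m ->
     regular_seq (mpoly d k)^o u ->
     (associated_primes_height
        (lquot ([set mpoly_eval X v | v in [set` u]] : set A^o)) d.-1
      #= `I_1)%card) ->
  grading grR ->
  graded_inclusion (mpoly_grading k (fun=> m)) grR f ->
  graded_inclusion grR grA g ->
  (forall t, g (f t) = mpoly_eval X t) ->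
  grade_ge (restrict_scalars f)
    (irrelevant (mpoly_grading k (fun _ : 'I_d => m))) d.-1 ->
  torsion_group (chow grR 1).
Proof.
move=> hgA A0 _ d2 dimA cmA noeth uniqA hgR hf hg gf _.
apply: chow_torsion => P.
exact: (hprime_multiple hgA A0 d2 dimA cmA noeth uniqA hgR hf hg gf).
Qed.
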